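(* Let $\mathcal P$ and $\mathcal Q$ be Clements--Lindström posets. (1) Suppose $\mathcal P$ and $\mathcal Q$ have the same rank. Then the diamond product $\mathcal P\diamond\mathcal Q$ is Macaulay if and only if either $\mathcal P\cong\mathcal Q$, or one of $\mathcal P,\mathcal Q$ is a path and the other is two-dimensional with a side of length two. (2) Suppose $\mathcal P$ is the $m\times n$ and $\mathcal Q$ is the $m'\times n'$ Clements--Lindström poset, with $m\le n$, $m'\le n'$ and $m,m'>1$. Then the wedge product $\mathcal P\vee\mathcal Q$ is Macaulay if and only if either ($m\le m'$ and $n\le n'$) or ($m'\le m$ and $n'\le n$).
   Context: For positive integers $d_1,\dots,d_n$, the $d_1\times\cdots\times d_n$ Clements--Lindström poset is $\{\mathbf a\in\mathbb N^n: 0\le a_i<d_i\ \forall i\}$ with componentwise order (a product of chains with $d_1,\dots,d_n$ vertices; equivalently the nonzero monomials of $K[x_1,\ldots,x_n]/(x_1^{d_1},\ldots,x_n^{d_n})$ under divisibility). It is ranked by $a_1+\cdots+a_n$. Its dimension is the number of its elements of rank one (i.e. the number of $i$ with $d_i>1$); its side lengths are the $d_i>1$. A path is a one-dimensional Clements--Lindström poset, i.e. a finite chain. For a ranked poset $\mathcal R$, $\mathcal R_{[d]}$ is the set of elements of rank $d$; the rank of $\mathcal R$ is the largest rank of an element; for $A\subseteq\mathcal R$ the upper shadow is $\nabla A=\{b: b\text{ covers some }a\in A\}$. Given an additional total order on $\mathcal R$ (not required to be related to the partial order), $\mathrm{Seg}_d\,q$ denotes the set of the $q$ largest elements of $\mathcal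 R_{[d]}$ in the total order. $\mathcal R$ is Macaulay if there is a total order on $\mathcal R$ such that for every $d$ and every $A\subseteq\mathcal R_{[d]}$: (i) $|\nabla\mathrm{Seg}_d|A||\le|\nabla A|$, and (ii) $\nabla\mathrm{Seg}_d|A|=\mathrm{Seg}_{d+1}|\nabla\mathrm{Seg}_d|A||$. The wedge product $\mathcal P\vee\mathcal Q$ of posets with unique least elements is the disjoint union with the two least elements identified. The diamond product $\mathcal P\diamond\mathcal Q$ of ranked posets of the same rank with unique least and unique largest elements is the disjoint union with the two least elements identified and the two largest elements identified. In both, $a\le b$ iff $a\le b$ holds in $\mathcal P$ or in $\mathcal Q$; ranks are inherited. *)

(* Defs.v *)
From HB Require Import structures.
From mathcomp Require Import all_boot all_order.

Set Implicit Arguments.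
Unset Strict Implicit.
Unset Printing Implicit Defensive.

Import Order.TTheory.

Local Open Scope order_scope.

Definition covers (disp : Order.disp_t) (T : finPOrderType disp) (x y : T) :=
  (x < y) && [forall z, ~~ (x < z < y)].

HB.mixin Record FinPOrder_isRanked (disp : Order.disp_t) T
    of Order.FinPOrder disp T := {
  rank : T -> nat;
  rank_minimal : forall x : T, (forall y : T, ~~ (y < x)) -> rank x = 0%N;
  rank_covers : forall x y : T, covers x y -> rank y = (rank x).+1
}.

#[short(type="rankedType")]
HB.structure Definition Ranked disp :=
  { T of FinPOrder_isRanked disp T & Order.FinPOrder disp T }.

#[short(type="rankedBType")]
HB.structure Definition RankedB disp :=
  { T of FinPOrder_isRanked disp T & Order.FinBPOrder disp T }.

#[short(type="rankedTBType")]
HB.structure Definition RankedTB disp :=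
  { T of FinPOrder_isRanked disp T & Order.FinTBPOrder disp T }.

Section RankedPosets.
Variables (disp : Order.disp_t) (R : rankedType disp).
Implicit Types (A : {set R}) (ord : rel R).

Definition level (r : nat) : {set R} := [set x | rank x == r].

Definition poset_rank : nat := \max_(x : R) rank x.

Definition dimension : nat := #|level 1|.

Definition upper_shadow A : {set R} := [set y | [exists x in A, covers x y]].

(* x is among the q largest elements of its level iff fewer than q elements
   of that level are larger; this is the whole level if q exceeds its size,
   see card_seg. *)
Definition seg ord (r q : nat) : {set R} :=
  [set x in level r |
    (#|[set y in level r | (y != x) && ord x y]| < q)%N].

Definition macaulay : Prop :=
  exists ord : rel R,
    [/\ total ord, antisymmetric ord, transitive ord &
        forall (r : nat) A, A \subset level r ->
          (#|upper_shadow (seg ord r #|A|)| <= #|upper_shadow A|)%N /\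
          upper_shadow (seg ord r #|A|)
            = seg ord r.+1 #|upper_shadow (seg ord r #|A|)|].

Lemma card_seg ord (r q : nat) :
  total ord -> antisymmetric ord -> transitive ord ->
  #|seg ord r q| = minn q #|level r|.
Proof.
move=> ord_tot ord_anti ord_tr; pose L := level r.
have ord_refl : reflexive ord by move=> x; have := ord_tot x x; rewrite orbb.
pose above x := [set y in L | (y != x) && ord x y].
have aboveP x y : y \in L -> x \in L -> y \in above x -> above y \proper above x.
  move=> yL xL; rewrite inE => /and3P[_ yx xy]; apply/properP; split.
    apply/subsetP=> z; rewrite !inE => /and3P[-> zy yz] /=.
    rewrite (ord_tr _ _ _ xy yz) andbT; apply: contraNneq yx => zx.
    by apply/eqP/ord_anti; rewrite xy -zx yz.
  exists y; first by rewrite !inE yx xy; move: yL; rewrite inE => ->.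
  by rewrite !inE eqxx andbF.
have lt_above x : x \in L -> (#|above x| < #|L|)%N.
  move=> xL; apply: proper_card; apply/properP; split.
    by apply/subsetP=> y; rewrite inE => /andP[].
  by exists x => //; rewrite !inE eqxx andbF.
have inj : {in L &, injective (fun x => #|above x|)}.
  move=> x y xL yL /= Exy; apply/eqP/negPn/negP => nxy.
  have /orP[xy|yx] := ord_tot x y.
    have yx : y \in above x by rewrite inE yL eq_sym nxy.
    by have /proper_card := aboveP _ _ yL xL yx; rewrite Exy ltnn.
  have xy : x \in above y by rewrite inE xL nxy.
  by have /proper_card := aboveP _ _ xL yL xy; rewrite Exy ltnn.
pose f (x : R) : 'I_#|L|.+1 := inord #|above x|.
have fE x : x \in L -> f x = #|above x| :> nat.
  by move=> xL; rewrite inordK // ltnS ltnW ?lt_above.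
have finj : {in L &, injective f}.
  by move=> x y xL yL /(congr1 val) /=; rewrite !fE //; apply: inj.
have fL : f @: L = [set i : 'I_#|L|.+1 | (i < #|L|)%N].
  apply/eqP; rewrite eqEcard; apply/andP; split.
    by apply/subsetP=> _ /imsetP[x xL ->]; rewrite inE fE ?lt_above.
  rewrite card_in_imset // (_ : [set i : 'I__ | _] = [set~ ord_max]).
    by rewrite cardsC1 card_ord.
  apply/setP=> i; rewrite !inE -val_eqE /= ltn_neqAle.
  by rewrite -ltnS ltn_ord andbT.
have -> : seg ord r q = [set x in L | (f x < q)%N].
  by apply/setP=> x; rewrite !inE; case xL: (_ == _) => //=; rewrite fE ?inE.
rewrite -(@card_in_imset _ _ f); last first.
  by move=> x y; rewrite !inE => /andP[+ _] /andP[+ _] => *; apply: finj;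
     rewrite ?inE.
rewrite (_ : f @: _ = [set i : 'I_#|L|.+1 | (i < minn q #|L|)%N]).
  rewrite -sum1dep_card -(big_ord_widen _ (fun=> 1%N)) ?sum1_card ?card_ord //.
  by rewrite (leq_trans (geq_minr _ _)).
apply/setP=> i; rewrite inE leq_min; apply/imsetP/andP => [[x]|[iq iL]].
  by rewrite inE => /andP[xL xq] ->; rewrite xq fE ?lt_above.
have : i \in f @: L by rewrite fL inE.
by case/imsetP=> x xL Ei; exists x => //; rewrite inE xL -Ei.
Qed.

End RankedPosets.

Arguments level {disp} R r.
Arguments poset_rank {disp} R.
Arguments dimension {disp} R.
Arguments macaulay {disp} R.

Definition poset_iso (dP dQ : Order.disp_t)
    (P : porderType dP) (Q : porderType dQ) : Prop :=
  exists2 f : P -> Q, bijective f & {mono f : x y / x <= y}.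

Section RankTheory.
Variables (disp : Order.disp_t).

Lemma rank_mono (R : rankedType disp) (x y : R) :
  x <= y -> (rank x <= rank y)%N.
Proof.
have [n] := ubnP #|[set z : R | x < z < y]|.
elim: n x y => // n IHn x y lt_n; rewrite le_eqVlt => /orP[/eqP->//|ltxy].
have [cov|] := boolP (covers x y); first by rewrite (rank_covers _ _ cov).
rewrite /covers ltxy /= negb_forall => /existsP[z]; rewrite negbK => /andP[xz zy].
have hz (a b : R) : x <= a -> b <= y -> ~~ (a < z < b) -> 
    (#|[set t : R | (a < t < b)%O]| < n)%N.
  move=> xa yb nz; apply: (@leq_trans #|[set t : R | x < t < y]|) => //.
  apply: proper_card; apply/properP; split.
    apply/subsetP=> t; rewrite !inE => /andP[at_ tb].
    by rewrite (le_lt_trans xa at_) (lt_le_trans tb yb).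
  by exists z; rewrite !inE ?xz ?zy.
apply: (@leq_trans (rank z)); apply: IHn; rewrite ?ltW //; apply: hz => //.
- exact: ltW.
- by rewrite ltxx andbF.
- exact: ltW.
- by rewrite ltxx.
Qed.

Lemma rank_bot (R : rankedBType disp) : rank (\bot : R) = 0%N.
Proof. by apply: rank_minimal => y; rewrite ltx0. Qed.

Lemma rank_top (R : rankedTBType disp) : rank (\top : R) = poset_rank R.
Proof.
apply/eqP; rewrite eqn_leq leq_bigmax /=.
by apply/bigmax_leqP => x _; rewrite rank_mono ?lex1.
Qed.

Lemma rank0_bot_top (R : rankedTBType disp) :
  (poset_rank R == 0%N) = (\bot == \top :> R).
Proof.
rewrite -rank_top; apply/idP/eqP => [|<-]; last by rewrite rank_bot.
apply: contraTeq => neq; have: (\bot : R) < \top by rewrite lt_neqAle neq le0x.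
move: (\bot : R) => b; have [n] := ubnP #|[set z : R | b < z]|.
elim: n b => // n IHn b le_n ltb.
have [cov|] := boolP (covers b \top); first by rewrite (rank_covers _ _ cov).
rewrite /covers ltb negb_forall => /existsP[z]; rewrite negbK => /andP[bz zt].
apply: IHn zt; apply: (@leq_trans #|[set t : R | b < t]|) => //.
apply: proper_card; apply/properP; split; last by exists z; rewrite inE ?bz ?ltxx.
by apply/subsetP=> t; rewrite !inE; apply: lt_trans.
Qed.

End RankTheory.

Section ClementsLindstrom.
Variables (n : nat) (d : n.-tuple nat).

(* The positivity proof is a parameter because the poset needs a least
   element; n = 0 is allowed and gives the one-point poset. *)
Definition clements_lindstrom of (forall i, 0 < tnth d i)%N : Type :=
  {dffun forall i : 'I_n, 'I_(tnth d i)}.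

Fact cl_display : Order.disp_t. Proof. exact: Order.Disp tt tt. Qed.

Variable d_gt0 : (forall i, 0 < tnth d i)%N.
Local Notation CL := (clements_lindstrom d_gt0).

HB.instance Definition _ := Finite.on CL.

Definition cl_coord (a : CL) (i : 'I_n) : nat :=
  (a : {dffun forall i : 'I_n, 'I_(tnth d i)}) i.

Definition cl_le (a b : CL) : bool :=
  [forall i, cl_coord a i <= cl_coord b i]%N.

Definition cl_rank (a : CL) : nat := (\sum_(i < n) cl_coord a i)%N.

Lemma cl_coord_inj (a b : CL) : cl_coord a =1 cl_coord b -> a = b.
Proof. by move=> eq_ab; apply/ffunP => i; apply/val_inj/eq_ab. Qed.

Fact cl_le_refl : reflexive cl_le.
Proof. by move=> a; apply/forallP. Qed.

Fact cl_le_anti : antisymmetric cl_le.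
Proof.
move=> a b /andP[/forallP ab /forallP ba]; apply: cl_coord_inj => i.
by apply/eqP; rewrite eqn_leq ab ba.
Qed.

Fact cl_le_trans : transitive cl_le.
Proof.
move=> b a c /forallP ab /forallP bc; apply/forallP => i.
exact: leq_trans (ab i) (bc i).
Qed.

HB.instance Definition _ :=
  Order.Le_isPOrder.Build cl_display CL cl_le_refl cl_le_anti cl_le_trans.

Definition cl_bot : CL := [ffun i => Ordinal (d_gt0 i)].

Fact cl_top_subproof i : ((tnth d i).-1 < tnth d i)%N.
Proof. by rewrite ltn_predL. Qed.

Definition cl_top : CL := [ffun i => Ordinal (cl_top_subproof i)].

Fact cl_le0x (a : CL) : cl_bot <= a.
Proof. by apply/forallP => i; rewrite /cl_coord ffunE. Qed.

Fact cl_lex1 (a : CL) : a <= cl_top.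
Proof.
apply/forallP => i; rewrite /cl_coord [cl_top i]ffunE /=.
by rewrite -ltnS prednK // ltn_ord.
Qed.

HB.instance Definition _ := Order.hasBottom.Build cl_display CL cl_le0x.
HB.instance Definition _ := Order.hasTop.Build cl_display CL cl_lex1.

Fact cl_rank_minimal (a : CL) : (forall b : CL, ~~ (b < a)) -> cl_rank a = 0%N.
Proof.
move=> /(_ \bot); rewrite lt0x negbK => /eqP ->.
by rewrite /cl_rank big1 // => i _; rewrite /cl_coord ffunE.
Qed.

Fact cl_rank_covers (a b : CL) : covers a b -> cl_rank b = (cl_rank a).+1.
Proof.
case/andP => /[dup] ltab; rewrite lt_neqAle => /andP[neab /forallP leab].
have [i lti] : exists i, (cl_coord a i < cl_coord b i)%N.
  apply/existsP; apply: contraNT neab; rewrite negb_exists => /forallP geab.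
  apply/eqP/cl_coord_inj => i; apply/eqP.
  by rewrite eqn_leq leab leqNgt geab.
pose m j := if j == i then (cl_coord a j).+1 else cl_coord a j.
have m_lt j : (m j < tnth d j)%N.
  rewrite /m; case: eqP => [->|_]; last exact: ltn_ord.
  exact: leq_ltn_trans lti (ltn_ord _).
pose e : CL := [ffun j => Ordinal (m_lt j)].
have eE j : cl_coord e j = m j by rewrite /cl_coord ffunE.
have lt_ae : a < e.
  rewrite lt_neqAle; apply/andP; split.
    apply/eqP => Eae; have := eE i; rewrite -Eae /m eqxx => /eqP.
    by rewrite -[X in X == _]addn0 -addn1 eqn_add2l.
  by apply/forallP => j; rewrite eE /m; case: eqP.
have le_eb : e <= b.
  by apply/forallP => j; rewrite eE /m; case: eqP => [->//|_]; apply: leab.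
move=> /forallP /(_ e); rewrite lt_ae /= lt_neqAle le_eb andbT negbK => /eqP <-.
rewrite /cl_rank (bigD1 i) //= [in RHS](bigD1 i) //= eE /m eqxx addSn.
congr (_ + _).+1; apply: eq_bigr => j /negbTE nji.
by rewrite eE /m nji.
Qed.

HB.instance Definition _ :=
  FinPOrder_isRanked.Build cl_display CL cl_rank_minimal cl_rank_covers.

Lemma cl_leE (a b : CL) :
  (a <= b) = [forall i, cl_coord a i <= cl_coord b i]%N.
Proof. by []. Qed.

Lemma cl_rankE (a : CL) : rank a = (\sum_(i < n) cl_coord a i)%N.
Proof. by []. Qed.

End ClementsLindstrom.

Section Grid.
Variables (m n : nat).

Fact grid_gt0 : (1 < m)%N -> (m <= n)%N ->
  forall i, (0 < tnth [tuple m; n] i)%N.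
Proof.
move=> m_gt1 le_mn i; have m_gt0 := ltnW m_gt1.
have: tnth [tuple m; n] i \in [tuple m; n] by apply: mem_tnth.
by rewrite !inE => /orP[]/eqP-> //; apply: leq_trans le_mn.
Qed.

Definition grid (m_gt1 : (1 < m)%N) (le_mn : (m <= n)%N) :=
  clements_lindstrom (grid_gt0 m_gt1 le_mn).

End Grid.

(* The order of a poset D covered by copies f(P) and g(Q) of P and Q:
   x <= y iff this holds in P or in Q. *)
Definition glue_le (dP dQ : Order.disp_t)
    (P : finPOrderType dP) (Q : finPOrderType dQ) (D : finType)
    (f : P -> D) (g : Q -> D) : rel D := fun x y =>
  [exists a, exists b, [&& x == f a, y == f b & a <= b]] ||
  [exists a, exists b, [&& x == g a, y == g b & a <= b]].

Section GlueTheory.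
Variables (dP dQ : Order.disp_t) (P : finPOrderType dP) (Q : finPOrderType dQ).
Variables (D : finType) (f : P -> D) (g : Q -> D).
Hypotheses (f_inj : injective f) (g_inj : injective g).
Hypothesis fg_surj : forall x, (exists p, x = f p) \/ (exists q, x = g q).
Hypothesis fg_meet : forall p q, f p = g q ->
  ((forall p', p <= p') /\ (forall q', q <= q')) \/
  ((forall p', p' <= p) /\ (forall q', q' <= q)).
Local Notation gle := (glue_le f g).

Lemma glue_leP x y :
  reflect ((exists a b, [/\ x = f a, y = f b & a <= b]) \/
           (exists a b, [/\ x = g a, y = g b & a <= b])) (gle x y).
Proof.
apply: (iffP orP) => -[].
- by case/existsP=> a /existsP[b /and3P[/eqP-> /eqP-> ab]]; left; exists a, b.
- by case/existsP=> a /existsP[b /and3P[/eqP-> /eqP-> ab]]; right; exists a, b.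
- case=> a [b [-> -> ab]]; left; apply/existsP; exists a; apply/existsP.
  by exists b; rewrite !eqxx.
case=> a [b [-> -> ab]]; right; apply/existsP; exists a; apply/existsP.
by exists b; rewrite !eqxx.
Qed.

Lemma glue_le_refl : reflexive gle.
Proof.
move=> x; apply/glue_leP; case: (fg_surj x) => -[p ->]; [left|right];
by exists p, p.
Qed.

Lemma glue_le_anti : antisymmetric gle.
Proof.
move=> x y /andP[/glue_leP + /glue_leP].
case=> -[a [b [-> -> ab]]] [] [c [d [Ec Ed cd]]].
- by move/f_inj: Ec cd => <-; move/f_inj: Ed => <- ba;
     congr f; apply/le_anti; rewrite ab.
- have [] := fg_meet Ed => -[exta extd].
    by rewrite Ec Ed; congr g; apply/le_anti; rewrite extd cd.
  by congr f; apply/le_anti; rewrite ab exta.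
- have [] := fg_meet (esym Ed) => -[extd exta].
    by rewrite Ec Ed; congr f; apply/le_anti; rewrite extd cd.
  by congr g; apply/le_anti; rewrite ab exta.
by move/g_inj: Ec cd => <-; move/g_inj: Ed => <- ba;
   congr g; apply/le_anti; rewrite ab.
Qed.

Lemma glue_le_trans : transitive gle.
Proof.
move=> y x z /glue_leP + /glue_leP.
case=> -[a [b [-> -> ab]]] [] [c [d [Ec -> cd]]]; apply/glue_leP.
- by left; exists a, d; split=> //; move/f_inj: Ec ab => -> /le_trans; apply.
- have [] := fg_meet Ec => -[extb extc].
    right; exists c, d; split=> //; rewrite -Ec; congr f.
    by apply/le_anti; rewrite ab extb.
  left; exists a, b; split=> //; rewrite Ec; congr g.
  by apply/le_anti; rewrite cd extc.
- have [] := fg_meet (esym Ec) => -[extc extb].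
    left; exists c, d; split=> //; rewrite -Ec; congr g.
    by apply/le_anti; rewrite ab extb.
  right; exists a, b; split=> //; rewrite Ec; congr f.
  by apply/le_anti; rewrite cd extc.
by right; exists a, d; split=> //; move/g_inj: Ec ab => -> /le_trans; apply.
Qed.

End GlueTheory.

Section GlueRank.
Variables (dP dQ dD : Order.disp_t) (P : rankedType dP) (Q : rankedType dQ).
Variables (D : finPOrderType dD) (f : P -> D) (g : Q -> D).
Hypotheses (f_inj : injective f) (g_inj : injective g).
Hypothesis fg_surj : forall x, (exists p, x = f p) \/ (exists q, x = g q).
Hypothesis leE : forall x y : D, (x <= y) = glue_le f g x y.
Variable r : D -> nat.
Hypotheses (r_f : forall p, r (f p) = rank p) (r_g : forall q, r (g q) = rank q).

Lemma glue_lt_f (p p' : P) : p < p' -> f p < f p'.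
Proof.
rewrite !lt_neqAle (inj_eq f_inj) => /andP[-> le_pp'] /=.
by rewrite leE; apply/glue_leP; left; exists p, p'.
Qed.

Lemma glue_lt_g (q q' : Q) : q < q' -> g q < g q'.
Proof.
rewrite !lt_neqAle (inj_eq g_inj) => /andP[-> le_qq'] /=.
by rewrite leE; apply/glue_leP; right; exists q, q'.
Qed.

Lemma glue_rank_minimal (x : D) : (forall y, ~~ (y < x)) -> r x = 0%N.
Proof.
case: (fg_surj x) => -[p ->] minx; rewrite ?r_f ?r_g; apply: rank_minimal => y.
  by apply: contra (minx (f y)); apply: glue_lt_f.
by apply: contra (minx (g y)); apply: glue_lt_g.
Qed.

Lemma glue_rank_covers (x y : D) : covers x y -> r y = (r x).+1.
Proof.
case/andP; rewrite lt_neqAle leE => /andP[nxy /glue_leP[]] [a [b [Ex Ey ab]]];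
  move: nxy; rewrite {}Ex {}Ey ?r_f ?r_g => nab /forallP cov;
  apply: rank_covers; rewrite /covers lt_neqAle ab andbT.
  rewrite (contraNneq _ nab) => [/=|->//]; apply/forallP => c.
  by apply: contra (cov (f c)) => /andP[ac cb]; rewrite !glue_lt_f.
rewrite (contraNneq _ nab) => [/=|->//]; apply/forallP => c.
by apply: contra (cov (g c)) => /andP[ac cb]; rewrite !glue_lt_g.
Qed.

End GlueRank.

Section Wedge.
Variables (dP dQ : Order.disp_t) (P : rankedBType dP) (Q : rankedBType dQ).

(* The class of the identified least elements is represented by inl \bot. *)
Definition wedge : Type := (P + {q : Q | q != \bot})%type.

HB.instance Definition _ := Finite.on wedge.

Definition wedge_l (p : P) : wedge := inl p.
Definition wedge_r (q : Q) : wedge :=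
  if insub q is Some u then inr u else inl \bot.

Fact wedge_display : Order.disp_t. Proof. exact: Order.Disp tt tt. Qed.

Definition wedge_rank (x : wedge) : nat :=
  match x with inl p => rank p | inr u => rank (val u) end.

Lemma wedge_bot : wedge_l \bot = wedge_r \bot.
Proof. by rewrite /wedge_r insubF ?eqxx. Qed.

Lemma wedge_l_inj : injective wedge_l. Proof. by move=> p p' []. Qed.

Lemma wedge_r_inj : injective wedge_r.
Proof.
move=> q q'; rewrite /wedge_r; case: insubP => [u _ <-|]; case: insubP => //.
  by move=> v _ <- [->].
by rewrite !negbK => /eqP-> /eqP->.
Qed.

Lemma wedge_surj (x : wedge) :
  (exists p, x = wedge_l p) \/ (exists q, x = wedge_r q).
Proof.
case: x => [p|u]; [by left; exists p | right; exists (val u)].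
by rewrite /wedge_r valK.
Qed.

Lemma wedge_meet (p : P) (q : Q) :
  wedge_l p = wedge_r q -> p = \bot /\ q = \bot.
Proof.
by rewrite /wedge_r /wedge_l; case: insubP => //; rewrite negbK => /eqP-> [->].
Qed.

Lemma wedge_meet_extremal (p : P) (q : Q) : wedge_l p = wedge_r q ->
  ((forall p', p <= p') /\ (forall q', q <= q')) \/
  ((forall p', p' <= p) /\ (forall q', q' <= q)).
Proof. by case/wedge_meet=> -> ->; left; split=> ?; apply: le0x. Qed.

HB.instance Definition _ := Order.Le_isPOrder.Build wedge_display wedge
  (glue_le_refl wedge_surj)
  (glue_le_anti wedge_l_inj wedge_r_inj wedge_meet_extremal)
  (glue_le_trans wedge_l_inj wedge_r_inj wedge_meet_extremal).

Lemma wedge_rank_l (p : P) : wedge_rank (wedge_l p) = rank p.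
Proof. by []. Qed.

Lemma wedge_rank_r (q : Q) : wedge_rank (wedge_r q) = rank q.
Proof.
rewrite /wedge_r; case: insubP => [u _ <- //|].
by rewrite negbK => /eqP->; rewrite /= !rank_bot.
Qed.

HB.instance Definition _ := FinPOrder_isRanked.Build wedge_display wedge
  (glue_rank_minimal wedge_l_inj wedge_r_inj wedge_surj (fun _ _ => erefl)
     wedge_rank_l wedge_rank_r)
  (glue_rank_covers wedge_l_inj wedge_r_inj (fun _ _ => erefl)
     wedge_rank_l wedge_rank_r).

Lemma wedge_leE (x y : wedge) : (x <= y) = glue_le wedge_l wedge_r x y.
Proof. by []. Qed.

Lemma wedge_rankE (x : wedge) : rank x = wedge_rank x.
Proof. by []. Qed.

End Wedge.

Section Diamond.
Variables (dP dQ : Order.disp_t) (P : rankedTBType dP) (Q : rankedTBType dQ).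

(* The classes of the identified least and largest elements are represented
   by inl \bot and inl \top. *)
Definition diamond of poset_rank P = poset_rank Q : Type :=
  (P + {q : Q | (q != \bot) && (q != \top)})%type.

Fact diamond_display : Order.disp_t. Proof. exact: Order.Disp tt tt. Qed.

Variable eq_rk : poset_rank P = poset_rank Q.
Local Notation PdQ := (diamond eq_rk).

HB.instance Definition _ := Finite.on PdQ.

Definition diamond_l (p : P) : PdQ := inl p.
Definition diamond_r (q : Q) : PdQ :=
  if insub q is Some u then inr u
  else if q == \bot then inl \bot else inl \top.

Definition diamond_rank (x : PdQ) : nat :=
  match x with inl p => rank p | inr u => rank (val u) end.

Lemma diamond_trivial : (\bot == \top :> P) = (\bot == \top :> Q).
Proof. by rewrite -!rank0_bot_top eq_rk. Qed.

Lemma diamond_bot : diamond_l \bot = diamond_r \bot.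
Proof. by rewrite /diamond_r insubF !eqxx. Qed.

Lemma diamond_top : diamond_l \top = diamond_r \top.
Proof.
rewrite /diamond_r insubF ?eqxx ?andbF //; case: eqP => // /eqP.
by rewrite eq_sym -diamond_trivial => /eqP->.
Qed.

Lemma diamond_l_inj : injective diamond_l. Proof. by move=> p p' []. Qed.

Lemma diamond_meet (p : P) (q : Q) : diamond_l p = diamond_r q ->
  (p = \bot /\ q = \bot) \/ (p = \top /\ q = \top).
Proof.
rewrite /diamond_r; case: insubP => //; rewrite negb_and !negbK.
by case: eqP => [-> _ [->]|_ /eqP-> [->]]; [left|right].
Qed.

Lemma diamond_r_inj : injective diamond_r.
Proof.
move=> q q'; rewrite {1}/diamond_r; case: insubP => [u _ <-|].
  rewrite /diamond_r; case: insubP => [v _ <- [->] //|].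
  by case: ifP.
rewrite negb_and !negbK => bt E.
have Er : diamond_r q = diamond_r q'.
  by rewrite -E /diamond_r insubF //; apply/negbTE; rewrite negb_and !negbK.
have [Eq|ntop] := eqVneq q \bot.
  move: Er; rewrite Eq -diamond_bot => /diamond_meet[][Eb ->] //.
  by apply/eqP; rewrite -diamond_trivial Eb.
move: bt Er; rewrite (negbTE ntop) /= => /eqP->.
rewrite -diamond_top => /diamond_meet[][Eb ->] //.
by apply/eqP; rewrite eq_sym -diamond_trivial Eb.
Qed.

Lemma diamond_surj (x : PdQ) :
  (exists p, x = diamond_l p) \/ (exists q, x = diamond_r q).
Proof.
case: x => [p|u]; [by left; exists p | right; exists (val u)].
by rewrite /diamond_r valK.
Qed.

Lemma diamond_meet_extremal (p : P) (q : Q) : diamond_l p = diamond_r q ->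
  ((forall p', p <= p') /\ (forall q', q <= q')) \/
  ((forall p', p' <= p) /\ (forall q', q' <= q)).
Proof.
by case/diamond_meet=> -[-> ->]; [left|right]; split=> ?; rewrite ?le0x ?lex1.
Qed.

HB.instance Definition _ := Order.Le_isPOrder.Build diamond_display PdQ
  (glue_le_refl diamond_surj)
  (glue_le_anti diamond_l_inj diamond_r_inj diamond_meet_extremal)
  (glue_le_trans diamond_l_inj diamond_r_inj diamond_meet_extremal).

Lemma diamond_rank_l (p : P) : diamond_rank (diamond_l p) = rank p.
Proof. by []. Qed.

Lemma diamond_rank_r (q : Q) : diamond_rank (diamond_r q) = rank q.
Proof.
rewrite /diamond_r; case: insubP => [u _ <- //|].
rewrite negb_and !negbK; case: eqP => [-> _|_ /eqP->] /=.
  by rewrite !rank_bot.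
by rewrite !rank_top.
Qed.

HB.instance Definition _ := FinPOrder_isRanked.Build diamond_display PdQ
  (glue_rank_minimal diamond_l_inj diamond_r_inj diamond_surj
     (fun _ _ => erefl) diamond_rank_l diamond_rank_r)
  (glue_rank_covers diamond_l_inj diamond_r_inj (fun _ _ => erefl)
     diamond_rank_l diamond_rank_r).

Lemma diamond_leE (x y : PdQ) : (x <= y) = glue_le diamond_l diamond_r x y.
Proof. by []. Qed.

Lemma diamond_rankE (x : PdQ) : rank x = diamond_rank x.
Proof. by []. Qed.

End Diamond.

(* Main.v *)
(* Part (1), sufficiency, rests on the Clements-Lindstrom theorem, proved by induction
   on the dimension: maximizing the total position in the order under 2-dimensional and
   (n-1)-dimensional compressions makes a set closed under trading the longest
   coordinate for any other one, and for such a set the size of the shadow is determined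
   by its first layer, its last layer and its size. For two copies of the same poset P,
   the two parts of a level are placed on the two middle elements of the square 2 x 2,
   below a full level of P on its top element; so the diamond inherits the
   Clements-Lindstrom theorem for P x 2 x 2.

   Necessity compares numbers of elements of corank one above sets of atoms. If P has fewer
   atoms than Q, the atoms of P must come first, and the first |Q_1| atoms then have
   too many coatoms above them, except for a path and a 2 x n rectangle. If the numbers
   of atoms agree but |P_r| < |Q_r| for some r, the atoms of P come first, and the
   first |Q_r| elements of corank r have too many coatoms above them. Thus all
   level sizes agree, which determines the side lengths by roots of unity.

   Part (2): in a rectangle with sides e <= d, |shadow A| - |A| is at least
   1 below rank e - 1, 0 afterwards, and from rank d - 1 on it is -1 for the full
   level only; initial segments attain these bounds. *)
Require Import Defs.
From HB Require Import structures.
From mathcomp Require Import all_boot all_order all_algebra all_field.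
From mathcomp Require Import zify.

Set Implicit Arguments.
Unset Strict Implicit.
Unset Printing Implicit Defensive.

(** Trading a unit of the first coordinate for another one changes only two coordinates, so it stays
    inside a slice spanned by coordinates 1 and 2 or by all coordinates but the second; hence two
    compressions suffice. In dimension two the first slice is everything, so rectangles are settled
    by hand. There the longer side must be the less significant one: in the box [[:: 2; 4]] the
    first element of rank 2 is (0, 2), with two upper covers, while (1, 1) has one. Away from the
    identified elements a level of a diamond or wedge is a disjoint union. For sufficiency the order
    exhausts one poset before it enters the other, and what remains is an inequality between sums of
    two shadow sizes. Necessity works with iterated shadows because coatoms are rigid: a coatom
    fails to lie above an atom only if both belong to the same side and that side has length two. A
    nonempty set of atoms thus misses at most one coatom of its poset, and the counts have almost no
    slack. This is the origin of the side of length two in the exceptional case. *)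

Lemma leq_card_rel (T U : finType) (A : {set T}) (B : {set U}) (F : T -> U -> Prop) :
  (forall x, x \in A -> exists2 y, y \in B & F x y) ->
  (forall x x' y, x \in A -> x' \in A -> F x y -> F x' y -> x = x') ->
  #|A| <= #|B|.
Proof.
move=> exF injF.
have [f fP] : exists f : {x | x \in A} -> U, forall u, f u \in B /\ F (val u) (f u).
  apply: (@fin_all_exists _ (fun=> U) (fun u y => y \in B /\ F (val u) y)) => u.
  by have [y yB Fy] := exF _ (valP u); exists y.
have f_inj : injective f.
  move=> u v Euv; apply: val_inj; apply: (injF _ _ (f u)) (valP u) (valP v) _ _.
    by case: (fP u).
  by rewrite Euv; case: (fP v).
rewrite -(card_sig (mem A)) -(card_codom f_inj).
by apply: subset_leq_card; apply/subsetP=> _ /codomP[u ->]; case: (fP u).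
Qed.

(* A ranked relation together with the total order given by [key]; Macaulay orders
   are compared levelwise, so only the order of [key] inside a level matters. *)
Record kgraph := KGraph {
  vert :> finType;
  rk : vert -> nat;
  le : rel vert;
  key : vert -> nat;
  kbound : nat;
  le_refl : reflexive le;
  le_rk : forall x y, le x y -> x = y \/ rk x < rk y;
  key_inj : injective key;
  key_lt : forall x, key x < kbound }.

(** * Initial segments of a level *)

Section Segments.
Variable X : kgraph.
Implicit Types (x y z : X) (A B S : {set X}) (r q : nat).

Definition cov x y := le x y && (rk y == (rk x).+1).

Definition lev r : {set X} := [set x | rk x == r].

Definition shadow A : {set X} := [set y | [exists x in A, cov x y]].

(** Segments start at the largest keys, in agreement with [seg]. *)
Definition ini r S :=
  (S \subset lev r) && [forall x in S, forall y in lev r, (key x <= key y) ==> (y \in S)].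

(** Condition (ii) reduces to the shadow being a segment again, since a segment is determined by its
    level and its size ([ini_eq]). *)
Definition Mac :=
  (forall r S, ini r S -> ini r.+1 (shadow S)) /\
  (forall r A S, A \subset lev r -> ini r S -> #|S| = #|A| ->
     #|shadow S| <= #|shadow A|).

Lemma iniP r S :
  reflect ((forall x, x \in S -> rk x = r) /\
           (forall x y, x \in S -> rk y = r -> key x <= key y -> y \in S))
          (ini r S).
Proof.
apply: (iffP andP) => -[sub up]; split.
- by move=> x /(subsetP sub); rewrite inE => /eqP.
- move=> x y xS ry kxy; move/forall_inP/(_ x xS)/forall_inP: up => /(_ y).
  by rewrite inE ry eqxx kxy => /(_ isT).
- by apply/subsetP=> x /sub rx; rewrite inE rx.
apply/forall_inP=> x xS; apply/forall_inP=> y; rewrite inE => /eqP ry.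
by apply/implyP; apply: up xS ry.
Qed.

Lemma shadowP A y : reflect (exists2 x, x \in A & cov x y) (y \in shadow A).
Proof. by rewrite inE; apply: exists_inP. Qed.

Lemma cov_rk x y : cov x y -> rk y = (rk x).+1.
Proof. by case/andP=> _ /eqP. Qed.

Lemma cov_le x y : cov x y -> le x y.
Proof. by case/andP. Qed.

Lemma shadowS A B : A \subset B -> shadow A \subset shadow B.
Proof.
move=> sAB; apply/subsetP=> y /shadowP[x xA xy]; apply/shadowP.
by exists x; rewrite ?(subsetP sAB).
Qed.

Lemma shadow_lev r A : A \subset lev r -> shadow A \subset lev r.+1.
Proof.
move=> sA; apply/subsetP=> y /shadowP[x /(subsetP sA)]; rewrite !inE.
by move=> /eqP <- /cov_rk ->.
Qed.

Lemma shadow0 : shadow set0 = set0.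
Proof. by apply/setP=> y; rewrite inE [RHS]inE; apply/existsP=> -[x]; rewrite inE. Qed.

Lemma ini_lev r S : ini r S -> S \subset lev r.
Proof. by case/andP. Qed.

Lemma ini_full r : ini r (lev r).
Proof.
by apply/iniP; split=> [x|x y _]; rewrite inE => /eqP.
Qed.

Lemma ini0 r : ini r set0.
Proof. by apply/iniP; split=> [x|x y]; rewrite inE. Qed.

Lemma ini_sub_total r S S' : ini r S -> ini r S' -> S \subset S' \/ S' \subset S.
Proof.
move=> /iniP[Sr Su] /iniP[Sr' Su'].
have [sub|/subsetPn[x xS xS']] := boolP (S \subset S'); first by left.
right; apply/subsetP=> y yS'; apply: (Su x) (Sr' _ yS') _ => //.
rewrite leqNgt; apply: contra xS' => /ltnW kyx.
exact: Su' yS' (Sr _ xS) kyx.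
Qed.

Lemma ini_sub r S S' : ini r S -> ini r S' -> #|S| <= #|S'| -> S \subset S'.
Proof.
move=> iS iS' leSS'; have [//|sub] := ini_sub_total iS iS'.
by have /eqP-> : S' == S by rewrite eqEcard sub.
Qed.

Lemma ini_eq r S S' : ini r S -> ini r S' -> #|S| = #|S'| -> S = S'.
Proof.
by move=> iS iS' E; apply/eqP; rewrite eqEsubset !(@ini_sub r) ?E.
Qed.

Lemma ini_exists r q : q <= #|lev r| -> exists2 S, ini r S & #|S| = q.
Proof.
elim: q => [|q IHq] leq; first by exists set0; rewrite ?ini0 ?cards0.
have [S iS cS] := IHq (ltnW leq); have [Sr Su] := iniP _ _ iS.
have [z0 z0P] : exists z, z \in lev r :\: S.
  apply/set0Pn; rewrite -card_gt0 cardsD (setIidPr (ini_lev iS)) cS; lia.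
case: (@arg_maxnP _ z0 (mem (lev r :\: S)) (@key X) z0P) => z /=.
rewrite !inE => /andP[zS /eqP rz] zmax.
exists (z |: S); last by rewrite cardsU1 zS cS.
apply/iniP; split=> [x|x y]; rewrite !inE; first by case/predU1P=> [->|/Sr].
case/predU1P=> [->|xS] ry kxy; last by rewrite (Su x) ?orbT.
have [yS|yS] := boolP (y \in S); rewrite ?orbT ?orbF //.
have /zmax kyz : y \in lev r :\: S by rewrite !inE yS ry eqxx.
by apply/eqP/key_inj/eqP; rewrite eqn_leq kyz.
Qed.

Definition top r q : {set X} :=
  odflt set0 [pick S | ini r S && (#|S| == q)].

Lemma topP r q : q <= #|lev r| -> ini r (top r q) /\ #|top r q| = q.
Proof.
move=> /ini_exists[S iS cS]; rewrite /top; case: pickP => [S' /andP[iS' /eqP]//|].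
by move/(_ S); rewrite iS cS eqxx.
Qed.

(** The differences of A and S have equal size, and each element of S outside A outweighs each
    element of A outside S. The strict gain makes the total weight a potential for compressions. *)
Lemma ini_sum_lt r A S (w : X -> nat) : A \subset lev r -> ini r S -> #|S| = #|A| ->
  (forall x y, rk x = r -> rk y = r -> key x < key y -> w x < w y) ->
  A != S -> \sum_(x in A) w x < \sum_(x in S) w x.
Proof.
move=> sA iS cSA wP neq; have [Sr Su] := iniP _ _ iS.
have cD : #|A :\: S| = #|S :\: A|.
  have := cardsID S A; have := cardsID A S; rewrite setIC; lia.
rewrite (big_setID S) /= [ltnRHS](big_setID A) /= setIC ltn_add2l.
have D0 : 0 < #|A :\: S|.
  rewrite card_gt0; apply: contraNneq neq => E; rewrite eqEcard cSA leqnn andbT.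
  by rewrite -setD_eq0 E.
pose m := \max_(x in A :\: S) w x.
apply: (@leq_ltn_trans (#|A :\: S| * m)).
  rewrite -sum_nat_const; apply: leq_sum => x xAS.
  by rewrite /m (bigD1 x) //= leq_maxl.
apply: (@leq_trans (#|S :\: A| * m.+1)); first by rewrite -cD ltn_pmul2l.
rewrite -sum_nat_const; apply: leq_sum => x; rewrite !inE => /andP[xA xS].
have [y0 y0P] : exists y, y \in A :\: S by apply/set0Pn; rewrite -card_gt0.
apply: (big_ind (fun k => k < w x)) => [|a b|y].
- apply: leq_ltn_trans (leq0n (w y0)) _; move: y0P; rewrite !inE => /andP[yS yA].
  apply: wP; rewrite ?(Sr _ xS) //.
    by have := subsetP sA _ yA; rewrite inE => /eqP.
  rewrite ltnNge; apply: contra yS => kxy; apply: Su xS _ kxy.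
  by have := subsetP sA _ yA; rewrite inE => /eqP.
- by rewrite gtn_max => -> ->.
rewrite !inE => /andP[yS yA].
have ry : rk y = r by have := subsetP sA _ yA; rewrite inE => /eqP.
apply: wP; rewrite ?(Sr _ xS) // ltnNge; apply: contra yS => kxy.
exact: Su xS ry kxy.
Qed.

End Segments.

(** * From Macaulay total orders to keys *)

Section RankedPosets.
Import Order.TTheory.
Variables (disp : Order.disp_t) (D : rankedType disp).
Implicit Types (x y z : D) (A S : {set D}).

Lemma covers_below x y : (x < y)%O -> exists2 z, covers x z & (z <= y)%O.
Proof.
move=> xy; have y0 : (x < y <= y)%O by rewrite xy lexx.
case: (@arg_minnP _ y (fun z => (x < z <= y)%O) (fun z => #|[set t | (x < t < z)%O]|) y0).
move=> z /andP[xz zy] zmin; exists z => //; rewrite /covers xz /=.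
apply/forallP=> t; apply/negP=> /andP[xt tz].
have /zmin : (x < t <= y)%O by rewrite xt (le_trans (ltW tz)).
rewrite leqNgt => /negP; apply; apply: proper_card; apply/properP; split.
  by apply/subsetP=> u; rewrite !inE => /andP[-> /lt_trans->].
by exists t; rewrite !inE ?xt ?tz // ltxx andbF.
Qed.

Lemma rank_strict x y : (x < y)%O -> rank x < rank y.
Proof.
by move=> /covers_below[z /rank_covers cz zy]; rewrite -ltnS -cz ltnS rank_mono.
Qed.

(** Every strict relation raises the rank, so nothing fits between consecutive ranks. *)
Lemma coversE x y : covers x y = (x <= y)%O && (rank y == (rank x).+1).
Proof.
apply/idP/andP => [cxy|[xy /eqP rxy]].
  by rewrite (rank_covers _ _ cxy) eqxx; case/andP: cxy => /ltW.
have ltxy : (x < y)%O.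
  by rewrite lt_neqAle xy andbT; apply/eqP=> E; move: rxy; rewrite E; lia.
rewrite /covers ltxy; apply/forallP=> z; apply/negP=> /andP[/rank_strict + /rank_strict].
by rewrite rxy; lia.
Qed.

Lemma covers_above x y : (x < y)%O -> exists2 z, covers z y & (x <= z)%O.
Proof.
move=> xy; have x0 : (x <= x < y)%O by rewrite xy lexx.
case: (@arg_maxnP _ x (fun z => (x <= z < y)%O) (@rank disp D) x0) => z /andP[xz zy] zmax.
exists z => //; have [t czt] := covers_below zy.
rewrite le_eqVlt => /orP[/eqP<-//|ty].
have /zmax : (x <= t < y)%O.
  by rewrite ty andbT (le_trans xz) //; case/andP: czt => /ltW.
by rewrite /= (rank_covers _ _ czt) /geq /= ltnn.
Qed.

Lemma covers_pred y : 0 < rank y -> exists x, covers x y.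
Proof.
move=> ry; have [x xy] : exists x, (x < y)%O.
  apply/existsP; apply: contraTT ry; rewrite negb_exists => /forallP miny.
  by rewrite (rank_minimal y miny).
by have [z czy _] := covers_above xy; exists z.
Qed.

Section Keyed.
Variables (k : D -> nat) (k_inj : injective k).

Definition keyed_poset : kgraph.
Proof.
refine (@KGraph D (@rank disp D) (fun x y => x <= y)%O k (\max_x k x).+1 _ _ k_inj _).
- by move=> x; exact: lexx.
- by move=> x y; rewrite le_eqVlt => /orP[/eqP->|/rank_strict]; [left|right].
- by move=> x; rewrite ltnS (bigD1 x) //= leq_maxl.
Defined.

Lemma shadow_keyed (A : {set keyed_poset}) : shadow A = upper_shadow (A : {set D}).
Proof.
by apply/setP=> y; rewrite !inE; apply: eq_existsb => x; rewrite coversE.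
Qed.

Lemma ini_seg (ord : rel D) r q :
    total ord -> antisymmetric ord -> transitive ord ->
    (forall x y, ord x y = (k x <= k y)) ->
  @ini keyed_poset r (seg ord r q).
Proof.
move=> tot anti tr ordE; apply/iniP; split=> [x|x y].
  by rewrite !inE => /andP[/eqP].
rewrite !inE => /andP[/eqP rx lt_q] ry kxy; rewrite /= in ry; rewrite ry eqxx /=.
apply: leq_ltn_trans lt_q; apply: subset_leq_card; apply/subsetP=> z.
rewrite !inE => /and3P[/eqP rz nzy]; rewrite !ordE => kyz; rewrite rz eqxx /=.
rewrite (leq_trans kxy kyz) andbT; apply: contraNneq nzy => Ezx.
by apply/eqP/k_inj/eqP; rewrite eqn_leq kyz Ezx; apply/andP; split.
Qed.

End Keyed.

(** A total order yields a key by counting the elements at or below x; a key yields a total order by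
    comparison. Under both passages [seg] and [ini] describe the same sets, by uniqueness of
    segments of given size. *)
Lemma macaulayP : macaulay D <-> exists k (k_inj : injective k), Mac (keyed_poset k_inj).
Proof.
split=> [[ord [tot anti tr ordP]]|[k [k_inj [M2 M1]]]]; last first.
  pose ord x y := k x <= k y; exists ord.
  have tot : total ord by move=> x y; apply: leq_total.
  have anti : antisymmetric ord.
    by move=> x y /andP[xy yx]; apply/k_inj/eqP; rewrite eqn_leq; apply/andP.
  have tr : transitive ord by move=> x y z; apply: leq_trans.
  split=> // r A sA.
  have iS q s := ini_seg k_inj q s tot anti tr (fun _ _ => erefl).
  have cA : #|A| <= #|level D r| by apply: subset_leq_card.
  have cS : #|seg ord r (#|A|)| = #|A| by rewrite card_seg // (minn_idPl cA).
  rewrite -!(shadow_keyed (k_inj := k_inj)); split; first exact: M1 (iS _ _) cS.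
  apply: (@ini_eq (keyed_poset k_inj) r.+1); [exact: M2 | exact: iS |].
  rewrite card_seg //; apply/esym/minn_idPl; apply: subset_leq_card.
  exact: (shadow_lev (ini_lev (iS r (#|A|)))).
pose k x := #|[set y | ord y x]|.
have kE x y : ord x y = (k x <= k y).
  apply/idP/idP => [xy|].
    by apply: subset_leq_card; apply/subsetP=> z; rewrite !inE => /tr; apply.
  apply: contraTT => nxy; have /orP[xy|yx] := tot x y; first by rewrite xy in nxy.
  rewrite -ltnNge; apply: proper_card; apply/properP; split.
    by apply/subsetP=> z; rewrite !inE => /tr; apply.
  by exists x; rewrite !inE //; have := tot x x; rewrite orbb.
have k_inj : injective k by move=> x y E; apply: anti; rewrite !kE E leqnn.
exists k, k_inj.
have iS q s := ini_seg k_inj q s tot anti tr kE.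
have segE r (S : {set keyed_poset k_inj}) : ini r S -> S = seg ord r #|S|.
  move=> iniS; apply: (ini_eq iniS (iS _ _)).
  by rewrite card_seg //; apply/esym/minn_idPl/subset_leq_card/(ini_lev iniS).
split=> [r S iniS|r A S sA iniS cS].
  have [_] := ordP r S (ini_lev iniS); rewrite -(segE _ _ iniS) -shadow_keyed => ->.
  exact: iS.
have [+ _] := ordP r A sA; rewrite -cS -(segE _ _ iniS).
by rewrite -!(shadow_keyed (k_inj := k_inj)).
Qed.

End RankedPosets.

(** * Products and boxes *)

Section Product.
Variables X Y : kgraph.

(** Positional notation in base [kbound X], with the second factor as leading digit. *)
Definition prod_key (p : X * Y) := key p.1 + kbound X * key p.2.

Lemma prod_key_lt (p q : X * Y) :
  (prod_key p < prod_key q) =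
  (key p.2 < key q.2) || ((key p.2 == key q.2) && (key p.1 < key q.1)).
Proof.
rewrite /prod_key; case: (ltngtP (key p.2) (key q.2)) => [lt21|lt21|->];
  last by rewrite ltn_add2r.
  have := key_lt p.1; have : kbound X * (key p.2).+1 <= kbound X * key q.2.
    by rewrite leq_mul2l lt21 orbT.
  rewrite mulnS /=; lia.
have := key_lt q.1; have : kbound X * (key q.2).+1 <= kbound X * key p.2.
  by rewrite leq_mul2l lt21 orbT.
rewrite mulnS /=; lia.
Qed.

Lemma prod_key_le (p q : X * Y) :
  (prod_key p <= prod_key q) =
  (key p.2 < key q.2) || ((key p.2 == key q.2) && (key p.1 <= key q.1)).
Proof.
rewrite leqNgt prod_key_lt.
by case: ltngtP => //= _; rewrite -leqNgt.
Qed.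

Definition prod_graph : kgraph.
Proof.
refine (@KGraph (X * Y)%type (fun p => rk p.1 + rk p.2)
  (fun p q => le p.1 q.1 && le p.2 q.2) prod_key (kbound X * kbound Y) _ _ _ _).
- by move=> p; rewrite !le_refl.
- move=> [a b] [c d] /= /andP[/le_rk[->|ac] /le_rk[->|bd]]; [by left|right; lia..].
- move=> p q E; have := prod_key_lt p q; have := prod_key_lt q p.
  rewrite (E : prod_key p = prod_key q) ltnn.
  case: (ltngtP (key p.2) (key q.2)) => //= E2.
  case: (ltngtP (key p.1) (key q.1)) => //= E1 _ _.
  by case: p q E1 E2 {E} => [a b] [c d] /= /key_inj-> /key_inj->.
move=> p; rewrite /prod_key; have := key_lt p.1.
have : kbound X * (key p.2).+1 <= kbound X * kbound Y by rewrite leq_mul2l key_lt orbT.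
rewrite mulnS; lia.
Defined.

Lemma prod_covE (p q : prod_graph) :
  cov p q = (cov p.1 q.1 && (p.2 == q.2)) || ((p.1 == q.1) && cov p.2 q.2).
Proof.
case: p q => [a b] [c d]; rewrite /cov /=; apply/idP/idP.
  case/andP=> /andP[ac bd] /eqP E.
  have [Eac|lac] := le_rk ac; have [Ebd|lbd] := le_rk bd.
  - by move: E; rewrite Eac Ebd; lia.
  - by rewrite Eac eqxx bd (_ : rk d == _) ?orbT //; apply/eqP; move: E; rewrite Eac; lia.
  - by rewrite Ebd eqxx ac (_ : rk c == _) //; apply/eqP; move: E; rewrite Ebd; lia.
  - lia.
case/orP=> /andP[].
  by case/andP=> -> /eqP-> /eqP->; rewrite le_refl addSn /=.
by move=> /eqP-> /andP[-> /eqP->]; rewrite le_refl addnS /=.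
Qed.

End Product.

Definition chain (d : nat) : kgraph.
Proof.
refine (@KGraph 'I_d val (fun i j => i <= j) val d _ _ val_inj (@ltn_ord d)).
- by move=> i; exact: leqnn.
- by move=> i j; rewrite leq_eqVlt => /orP[/eqP/val_inj->|]; [left|right].
Defined.

Definition point : kgraph.
Proof.
by refine (@KGraph unit (fun=> 0) (fun _ _ => true) (fun=> 0) 1 _ _ _ _) => // -[] [] //; left.
Defined.

Lemma chain_covE d (i j : chain d) : cov i j = (val j == (val i).+1).
Proof. by rewrite /cov /=; apply: andb_idl => /eqP->. Qed.

Lemma point_covE (i j : point) : cov i j = false.
Proof. by rewrite /cov. Qed.

(* The head of the list is the least significant coordinate of the order; in the
   Clements-Lindstrom theorem it must be the longest side. *)
Fixpoint box (s : seq nat) : kgraph :=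
  if s is d :: s' then prod_graph (chain d) (box s') else point.

(** The witness lowers z in its first nonzero coordinate, which costs the least key. This is why
    shadows of segments are segments. *)
Lemma box_dec s (u z : box s) : key u < key z -> rk u < rk z ->
  exists2 z', cov z' z & key u <= key z'.
Proof.
elim: s u z => [|d s IHs] //= [u1 u2] [z1 z2] /=; rewrite prod_key_lt /= => kuz ruz.
have [z1_gt0|] := ltnP 0 z1.
  have z1d : z1.-1 < d by apply: leq_ltn_trans (ltn_ord z1); apply: leq_pred.
  exists (Ordinal z1d, z2).
    by rewrite prod_covE /= eqxx chain_covE /= prednK ?eqxx.
  rewrite prod_key_le /=; move: kuz; case: ltngtP => //= _; lia.
rewrite leqn0 => /eqP z10; move: kuz ruz; rewrite z10 ltn0 andbF orbF add0n => k2 r2.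
have [||z' cz' kz'] := IHs u2 z2 => //; first exact: leq_ltn_trans (leq_addl _ _) r2.
exists (z1, z'); first by rewrite prod_covE /= cz' eqxx orbT.
rewrite prod_key_le /= z10; case: (ltngtP (key u2)) kz' => //= /key_inj E _.
by move: (cov_rk cz'); rewrite -E; move: r2; lia.
Qed.

(** Dual to [box_dec]: y is raised in its first coordinate that has room. *)
Lemma box_inc s (y z : box s) : key y < key z -> rk y < rk z ->
  exists2 y', cov y y' & key y' <= key z.
Proof.
elim: s y z => [|d s IHs] //= [y1 y2] [z1 z2] /=; rewrite prod_key_lt /= => kyz ryz.
have [y1d|dy1] := ltnP y1.+1 d.
  exists (Ordinal y1d, y2); first by rewrite prod_covE /= eqxx chain_covE /= eqxx.
  by rewrite prod_key_le /=; move: kyz; case: ltngtP.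
have z1d := ltn_ord z1; have y1d := ltn_ord y1.
have k2 : key y2 < key z2 by case/orP: kyz => // /andP[_]; lia.
have [||y' cy' ky'] := IHs y2 z2 => //; first by lia.
exists (y1, y'); first by rewrite prod_covE /= cy' eqxx orbT.
rewrite prod_key_le /=; case: (ltngtP (key y')) ky' => //= /key_inj E _.
by move: (cov_rk cy'); rewrite E; move: ryz; lia.
Qed.

Lemma box_key_cov s (x y : box s) : cov x y -> key x < key y.
Proof.
move=> cxy; suff: key x <= key y.
  rewrite leq_eqVlt => /orP[/eqP/key_inj E|//].
  by have := cov_rk cxy; rewrite E; lia.
move: (cov_le cxy); clear; elim: s x y => [|d s IHs] //= [x1 x2] [y1 y2] /= /andP[le1 /IHs le2].
by rewrite /prod_key /= leq_add // leq_mul2l le2 orbT.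
Qed.

Lemma ini_shadow_box s r (S : {set box s}) : ini r S -> ini r.+1 (shadow S).
Proof.
move=> /iniP[Sr Su]; apply/iniP; split=> [y /shadowP[x /Sr <- /cov_rk]//|y z].
case/shadowP=> x xS xy rz kyz.
have [||z' cz kz] := box_dec (u := x) (z := z); first exact: leq_trans (box_key_cov xy) kyz.
  by rewrite (Sr _ xS) rz.
apply/shadowP; exists z' => //; apply: Su xS _ kz.
by have := cov_rk cz; rewrite rz => -[].
Qed.

(** * Shadows in rectangles *)

Section Rectangle.
Variables d e : nat.
Local Notation rect := (box [:: d; e]).
Implicit Types (x y z : rect) (A S : {set rect}).

Definition rect1 x : nat := val x.1.
Definition rect2 x : nat := val x.2.1.

Lemma rect_inj x y : rect1 x = rect1 y -> rect2 x = rect2 y -> x = y.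
Proof.
by case: x y => [x1 [x2 []]] [y1 [y2 []]] /val_inj /= -> /val_inj /= ->.
Qed.

Lemma rect1_lt x : rect1 x < d. Proof. exact: ltn_ord. Qed.

Lemma rect2_lt x : rect2 x < e. Proof. exact: ltn_ord. Qed.

Lemma rectP a b : a < d -> b < e -> exists x, rect1 x = a /\ rect2 x = b.
Proof. by move=> ad be; exists (Ordinal ad, (Ordinal be, tt)). Qed.

Lemma rect_rk x : rk x = rect1 x + rect2 x.
Proof. by rewrite /= addn0. Qed.

Lemma rect_covP x y : cov x y <->
  (rect1 y = (rect1 x).+1 /\ rect2 y = rect2 x) \/
  (rect1 y = rect1 x /\ rect2 y = (rect2 x).+1).
Proof.
case: x y => [x1 [x2 []]] [y1 [y2 []]]; rewrite !prod_covE /= !chain_covE /=.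
rewrite /rect1 /rect2 /= andbF orbF eqxx andbT; split.
  case/orP=> /andP[]; first by move=> /eqP-> /eqP[->]; left.
  by move=> /eqP-> /eqP->; right.
case=> -[E1 E2]; apply/orP; [left|right]; rewrite ?E1 ?E2 eqxx ?andbT /=.
  by apply/eqP; congr (_, _); apply: val_inj.
by apply/eqP/val_inj.
Qed.

Lemma rect_key_le x y : rk x = rk y -> (key x <= key y) = (rect2 x <= rect2 y).
Proof.
rewrite !rect_rk prod_key_le /= /prod_key /= !muln0 !addn0 /rect1 /rect2 /= => E.
by case: ltngtP => //= E2; lia.
Qed.

(** The basic injection raises the first coordinate. Only an element with first coordinate d - 1
    resists it; such an element appears from rank d - 1 on, and when A is the full level it accounts
    for the correction on the right. *)
Lemma rect_lower r A : e <= d -> A \subset lev rect r -> A != set0 ->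
  #|A| + (r.+1 < e) <= #|shadow A| + ((d <= r.+1) && (A == lev rect r)).
Proof.
move=> ed sA /set0Pn[x0 x0A].
have rA x : x \in A -> rect1 x + rect2 x = r.
  by move=> /(subsetP sA); rewrite inE -rect_rk => /eqP.
have sh x y : x \in A ->
    rect1 y = (rect1 x).+1 /\ rect2 y = rect2 x \/
    rect1 y = rect1 x /\ rect2 y = (rect2 x).+1 -> y \in shadow A.
  by move=> xA /rect_covP cxy; apply/shadowP; exists x.
pose up x y := rect1 y = (rect1 x).+1 /\ rect2 y = rect2 x.
have up_inj x x' y : up x y -> up x' y -> x = x'.
  by move=> [E1 E2] [E1' E2']; apply: rect_inj; lia.
have [re|er] := ltnP r.+1 e.
  rewrite (leqNgt d) (leq_trans re ed) addn0 addn1.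
  (* Raising the largest second coordinate gives a shadow element that no raise of a first
     coordinate reaches. *)
  case: (@arg_maxnP _ x0 (mem A) rect2 x0A) => x xA xmax.
  have [|y [y1 y2]] := @rectP (rect1 x) (rect2 x).+1 (rect1_lt x).
    by have := rA x xA; lia.
  have yS : y \in shadow A by apply: (sh x) => //; right.
  rewrite (cardsD1 y (shadow A)) yS add1n ltnS.
  apply: (leq_card_rel (F := up)) => [z zA|z z' t _ _]; last exact: up_inj.
  have rz := rA z zA; have [||t [t1 t2]] := @rectP (rect1 z).+1 (rect2 z).
  - lia.
  - exact: rect2_lt.
  exists t => //; rewrite !inE; apply/andP; split.
    apply/eqP=> E; have := xmax z zA; rewrite /geq /=; rewrite E in t1 t2; lia.
  by have := sh z t; rewrite inE; apply=> //; left.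
rewrite addn0; have [dr|rd] := leqP d r.+1; last first.
  rewrite addn0; apply: (leq_card_rel (F := up)) => [z zA|z z' t _ _]; last exact: up_inj.
  have rz := rA z zA; have [||t [t1 t2]] := @rectP (rect1 z).+1 (rect2 z).
  - lia.
  - exact: rect2_lt.
  by exists t => //; apply: (sh z) => //; left.
have [EA|neA] := eqVneq A (lev rect r).
  have [w|w] := ltnP (r - d.-1) e; last first.
    by have := rA _ x0A; have := rect1_lt x0; have := rect2_lt x0; lia.
  have [|v [v1 v2]] := @rectP d.-1 (r - d.-1) _ w; first by lia.
  have vA : v \in A by rewrite EA inE rect_rk v1 v2; lia.
  rewrite addn1 (cardsD1 v) vA add1n ltnS.
  apply: (leq_card_rel (F := up)) => [z|z z' t _ _]; last exact: up_inj.
  rewrite !inE => /andP[/eqP nzx zA].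
  have rz := rA z zA; have rx := rA _ vA; have z1 := rect1_lt z.
  have [||t [t1 t2]] := @rectP (rect1 z).+1 (rect2 z).
  - rewrite ltn_neqAle; apply/andP; split; last by [].
    by apply/eqP=> Ez; apply: nzx; apply: rect_inj; lia.
  - exact: rect2_lt.
  by exists t => //; apply: (sh z) => //; left.
rewrite addn0.
(* A level element z outside A separates A into two parts that can be shifted
   in different directions. *)
have [z zr zA] : exists2 z, rect1 z + rect2 z = r & z \notin A.
  have: ~~ (lev rect r \subset A) by apply: contra neA => sL; rewrite eqEsubset sA.
  by case/subsetPn=> z; rewrite inE rect_rk => /eqP; exists z.
have neq t : t \in A -> rect2 t <> rect2 z.
  move=> tA E; move/negP: zA; apply; rewrite (_ : z = t) //.
  by have rt := rA t tA; apply: rect_inj; lia.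
pose F x y := if rect2 x < rect2 z then rect1 y = rect1 x /\ rect2 y = (rect2 x).+1
              else up x y.
apply: (leq_card_rel (F := F)) => [x xA|x x' y xA x'A].
  have rx := rA x xA; have z1 := rect1_lt z; have z2 := rect2_lt z; rewrite /F.
  have x1 := rect1_lt x; have x2 := rect2_lt x.
  case: ltnP => xz.
    have [||t [t1 t2]] := @rectP (rect1 x) (rect2 x).+1; [lia|lia|].
    by exists t => //; apply: (sh x) => //; right.
  have := neq x xA => neqx.
  have [||t [t1 t2]] := @rectP (rect1 x).+1 (rect2 x); [lia|lia|].
  by exists t => //; apply: (sh x) => //; left.
have := neq x xA; have := neq x' x'A.
have rx := rA x xA; have rx' := rA x' x'A; rewrite /F /up.
by case: ltnP => xz; case: ltnP => x'z; move=> ? ? [E1 E2] [E1' E2']; apply: rect_inj; lia.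
Qed.

(** Lowering the first coordinate sends a shadow element off the axis back into S, since the result
    is a member of S or has a larger second coordinate than one. The images avoid first coordinate d
    - 1, and the axis contributes at most (0, r + 1), which exists only for r + 1 < e. *)
Lemma rect_upper r S : ini r S -> S != set0 ->
  #|shadow S| + ((d <= r.+1) && (S == lev rect r)) <= #|S| + (r.+1 < e).
Proof.
move=> /iniP[Sr Su] /set0Pn[x0 x0S].
have rS x : x \in S -> rect1 x + rect2 x = r by move=> /Sr; rewrite rect_rk.
have upS x y : x \in S -> rect1 y + rect2 y = r -> rect2 x <= rect2 y -> y \in S.
  move=> xS ry xy; apply: (Su x) => //; first by rewrite rect_rk.
  by rewrite rect_key_le // !rect_rk ry rS.
pose T := shadow S :\: [set y | rect1 y == 0].
pose N := [set x in S | rect1 x == d.-1].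
have cT : #|T| <= #|S :\: N|.
  pose F y x := rect1 y = (rect1 x).+1 /\ rect2 y = rect2 x.
  apply: (leq_card_rel (F := F)) => [y|y y' x _ _]; last first.
    by move=> [E1 E2] [E1' E2']; apply: rect_inj; lia.
  rewrite inE [y \in [set _ | _]]inE => /andP[y1 /shadowP[x xS /rect_covP cxy]].
  have y1d := rect1_lt y; have y2e := rect2_lt y; have rx := rS x xS.
  have [||z [z1 z2]] := @rectP (rect1 y).-1 (rect2 y); [lia|lia|].
  exists z; last by rewrite /F; lia.
  have zS : z \in S by case: cxy => cxy; apply: (upS x) => //; lia.
  rewrite !inE zS /=; lia.
have cN : (d <= r.+1) && (S == lev rect r) <= #|N|.
  case: andP => // -[dr /eqP ES]; rewrite card_gt0; apply/set0Pn.
  have x1 := rect1_lt x0; have x2 := rect2_lt x0; have rx := rS _ x0S.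
  have [||z [z1 z2]] := @rectP d.-1 (r - d.-1); [lia|lia|].
  by exists z; rewrite inE z1 eqxx andbT ES inE rect_rk z1 z2; lia.
have cO : #|shadow S :&: [set y | rect1 y == 0]| <= (r.+1 < e).
  have H y : y \in shadow S :&: [set y | rect1 y == 0] -> rect1 y = 0 /\ rect2 y = r.+1.
    rewrite inE [y \in [set _ | _]]inE => /andP[/shadowP[x /rS rx /rect_covP cxy]]; lia.
  have [re|er] := ltnP r.+1 e.
    by apply/card_le1_eqP=> y z /H[y1 y2] /H[z1 z2]; apply: rect_inj; lia.
  rewrite leqn0 cards_eq0; apply/eqP/setP=> y; rewrite in_set0; apply/negP=> /H[_].
  by have := rect2_lt y; lia.
rewrite -(cardsID [set y | rect1 y == 0] (shadow S)) -/T.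
have := cardsID N S; have -> : S :&: N = N by apply/setIidPr/subsetP=> x; rewrite inE => /andP[].
lia.
Qed.

Lemma Mac_rect : e <= d -> Mac rect.
Proof.
move=> ed; split=> [r S|r A S sA iS cS]; first exact: ini_shadow_box.
have [A0|A0] := eqVneq A set0.
  have -> : S = set0 by apply/eqP; rewrite -cards_eq0 cS A0 cards0.
  by rewrite shadow0 cards0.
have S0 : S != set0 by rewrite -card_gt0 cS card_gt0.
have full : (S == lev rect r) = (A == lev rect r).
  by rewrite !eqEcard sA (ini_lev iS) cS.
have := rect_lower ed sA A0; have := rect_upper iS S0; rewrite full cS; lia.
Qed.
End Rectangle.

(** * Compression in a product *)

Section Compression.
Variables (X Y : kgraph).
Hypothesis MacX : Mac X.
Local Notation T := (prod_graph X Y).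
Implicit Types (A B : {set T}) (y : Y).

Definition slice A y : {set X} := [set x | ((x, y) : T) \in A].

Lemma sum_slices A (w : T -> nat) :
  \sum_(p in A) w p = \sum_y \sum_(x in slice A y) w (x, y).
Proof.
rewrite (exchange_big_dep predT) //= pair_big_dep /=.
by apply: eq_big => [[x y]|[x y]] //=; rewrite inE.
Qed.

Lemma card_slices A : #|A| = \sum_y #|slice A y|.
Proof.
by rewrite -sum1_card sum_slices; apply: eq_bigr => y _; rewrite sum1_card.
Qed.

Lemma slice_lev r A y : A \subset lev T r -> slice A y \subset lev X (r - rk y).
Proof.
move=> sA; apply/subsetP=> x; rewrite !inE => /(subsetP sA); rewrite inE /=; lia.
Qed.

Lemma slice_rk r A y : A \subset lev T r -> r < rk y -> slice A y = set0.
Proof.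
move=> sA ry; apply/setP=> x; rewrite !inE; apply/negP=> /(subsetP sA).
by rewrite inE /=; lia.
Qed.

Lemma slice_shadowP A y x :
  reflect (x \in shadow (slice A y) \/ exists2 y', cov y' y & x \in slice A y')
          (x \in slice (shadow A) y).
Proof.
rewrite [x \in slice _ _]inE; apply: (iffP (shadowP _ _)) => [[[x' y'] xyA]|].
  rewrite prod_covE /= => /orP[] /andP[].
    by move=> cx /eqP Ey; left; apply/shadowP; exists x' => //; rewrite inE -Ey.
  by move=> /eqP Ex cy; right; exists y' => //; rewrite inE -Ex.
case=> [/shadowP[x' + cx]|[y' cy]]; rewrite inE => xyA.
  by exists (x', y) => //; rewrite prod_covE /= cx eqxx.
by exists (x, y') => //; rewrite prod_covE /= cy eqxx orbT.
Qed.

(** Each slice is replaced by the segment of its size. A slice of the new shadow is then a union of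
    segments of one level; these are nested, so it is no larger than the largest of them, and each
    is bounded by a part of the same slice of [shadow A]. *)
Lemma compression r A (w : T -> nat) : A \subset lev T r ->
    (forall x x' y, rk x = rk x' -> key x < key x' -> w (x, y) < w (x', y)) ->
  (forall y, ini (r - rk y) (slice A y)) \/
  exists B, [/\ B \subset lev T r, #|B| = #|A|, #|shadow B| <= #|shadow A| &
                \sum_(p in A) w p < \sum_(p in B) w p].
Proof.
move=> sA w_lt; have [M2 M1] := MacX.
pose B : {set T} := [set p | (rk p.2 <= r) && (p.1 \in top X (r - rk p.2) #|slice A p.2|)].
have topA y : ini (r - rk y) (top X (r - rk y) #|slice A y|) /\
    #|top X (r - rk y) (#|slice A y|)| = #|slice A y|.
  by apply: topP; apply/subset_leq_card/slice_lev.
have sliceB y : slice B y = top X (r - rk y) #|slice A y|.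
  apply/setP=> x; rewrite !inE /=; case: leqP => //= ry.
  have [_] := topA y; rewrite (slice_rk sA ry) cards0 => /cards0_eq ->.
  by rewrite inE.
have iniB y : ini (r - rk y) (slice B y) by rewrite sliceB; case: (topA y).
have cardB y : #|slice B y| = #|slice A y| by rewrite sliceB; case: (topA y).
have sB : B \subset lev T r.
  apply/subsetP=> -[x y]; rewrite !inE /= => /andP[ry].
  have [/ini_lev/subsetP/(_ x) + _] := topA y; rewrite !inE => H /H /eqP->.
  by rewrite subnK.
have cB : #|B| = #|A| by rewrite !card_slices; apply: eq_bigr.
have shB : #|shadow B| <= #|shadow A|.
  rewrite !card_slices; apply: leq_sum => y _.
  have sshA := slice_lev y (shadow_lev sA).
  have [ry|ry] := leqP (rk y) r.+1; last first.
    by rewrite (slice_rk (shadow_lev sB) ry) cards0.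
  have [K iK cK] := ini_exists (subset_leq_card sshA).
  rewrite -cK; apply/subset_leq_card/subsetP=> x /slice_shadowP[xB|[y' cy xB]].
    have [ry'|ry'] := leqP (rk y) r; last first.
      by move: xB; rewrite (slice_rk sB ry') shadow0 inE.
    rewrite subSn // in iK; apply: (subsetP (ini_sub (M2 _ _ (iniB y)) iK _)) xB.
    rewrite cK; apply: leq_trans (M1 _ _ _ (slice_lev y sA) (iniB y) (cardB y)) _.
    by apply/subset_leq_card/subsetP=> z zA; apply/slice_shadowP; left.
  rewrite (cov_rk cy) subSS in iK; apply: (subsetP (ini_sub (iniB y') iK _)) xB.
  rewrite cK cardB; apply/subset_leq_card/subsetP=> z zA.
  by apply/slice_shadowP; right; exists y'.
have w_slice y : \sum_(x in slice A y) w (x, y) <= \sum_(x in slice B y) w (x, y)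
                 ?= iff (slice A y == slice B y).
  have [->|neq] := eqVneq (slice A y) (slice B y); first exact: leqif_refl.
  have lt := ini_sum_lt (slice_lev y sA) (iniB y) (cardB y)
    (fun x x' rx rx' => @w_lt x x' y (etrans rx (esym rx'))) neq.
  by split; [exact: ltnW | exact: ltn_eqF].
have [/forallP all|/forallPn[y0 ny0]] := boolP [forall y, slice A y == slice B y].
  by left=> y; rewrite (eqP (all y)).
right; exists B; split=> //; rewrite !sum_slices.
rewrite (bigD1 y0) //= [ltnRHS](bigD1 y0) //= -addSn leq_add //.
  by rewrite ltn_neqAle; have [-> ->] := w_slice y0; rewrite ny0.
by apply: leq_sum => y _; case: (w_slice y).
Qed.

End Compression.

Section Isomorphism.
Variables (X Y : kgraph) (h : X -> Y).
Hypotheses (h_bij : bijective h) (h_rk : forall x, rk (h x) = rk x).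
Hypothesis h_cov : forall x y, cov (h x) (h y) = cov x y.

Lemma shadow_imset (A : {set X}) : shadow (h @: A) = h @: shadow A.
Proof.
case: h_bij => g hK gK; apply/setP=> y; rewrite -(gK y) mem_imset; last exact: can_inj hK.
apply/shadowP/shadowP => [[_ /imsetP[x xA ->]]|[x xA cx]].
  by rewrite h_cov; exists x.
by exists (h x); rewrite ?h_cov // imset_f.
Qed.

Lemma lev_imset r (A : {set X}) : (h @: A \subset lev Y r) = (A \subset lev X r).
Proof.
apply/subsetP/subsetP => sA x.
  by move=> xA; have := sA (h x) (imset_f h xA); rewrite !inE h_rk.
by case/imsetP=> z /sA + ->; rewrite !inE h_rk.
Qed.

End Isomorphism.

Lemma Mac_leq (X : kgraph) r (A S : {set X}) : Mac X -> A \subset lev X r -> ini r S ->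
  #|S| <= #|A| -> #|shadow S| <= #|shadow A|.
Proof.
move=> [_ M1] sA iS leSA; have [K iK cK] := ini_exists (subset_leq_card sA).
apply: leq_trans (M1 r A K sA iK cK).
by apply/subset_leq_card/shadowS/(ini_sub iS iK); rewrite cK.
Qed.

(** * Sets closed under trading the first coordinate *)

Section Stable.
Variables (d : nat) (s : seq nat).
Local Notation T := (box (d.+1 :: s)).
Implicit Types (A S : {set T}) (i j : 'I_d.+1).

Definition stable A := forall i j (x y : box s),
  ((i, x) : T) \in A -> cov x y -> val i = (val j).+1 -> ((j, y) : T) \in A.

(** Layers fix the first, least significant coordinate, whereas [slice] fixes the second factor. *)
Definition layer A i : {set box s} := [set x | ((i, x) : T) \in A].

Lemma card_layers A : #|A| = \sum_i #|layer A i|.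
Proof.
under eq_bigr do rewrite -sum1_card.
by rewrite -sum1_card pair_big_dep /=; apply: eq_bigl => -[i x]; rewrite inE.
Qed.

Lemma layer_lev r A i : A \subset lev T r -> layer A i \subset lev (box s) (r - i).
Proof.
by move=> sA; apply/subsetP=> x; rewrite !inE => /(subsetP sA); rewrite inE /=; lia.
Qed.

Lemma layer_ini r S i : ini r S -> ini (r - i) (layer S i).
Proof.
move=> /iniP[Sr Su]; apply/iniP; split=> [x|x y]; rewrite inE => xS.
  by have /= := Sr _ xS; lia.
move=> ry kxy; rewrite inE; apply: (Su (i, x)) => //=.
  by have /= := Sr _ xS; lia.
by rewrite prod_key_le /= leqnn andbT orbC -leq_eqVlt.
Qed.

Lemma layer_shadow_succ A (i : 'I_d) :
  layer A (widen_ord (leqnSn d) i) \subset layer (shadow A) (lift ord0 i).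
Proof.
apply/subsetP=> x; rewrite !inE => xA; apply/exists_inP.
by exists (widen_ord (leqnSn d) i, x) => //; rewrite prod_covE chain_covE /= !eqxx.
Qed.

Lemma layer_shadow0 A : layer (shadow A) ord0 = shadow (layer A ord0).
Proof.
apply/setP=> x; rewrite inE; apply/shadowP/shadowP => [[[i y] yA]|[y yA cyx]].
  rewrite prod_covE chain_covE /= => /andP[/eqP Ei cyx].
  by exists y => //; rewrite inE -Ei.
by exists (ord0, y); [move: yA; rewrite inE | rewrite prod_covE chain_covE /= cyx ?orbT].
Qed.

(** Layer i + 1 of the shadow contains layer i of A, and layer 0 of the shadow is the shadow of
    layer 0. Only the last layer of A has no successor. *)
Lemma shadow_lower A :
  #|shadow (layer A ord0)| + #|A| <= #|shadow A| + #|layer A ord_max|.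
Proof.
rewrite (card_layers A) (card_layers (shadow A)) big_ord_recr big_ord_recl /=.
rewrite layer_shadow0 addnA leq_add2r leq_add2l; apply: leq_sum => i _.
exact/subset_leq_card/layer_shadow_succ.
Qed.

(** What layer i + 1 of S contributes to its own layer of the shadow lies, by stability, already in
    layer i of S, so [shadow_lower] is sharp. *)
Lemma shadow_upper S : stable S ->
  #|shadow S| + #|layer S ord_max| <= #|shadow (layer S ord0)| + #|S|.
Proof.
move=> stS; rewrite (card_layers S) (card_layers (shadow S)) big_ord_recl big_ord_recr /=.
rewrite layer_shadow0 addnA leq_add2r leq_add2l; apply: leq_sum => i _.
apply/subset_leq_card/subsetP=> x; rewrite !inE => /exists_inP[[j y] yS].
rewrite prod_covE chain_covE /= => /orP[]/andP[].
  move=> Ej /eqP <-; rewrite (_ : widen_ord _ i = j) //.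
  by apply: val_inj => /=; move: Ej; rewrite /bump /=; lia.
move=> /eqP Ej cyx; apply: stS yS cyx _; rewrite Ej /= /bump; lia.
Qed.

Lemma ini_stable r S : ini r S -> stable S.
Proof.
move=> /iniP[Sr Su] i j x y xS cxy Ei; apply: (Su _ _ xS) => /=.
  by move: Ei; have := Sr _ xS; rewrite (cov_rk cxy) /=; lia.
by rewrite prod_key_le /= (box_key_cov cxy).
Qed.

(* After replacing every layer of A by an initial segment, the resulting family B
   contains, with (i, x), every larger (j, z) of the same rank with j <= i.
   Hence layer 0 of A is at least as large as that of S and the last layer is at
   most as large, which is all that [shadow_lower] and [shadow_upper] require. *)
Lemma Mac_stable r A S : Mac (box s) -> A \subset lev T r -> stable A ->
  ini r S -> #|S| = #|A| -> #|shadow S| <= #|shadow A|.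
Proof.
move=> Macs sA stA iS cS; have [M2 M1] := Macs; have [Sr Su] := iniP _ _ iS.
pose B i := top (box s) (r - i) #|layer A i|.
have [iB cB] : (forall i, ini (r - i) (B i)) /\ forall i, #|B i| = #|layer A i|.
  by split=> i; have [] := topP (subset_leq_card (layer_lev i sA)).
have Br i x : x \in B i -> rk ((i, x) : T) = r.
  move=> xB; have /= := ini_lev (iB i); move/subsetP/(_ x xB); rewrite inE.
  have [ri|] := ltnP r i; last by lia.
  have : #|B i| = 0.
    rewrite cB; apply/eqP; rewrite cards_eq0; apply/eqP/setP=> z; rewrite !inE.
    by apply/negP=> /(subsetP sA); rewrite inE /=; lia.
  by move/cards0_eq=> B0; rewrite B0 inE in xB.
have sub i j : val i = (val j).+1 -> i <= r -> shadow (B i) \subset B j.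
  move=> Ei ir; have i1 : (r - i).+1 = r - j by rewrite /= in Ei; lia.
  apply: (@ini_sub _ (r - j)) => //; first by rewrite -i1; apply: M2.
  rewrite cB; apply: leq_trans (Mac_leq Macs (layer_lev i sA) (iB i) _) _; first by rewrite cB.
  apply/subset_leq_card/subsetP=> y /shadowP[x]; rewrite !inE => xA cxy.
  exact: stA xA cxy Ei.
(* Induction on i - j: [box_inc] hands a unit of the first coordinate to x without overtaking z. *)
have closed n i j x z : i - j = n -> x \in B i -> j <= i -> rk ((j, z) : T) = r ->
    key ((i, x) : T) <= key ((j, z) : T) -> z \in B j.
  elim: n i x => [|n IHn] i x Eij xB ji rz kxz.
    have Ej : j = i by apply: val_inj => /=; lia.
    rewrite Ej in rz kxz *; have [_ up] := iniP _ _ (iB i).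
    apply: (up x) => //; first by move: rz => /=; lia.
    by move: kxz; rewrite prod_key_le /= leqnn andbT orbC -leq_eqVlt.
  have rx := Br _ _ xB; rewrite /= in rx rz.
  have kxz' : key x < key z.
    by move: kxz; rewrite prod_key_le /=; case: ltngtP => //=; lia.
  have [|x' cx kx'] := box_inc kxz'; first by lia.
  have i1 : i.-1 < d.+1 by have := ltn_ord i; lia.
  apply: (IHn (Ordinal i1) x') => //=; try lia.
    have := sub i (Ordinal i1); move=> /(_ _ _)/subsetP; apply=> /=; try lia.
    by apply/shadowP; exists x.
  rewrite prod_key_le /=; case: ltngtP kx' => //= /key_inj E _.
  by have := cov_rk cx; rewrite E; lia.
(* Otherwise some (0, w) in S lies outside B. By [closed] every member of B has a larger key, so B
   is contained in S and A would be smaller than S. The last layer is treated dually. *)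
have le0 : #|layer S ord0| <= #|layer A ord0|.
  rewrite leqNgt; apply/negP=> lt0; suff: #|A| < #|S| by rewrite cS ltnn.
  have [w wS wB] : exists2 w, w \in layer S ord0 & w \notin B ord0.
    apply/subsetPn; apply: contraL lt0 => /subset_leq_card; rewrite cB -leqNgt => ->//.
  rewrite inE in wS.
  have BS i : B i \subset layer S i.
    apply/subsetP=> x xB; rewrite inE; apply: (Su _ _ wS); first exact: Br.
    rewrite leqNgt; apply: contra wB => /ltnW kx.
    by apply: (closed _ i ord0 x) => //; apply: Sr.
  rewrite (card_layers A) (card_layers S) !big_ord_recl -addSn leq_add //.
  by apply: leq_sum => i _; rewrite -cB subset_leq_card.
have leK : #|layer A ord_max| <= #|layer S ord_max|.
  rewrite leqNgt; apply/negP=> ltK; suff: #|S| < #|A| by rewrite cS ltnn.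
  have [y yB yS] : exists2 y, y \in B ord_max & y \notin layer S ord_max.
    by apply/subsetPn; apply: contraL ltK => /subset_leq_card; rewrite cB -leqNgt => ->.
  have SB i : layer S i \subset B i.
    apply/subsetP=> x; rewrite inE => xS.
    apply: (closed _ ord_max i y) => //; first exact: leq_ord.
      exact: Sr.
    rewrite leqNgt; apply: contra yS => /ltnW ky; rewrite inE.
    by apply: (Su _ _ xS) => //; apply: Br.
  rewrite (card_layers A) (card_layers S) !big_ord_recr /= -addnS leq_add //.
  by apply: leq_sum => i _; rewrite -cB subset_leq_card.
have := shadow_lower A; have := shadow_upper (ini_stable iS).
have := @Mac_leq _ r _ _ Macs _ _ le0.
have := layer_lev ord0 sA; have := layer_ini ord0 iS; rewrite subn0 => i0 l0 /(_ l0 i0).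
lia.
Qed.

End Stable.

Section Optimal.
Variables (T X Y : kgraph) (h : T -> X * Y).
Local Notation XY := (prod_graph X Y).
Hypotheses (h_bij : bijective (h : T -> XY)) (h_rk : forall p, rk (h p : XY) = rk p).
Hypothesis h_cov : forall p q, cov (h p : XY) (h q : XY) = cov p q.
Hypothesis h_key : forall p q, (h p).2 = (h q).2 ->
  (key (h p).1 <= key (h q).1) = (key p <= key q).

(** If compressing along [h] changed A, the key sum would grow without enlarging the shadow, against
    maximality; so the slices of A are segments already. *)
Lemma optimal_slices r (A : {set T}) : Mac X -> A \subset lev T r ->
    (forall B : {set T}, B \subset lev T r -> #|B| = #|A| -> #|shadow B| <= #|shadow A| ->
       \sum_(p in B) key p <= \sum_(p in A) key p) ->
  forall p q, p \in A -> (h p).2 = (h q).2 -> rk p = rk q ->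
    key p <= key q -> q \in A.
Proof.
case: (h_bij) => g hK gK MacX sA optA.
have h_inj := can_inj hK; have g_inj := can_inj gK.
have [||sl|[B [sB cB shB wB]]] := @compression X Y MacX r (h @: A) (fun p => key (g p)).
- by rewrite lev_imset.
- move=> x x' y _; rewrite !ltnNge; apply: contraNN.
  by have := @h_key (g (x', y)) (g (x, y)); rewrite !gK => ->.
- move=> p q pA Ep2 Erk kpq.
  have /iniP[slr slu] := sl (h p).2.
  have hpA : (h p).1 \in slice (h @: A) (h p).2.
    by rewrite inE -surjective_pairing imset_f.
  have := slu _ (h q).1 hpA; rewrite inE Ep2 -surjective_pairing mem_imset //; apply=> //;
    last by rewrite h_key.
  have := slr _ hpA; have := h_rk p; have := h_rk q; rewrite /= Ep2 -Erk; lia.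
have gB : h @: (g @: B) = B.
  by rewrite -imset_comp (eq_imset (g := id)) ?imset_id // => x /=; rewrite gK.
have := optA (g @: B); rewrite -(lev_imset h_rk) gB sB card_imset // cB card_imset //.
move=> /(_ isT erefl); rewrite -(card_imset _ h_inj) -(shadow_imset h_bij h_cov) gB.
rewrite -(card_imset _ h_inj) -(shadow_imset h_bij h_cov) => /(_ shB).
rewrite leqNgt => /negP; case.
move: wB; rewrite !big_imset /=; try by move=> ? ? _ _; apply: h_inj || apply: g_inj.
by under eq_bigr do rewrite hK.
Qed.

End Optimal.

(** * The Clements-Lindström theorem *)

Section ClementsLindstromTheorem.

Section Regroup.
Variables X Y Z : kgraph.
Local Notation XYZ := (prod_graph X (prod_graph Y Z)).

(** The added [point] makes the first factor literally a box with two sides. *)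
Definition group12 (p : XYZ) : prod_graph X (prod_graph Y point) * Z :=
  ((p.1, (p.2.1, tt)), p.2.2).

Definition group13 (p : XYZ) : prod_graph X Z * Y := ((p.1, p.2.2), p.2.1).

Lemma group12_bij : bijective group12.
Proof. by exists (fun q => (q.1.1, (q.1.2.1, q.2))) => [[? []]|[[? [? []]] ?]]. Qed.

Lemma group13_bij : bijective group13.
Proof. by exists (fun q => (q.1.1, (q.2, q.1.2))) => [[? []]|[[]]]. Qed.

Lemma group12_rk p : rk (group12 p : prod_graph _ _) = rk p.
Proof. by case: p => [x [y z]] /=; lia. Qed.

Lemma group13_rk p : rk (group13 p : prod_graph _ _) = rk p.
Proof. by case: p => [x [y z]] /=; lia. Qed.

Lemma group12_cov p q :
  cov (group12 p : prod_graph _ _) (group12 q : prod_graph _ _) = cov p q.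
Proof.
case: p q => [x [y z]] [x' [y' z']]; rewrite !prod_covE /= !xpair_eqE.
rewrite point_covE !eqxx.
by do !case: eqP => _ //=; rewrite ?andbT ?andbF ?orbF ?orbA.
Qed.

Lemma group13_cov p q :
  cov (group13 p : prod_graph _ _) (group13 q : prod_graph _ _) = cov p q.
Proof.
case: p q => [x [y z]] [x' [y' z']]; rewrite !prod_covE /= !xpair_eqE.
by do !case: eqP => _ //=; rewrite ?andbT ?andbF ?orbF //=; case: (cov x x') => //=; rewrite orbC.
Qed.

Lemma group12_key p q : (group12 p).2 = (group12 q).2 ->
  (key (group12 p).1 <= key (group12 q).1) = (key p <= key q).
Proof.
case: p q => [x [y z]] [x' [y' z']] /= ->.
by rewrite /= /prod_key /= /prod_key /= !muln0 !addn0 !mulnDr !addnA leq_add2r.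
Qed.

Lemma group13_key p q : (group13 p).2 = (group13 q).2 ->
  (key (group13 p).1 <= key (group13 q).1) = (key p <= key q).
Proof.
case: p q => [x [y z]] [x' [y' z']] /= ->.
rewrite !prod_key_le /= !prod_key_lt /= ltnn andbF orbF; congr (_ || (_ && _)).
rewrite /prod_key /= eqn_add2l; case: (kbound Y) (key_lt y') => // n _.
by rewrite eqn_pmul2l.
Qed.

End Regroup.

(* A set of maximal total key is fixed by the compressions in the directions of
   the coordinates (1, 2) and of all coordinates but the second one. *)
Lemma exists_stable d e s r (A : {set box [:: d.+1, e & s]}) :
    Mac (box [:: d.+1; e]) -> Mac (box (d.+1 :: s)) -> A \subset lev _ r ->
  exists B : {set box [:: d.+1, e & s]},
    [/\ B \subset lev _ r, #|B| = #|A|, #|shadow B| <= #|shadow A| & stable B].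
Proof.
move=> Mac_de Mac_ds sA.
pose good (B : {set box [:: d.+1, e & s]}) :=
  [&& B \subset lev _ r, #|B| == #|A| & #|shadow B| <= #|shadow A|].
have gA : good A by rewrite /good sA eqxx leqnn.
case: (@arg_maxnP _ A good (fun B => \sum_(p in B) key p) gA) => B /and3P[sB /eqP cB shB] maxB.
exists B; split=> // i j [x2 x3] [y2 y3] pB cxy Ei.
have optB (B' : {set box [:: d.+1, e & s]}) : B' \subset lev _ r -> #|B'| = #|B| ->
    #|shadow B'| <= #|shadow B| -> \sum_(p in B') key p <= \sum_(p in B) key p.
  move=> sB' cB' shB'; apply: maxB; rewrite /good sB' cB' cB eqxx /=.
  exact: leq_trans shB' shB.
pose p : box [:: d.+1, e & s] := (i, (x2, x3)); pose q : box [:: d.+1, e & s] := (j, (y2, y3)).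
have rpq : rk p = rk q by have /= := cov_rk cxy; move: Ei => /=; lia.
have kpq : key p <= key q by rewrite prod_key_le /= (box_key_cov (s := e :: s) cxy).
(* A cover in the second coordinate stays in a slice of [group12]; any other cover stays in a slice
   of [group13]. *)
move: cxy; rewrite prod_covE /= => /orP[/andP[_ /eqP E3]|/andP[/eqP E2 _]].
  exact: (optimal_slices (@group12_bij _ _ _) (@group12_rk _ _ _) (@group12_cov _ _ _)
    (@group12_key _ _ _) Mac_de sB optB pB (q := q) E3 rpq kpq).
exact: (optimal_slices (@group13_bij _ _ _) (@group13_rk _ _ _) (@group13_cov _ _ _)
    (@group13_key _ _ _) Mac_ds sB optB pB (q := q) E2 rpq kpq).
Qed.

(** Settles dimension at most one and the empty boxes with a side 0. *)
Lemma Mac_thin s : (forall x y : box s, rk x = rk y -> x = y) -> Mac (box s).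
Proof.
move=> thin; split=> [r S|r A S sA iS cS]; first exact: ini_shadow_box.
have [A0|A0] := posnP #|A|.
  by have := cS; rewrite A0 => /cards0_eq->; rewrite shadow0 cards0.
have [x xA] := card_gt0P A0; have S0 : 0 < #|S| by rewrite cS.
suff -> : S = A by [].
have lev1 (B : {set box s}) : B \subset lev (box s) r -> 0 < #|B| -> B = [set x].
  move=> sB /card_gt0P[y yB].
  have rx z : z \in B -> z = x.
    move=> /(subsetP sB); have := subsetP sA _ xA; rewrite !inE => /eqP rx /eqP rz.
    by apply: thin; rewrite rx rz.
  by apply/setP=> z; rewrite inE; apply/idP/eqP => [/rx|->]; rewrite -?(rx _ yB).
by rewrite (lev1 S) ?(ini_lev iS) // (lev1 A).
Qed.

Theorem clements_lindstrom_Mac s : sorted geq s -> Mac (box s).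
Proof.
have [n] := ubnP (size s); elim: n s => // n IHn [|d [|e s]].
- by move=> _ _; apply: (@Mac_thin [::]) => -[] [].
- by move=> _ _; apply: (@Mac_thin [:: d]) => -[x []] [y []] /=; rewrite !addn0 => /val_inj->.
rewrite /= !ltnS => size_s /andP[ed sorted_s].
have [s0|s0] := posnP (size s).
  by rewrite (size0nil s0); apply: Mac_rect.
case: d ed => [|d] ed.
  by apply: (@Mac_thin [:: 0, e & s]) => -[[]].
split=> [r S|r A S sA iS cS]; first exact: (@ini_shadow_box [:: d.+1, e & s]).
have Mac_s : Mac (box (e :: s)) by apply: IHn.
have Mac_ds : Mac (box (d.+1 :: s)).
  apply: IHn => //=; case: (s) sorted_s => //= f s' /andP[fe ->].
  by rewrite andbT /geq /= (leq_trans fe).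
have [B [sB cB shB stB]] := exists_stable (Mac_rect ed) Mac_ds sA.
apply: leq_trans shB; apply: (Mac_stable Mac_s sB stB iS).
by rewrite cB.
Qed.

End ClementsLindstromTheorem.

(** * Complementation, atoms and coatoms of a box *)

Section BoxStructure.

Definition box_rank s := sumn [seq d.-1 | d <- s].

Fixpoint box_rev s : box s -> box s :=
  if s is d :: s' then fun p => (rev_ord p.1, box_rev p.2) else id.

Lemma box_revK s : involutive (@box_rev s).
Proof. by elim: s => [|d s IHs] // [i x] /=; rewrite rev_ordK IHs. Qed.

Lemma box_rk_rev s (x : box s) : rk x + rk (box_rev x) = box_rank s.
Proof.
elim: s x => [|d s IHs] // [i x] /=; rewrite /box_rank /= -/(box_rank s) -(IHs x).
by have := ltn_ord i; lia.
Qed.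

Lemma box_rk_le s (x : box s) : rk x <= box_rank s.
Proof. by rewrite -(box_rk_rev x) leq_addr. Qed.

Lemma card_lev_rev s r : r <= box_rank s ->
  #|lev (box s) (box_rank s - r)| = #|lev (box s) r|.
Proof.
move=> rs; rewrite -(card_imset _ (inv_inj (@box_revK s))); apply: eq_card => x.
rewrite -[x](@box_revK s) mem_imset; last exact: inv_inj (@box_revK s).
by rewrite !inE; have := box_rk_rev (box_rev x); rewrite box_revK; lia.
Qed.

Lemma box_le_rev s (x y : box s) : le (box_rev x) (box_rev y) = le y x.
Proof.
elim: s x y => [|d s IHs] // [i x] [j y] /=; rewrite IHs.
by have ltid := ltn_ord i; have ltjd := ltn_ord j; congr (_ && _); lia.
Qed.

Lemma box_le0 s (x y : box s) : rk x = 0 -> le x y.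
Proof.
elim: s x y => [|d s IHs] // [i x] [j y] /= E.
by rewrite IHs ?andbT //; lia.
Qed.

Lemma box_le1 s (x y : box s) : rk y = box_rank s -> le x y.
Proof. by move=> E; rewrite -box_le_rev box_le0 //; have := box_rk_rev y; lia. Qed.

Lemma box_bot s : all (leq 1) s -> exists x : box s, rk x = 0.
Proof.
elim: s => [|d s IHs] /=; first by exists tt.
by case/andP=> d0 /IHs[x rx]; exists (Ordinal d0, x).
Qed.

Lemma box_lev_gt0 s r : all (leq 1) s -> r <= box_rank s -> 0 < #|lev (box s) r|.
Proof.
elim: s r => [|d s IHs] r /=.
  by rewrite leqn0 => _ /eqP->; apply/card_gt0P; exists tt; rewrite inE.
case/andP=> d0 /IHs{}IHs; rewrite /box_rank /= -/(box_rank s) => rs.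
have [x] : exists x, x \in lev (box s) (r - d.-1) by apply/card_gt0P/IHs; lia.
rewrite inE => /eqP rx.
have lt_d : minn r d.-1 < d by lia.
by apply/card_gt0P; exists (Ordinal lt_d, x); rewrite inE /= rx; apply/eqP; lia.
Qed.

(** The coatom [box_rev b] is the top lowered by one in the coordinate of b. It fails to dominate a
    only if a uses the same coordinate and that coordinate has dropped to 0. *)
Lemma box_atom_coatom s (a b : box s) : rk a = 1 -> rk b = 1 ->
  ~~ le a (box_rev b) -> a = b /\ 2 \in s.
Proof.
elim: s a b => [|d s IHs] // [i x] [j y] /= ra rb.
have ltid := ltn_ord i; have ltjd := ltn_ord j.
have [i0|i0] := posnP i.
  rewrite i0 leq0n /= => nle.
  have [y0|y0] := posnP (@rk (box s) y).
    by move: nle; rewrite box_le1 //; have := box_rk_rev y; lia.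
  have [||-> s2] := IHs _ _ _ _ nle; try by lia.
  by split; [congr (_, _); apply: val_inj; rewrite /= ; lia | rewrite inE s2 orbT].
have x0 : @rk (box s) x = 0 by lia.
rewrite (box_le0 _ x0) andbT => nle; rewrite inE (_ : 2 == d); last by apply/eqP; lia.
split=> //; congr (_, _); first by apply: val_inj; rewrite /=; lia.
have y0 : @rk (box s) y = 0 by lia.
by have [//|] := le_rk (box_le0 y x0); lia.
Qed.

Lemma card_lev0 s : all (leq 1) s -> #|lev (box s) 0| = 1.
Proof.
move=> s1; have [x x0] := box_bot s1; apply/eqP/cards1P; exists x; apply/setP=> y.
rewrite !inE; apply/eqP/eqP => [y0|->//].
by have [//|] := le_rk (box_le0 x y0); lia.
Qed.

Lemma card_lev1 s : all (leq 2) s -> #|lev (box s) 1| = size s.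
Proof.
elim: s => [|d s IHs] /=.
  by move=> _; apply/eqP; rewrite cards_eq0; apply/eqP/setP=> x; rewrite !inE.
case/andP=> d2 s2; have s1 : all (leq 1) s by apply: sub_all s2 => k; exact: ltnW.
rewrite -(IHs s2) -[LHS](cardsID [set p : box (d :: s) | val p.1 == 0]) addnC.
have d0 : 0 < d by exact: ltnW.
rewrite -[RHS]add1n; congr (_ + _).
  have [x x0] := box_bot s1; apply/eqP/cards1P; exists (Ordinal d2, x).
  apply/setP=> -[i y]; rewrite !inE /=; apply/andP/eqP => [[i0 /eqP E]|[-> ->]].
    congr (_, _); first by apply: val_inj => /=; lia.
    have y0 : @rk (box s) y = 0 by lia.
    by have [//|] := le_rk (box_le0 x y0); lia.
  by rewrite /= x0.
rewrite -(card_imset (lev (box s) 1) (f := fun x => (Ordinal d0, x) : box (d :: s))); last first.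
  by move=> x y [].
apply: eq_card => -[i y]; rewrite !inE /=; apply/andP/imsetP => [[/eqP E i0]|[x]].
  exists y; first by rewrite inE; apply/eqP; lia.
  by congr (_, _); apply: val_inj => /=; lia.
by rewrite inE => /eqP rx [-> ->]; rewrite rx.
Qed.

End BoxStructure.

(** * Level sizes determine the side lengths *)

Section HilbertSeries.
Import GRing.Theory Num.Theory.
Local Open Scope ring_scope.

Let G d : {poly algC} := \sum_(i < d) 'X^i.

(** Ranks add up over the factors, so the rank generating polynomial is a product of geometric
    sums. *)
Lemma hilbert_coef s r :
  (\prod_(d <- s) G d)`_r = #|lev (box s) r|%:R.
Proof.
transitivity ((\sum_(x : box s) 'X^(rk x) : {poly algC})`_r); last first.
  rewrite coef_sum -sum1_card natr_sum [RHS]big_mkcond /=.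
  by apply: eq_bigr => x _; rewrite coefXn !inE eq_sym; case: eqP.
congr ((_ : {poly algC})`_r); elim: s => [|d s IHs].
  by rewrite big_nil (big_pred1 tt) //= => -[].
rewrite big_cons IHs /G big_distrl /=.
under eq_bigr do rewrite big_distrr /=.
by rewrite pair_big /=; apply: eq_bigr => -[i x] _; rewrite -exprD.
Qed.

(** From (w - 1) G(w) = w^d - 1 and w distinct from 1. *)
Lemma chain_poly_root e (w : algC) d : (1 < e)%N -> e.-primitive_root w ->
  root (G d) w = (e %| d)%N.
Proof.
move=> e1 prim; have w1 : w != 1.
  by apply: contraTneq e1 => w1; rewrite -leqNgt dvdn_leq // (prim_order_dvd prim) w1 expr1n.
rewrite (prim_order_dvd prim) -subr_eq0 subrX1 mulf_eq0 subr_eq0 (negbTE w1) /=.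
rewrite rootE /G horner_sum; congr (_ == 0).
by apply: eq_bigr => i _; rewrite hornerXn.
Qed.

(* A primitive root of unity of order the largest side of one box is a root of both
   rank generating polynomials, so the largest sides agree and can be cancelled. *)
Lemma prod_chain_poly_inj s t : sorted geq s -> sorted geq t ->
    all (leq 2) s -> all (leq 2) t ->
  \prod_(d <- s) G d = \prod_(d <- t) G d -> s = t.
Proof.
have head_le u d v : (1 < d)%N -> sorted geq u -> all (leq 2) u ->
    \prod_(e <- d :: v) G e = \prod_(e <- u) G e -> (d <= head 0%N u)%N.
  move=> d1 sorted_u u2 E; have [w prim] := C_prim_root_exists (ltnW d1).
  have : root (\prod_(e <- u) G e) w.
    by rewrite -E big_cons rootM (chain_poly_root _ d1 prim) dvdnn.
  rewrite rootE horner_prod => /eqP/eqP; rewrite prodf_seq_eq0 => /hasP[e eu /=].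
  rewrite -rootE (chain_poly_root _ d1 prim) => d_dvd_e.
  have e0 : (0 < e)%N by apply: leq_trans (allP u2 e eu).
  apply: leq_trans (dvdn_leq e0 d_dvd_e) _; case: (u) sorted_u eu => //= f u' pf.
  rewrite inE => /predU1P[->//|eu']; apply: (allP (order_path_min _ pf)) => //.
  by move=> a b c /= ba cb; apply: leq_trans cb ba.
have G_neq0 d : (1 < d)%N -> G d != 0.
  move=> d1; apply/eqP=> /(congr1 (fun p : {poly algC} => p`_0)) /eqP.
  have := hilbert_coef [:: d] 0; rewrite big_seq1 => ->.
  by rewrite coef0 pnatr_eq0 card_lev0 //= ltnW.
elim: s t => [|d s IHs] [|e t] //=.
- move=> _ st _ /andP[e1 _] E; have := head_le [::] e t e1 isT isT (esym E); rewrite /=; lia.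
- move=> ss _ /andP[d1 _] _ E; have := head_le [::] d s d1 isT isT E; rewrite /=; lia.
move=> ss st /[dup] ds2 /andP[d1 s1] /[dup] et2 /andP[e1 t1] E.
have de : d = e.
  apply/eqP; rewrite eqn_leq; apply/andP; split; first exact: (head_le (e :: t) d s d1 st et2 E).
  exact: (head_le (d :: s) e t e1 ss ds2 (esym E)).
move: E; rewrite de !big_cons => /(mulfI (G_neq0 _ e1)) /IHs -> //.
- exact: path_sorted ss.
- exact: path_sorted st.
Qed.

Lemma card_lev_inj s t : sorted geq s -> sorted geq t ->
    all (leq 2) s -> all (leq 2) t ->
  (forall r, #|lev (box s) r| = #|lev (box t) r|) -> s = t.
Proof.
move=> ss st s2 t2 E; apply: prod_chain_poly_inj => //.
by apply/polyP=> r; rewrite !hilbert_coef E.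
Qed.

End HilbertSeries.

(** * Clements-Lindström posets as boxes *)

Section Representation.
Variables (n : nat) (d : n.-tuple nat) (d_gt0 : forall i, 0 < tnth d i).
Local Notation CL := (clements_lindstrom d_gt0).

Fixpoint cl_proj (l : seq 'I_n) (a : CL) : box [seq tnth d i | i <- l] :=
  if l is i :: l' then ((a : {dffun forall i, 'I_(tnth d i)}) i, cl_proj l' a) else tt.

Lemma cl_proj_le l a b : le (cl_proj l a) (cl_proj l b) =
  all (fun i => cl_coord a i <= cl_coord b i) l.
Proof. by elim: l => //= i l ->. Qed.

Lemma cl_proj_rk l a : rk (cl_proj l a) = \sum_(i <- l) cl_coord a i.
Proof. by elim: l => [|i l IHl] /=; rewrite ?big_nil ?big_cons ?IHl. Qed.

Lemma cl_proj_surj l (x : box [seq tnth d i | i <- l]) : uniq l ->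
  exists a, cl_proj l a = x.
Proof.
move=> l_uniq.
have [h [h_lt hP]] : exists h : 'I_n -> nat, (forall i, h i < tnth d i) /\
    forall a : CL, {in l, forall i, cl_coord a i = h i} -> cl_proj l a = x.
  elim: l x l_uniq => [|i l IHl] /= x.
    by exists (fun=> 0); split=> // a _; case: x.
  case: x => j x /andP[il /(IHl x)[h [h_lt hP]]].
  exists (fun k => if k == i then val j else h k); split=> [k|a aE].
    by case: eqP => [->|_] //; apply: ltn_ord.
  congr (_, _); first by apply: val_inj; have := aE i (mem_head _ _); rewrite eqxx.
  apply: hP => k kl; rewrite aE ?inE ?kl ?orbT // ifN //.
  by apply: contraNneq il => <-.
exists ([ffun i => Ordinal (h_lt i)] : {dffun forall i, 'I_(tnth d i)}).
by apply: hP => i _; rewrite /cl_coord ffunE.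
Qed.

(** Coordinates of sides of length one are constant and dropped, so that the length of s becomes the
    dimension. Sorting puts the longest side at the head, as [clements_lindstrom_Mac] demands. *)
Lemma cl_box : exists s,
  [/\ sorted geq s, all (leq 2) s, perm_eq s [seq k <- d | 1 < k] &
   exists f : box s -> CL, [/\ bijective f, {mono f : x y / le x y >-> (x <= y)%O} &
                               forall x, rank (f x) = rk x]].
Proof.
pose l := sort (relpre (tnth d) geq) [seq i <- enum 'I_n | 1 < tnth d i].
have mem_l i : (i \in l) = (1 < tnth d i) by rewrite mem_sort mem_filter mem_enum andbT.
have l_uniq : uniq l by rewrite sort_uniq filter_uniq ?enum_uniq.
have out (a : CL) i : i \notin l -> cl_coord a i = 0.
  by rewrite mem_l -leqNgt => di; have := ltn_ord ((a : {dffun forall i, 'I_(tnth d i)}) i);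
     rewrite /cl_coord; lia.
have leE (a b : CL) : le (cl_proj l a) (cl_proj l b) = (a <= b)%O.
  rewrite cl_proj_le cl_leE; apply/allP/forallP => [ab i|ab i _]; last exact: ab.
  by have [/ab//|/(out a)->] := boolP (i \in l).
have rkE (a : CL) : rk (cl_proj l a) = rank a.
  rewrite cl_proj_rk cl_rankE [RHS](bigID (mem l)) /= [X in _ = _ + X]big1 ?addn0; last first.
    by move=> i; apply: out.
  exact: big_uniq.
have [f fK] := fin_all_exists (fun x => cl_proj_surj x l_uniq).
have gK : cancel (cl_proj l) f.
  by move=> a; apply/eqP; rewrite Order.POrderTheory.eq_le -!leE fK le_refl.
exists [seq tnth d i | i <- l]; split.
- by rewrite sorted_map; apply: sort_sorted => i j; apply: leq_total.
- by apply/allP=> _ /mapP[i + ->]; rewrite mem_l.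
- by rewrite -[X in filter _ X](map_tnth_enum d) filter_map perm_map // perm_sort.
exists f; split; first by exists (cl_proj l).
- by move=> x y; rewrite -leE !fK.
by move=> x; rewrite -rkE fK.
Qed.

End Representation.

(** For a set inside a level of rank at most r of a ranked poset this is the iterated shadow, see
    [shadow_up]. *)
Definition up (X : kgraph) r (A : {set X}) : {set X} :=
  [set y in lev X r | [exists x in A, le x y]].

Lemma up_lev (X : kgraph) r (A : {set X}) : up r A \subset lev X r.
Proof. by apply/subsetP=> x; rewrite inE => /andP[]. Qed.

Lemma upP (X : kgraph) r (A : {set X}) y :
  reflect (rk y = r /\ exists2 x, x \in A & le x y) (y \in up r A).
Proof.
rewrite !inE; apply: (iffP andP) => [[/eqP ry /exists_inP]|[/eqP ry xA]] //.
by split=> //; apply/exists_inP.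
Qed.

Lemma up_id (X : kgraph) r (A : {set X}) : A \subset lev X r -> up r A = A.
Proof.
move=> sA; apply/setP=> y; apply/upP/idP => [[ry [x xA /le_rk[<-//|]]]|yA].
  by have := subsetP sA _ xA; rewrite inE => /eqP; lia.
split; last by exists y; rewrite ?le_refl.
by have := subsetP sA _ yA; rewrite inE => /eqP.
Qed.

Lemma up0 (X : kgraph) r : up r (set0 : {set X}) = set0.
Proof.
by apply/setP=> y; rewrite [RHS]inE; apply/upP => -[_ [x]]; rewrite inE.
Qed.

(* For [rk x = 0] the two images meet at the bottom, and from rank [R] on at the top;
   a wedge is the case where [R] exceeds all ranks. *)
Record glued (disp : Order.disp_t) (D : rankedType disp) (X Y : kgraph)
    (f : X -> D) (g : Y -> D) (R : nat) : Prop := Glued {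
  glued_lef : forall x x', (f x <= f x')%O = le x x';
  glued_leg : forall y y', (g y <= g y')%O = le y y';
  glued_rkf : forall x, rank (f x) = rk x;
  glued_rkg : forall y, rank (g y) = rk y;
  glued_surj : forall z, (exists x, z = f x) \/ (exists y, z = g y);
  glued_fg : forall x y, 0 < rk x -> rk y < R -> ~~ (f x <= g y)%O;
  glued_gf : forall x y, 0 < rk y -> rk x < R -> ~~ (g y <= f x)%O }.

Lemma gluedC disp (D : rankedType disp) X Y f g R :
  @glued disp D X Y f g R -> glued g f R.
Proof.
case=> lef leg rkf rkg surj fg gf; split=> // [z|x y|x y].
- by case: (surj z); [right|left].
- exact: gf.
- exact: fg.
Qed.

(** * Two posets glued at their extremes *)

Section Glued.
Variables (disp : Order.disp_t) (D : rankedType disp) (X Y : kgraph).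
Variables (f : X -> D) (g : Y -> D) (R : nat).
Hypothesis gl : glued f g R.
Let lef := glued_lef gl.
Let leg := glued_leg gl.
Let rkf := glued_rkf gl.
Let rkg := glued_rkg gl.

Lemma glued_injf : injective f.
Proof.
move=> x x' E; have : le x x' by rewrite -lef E Order.POrderTheory.lexx.
by case/le_rk=> // lt; have := congr1 (@rank disp D) E; rewrite !rkf; lia.
Qed.

Lemma glued_injg : injective g.
Proof.
move=> y y' E; have : le y y' by rewrite -leg E Order.POrderTheory.lexx.
by case/le_rk=> // lt; have := congr1 (@rank disp D) E; rewrite !rkg; lia.
Qed.

Lemma glued_neq x y : 0 < rk x < R -> f x <> g y.
Proof.
case/andP=> x0 xR E; have := glued_fg gl (x := x) (y := y) x0.
by rewrite -rkg -E rkf Order.POrderTheory.lexx => /(_ xR).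
Qed.

Section Keyed.
Variables (k : D -> nat) (k_inj : injective k).
Local Notation K := (keyed_poset k_inj).
Implicit Types (C : {set K}) (r : nat).

Lemma glued_card r C : 0 < r < R -> C \subset lev K r ->
  #|C| = #|f @^-1: C| + #|g @^-1: C|.
Proof.
move=> rR sC; rewrite -(cardsID (f @: setT) C); congr (_ + _).
  rewrite -(card_imset _ glued_injf); apply: eq_card => z; rewrite !inE.
  apply/andP/imsetP => [[zC /imsetP[x _ E]]|[x + ->]].
    by exists x => //; rewrite inE -E.
  by rewrite inE => ->; rewrite imset_f.
rewrite -(card_imset _ glued_injg); apply: eq_card => z; rewrite !inE.
apply/andP/imsetP => [[zf zC]|[y + ->]].
  case: (glued_surj gl z) => [[x E]|[y E]]; first by rewrite E imset_f in zf.
  by exists y => //; rewrite inE -E.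
rewrite inE => yC; split=> //; apply/imsetP => -[x _ E].
by apply: (@glued_neq x y) => //; have := subsetP sC _ yC; rewrite inE /= E rkf => /eqP->.
Qed.

Lemma glued_levf r C : C \subset lev K r -> f @^-1: C \subset lev X r.
Proof.
move=> sC; apply/subsetP=> x; rewrite inE => /(subsetP sC).
by rewrite !inE /= rkf.
Qed.

Lemma glued_shadowf r C : 0 < r -> r.+1 < R -> C \subset lev K r ->
  f @^-1: (shadow C) = shadow (f @^-1: C).
Proof.
move=> r0 rR sC; apply/setP=> x; rewrite inE; apply/shadowP/shadowP => [[z zC]|[x' x'C]].
  have rz : rank z = r by have := subsetP sC _ zC; rewrite inE => /eqP.
  case: (glued_surj gl z) zC rz => [[x' ->]|[y ->]] zC rz.
    by rewrite /cov /= lef !rkf => cx; exists x' => //; rewrite inE.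
  rewrite /cov /= rkf => /andP[le_yx /eqP rx]; move: le_yx; rewrite (negbTE (glued_gf gl _ _)) //.
    by rewrite -rkg rz.
  by rewrite rx rz.
by rewrite /cov => cx; exists (f x'); [move: x'C; rewrite inE | rewrite /= lef !rkf].
Qed.

Lemma glued_up r r' C : 0 < r -> r' < R -> C \subset lev K r ->
  f @^-1: up r' C = up r' (f @^-1: C).
Proof.
move=> r0 rR sC; apply/setP=> x; rewrite !inE /= rkf; case: eqP => //= rx.
apply/exists_inP/exists_inP => [[z zC]|[w wC le_wx]]; last first.
  by exists (f w); [move: wC; rewrite inE | rewrite lef].
have rz : rank z = r by have := subsetP sC _ zC; rewrite inE => /eqP.
case: (glued_surj gl z) zC rz => [[w ->]|[y ->]] zC rz.
  by rewrite lef => ?; exists w => //; rewrite inE.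
by rewrite (negbTE (glued_gf gl _ _)) // ?rx // -rkg rz.
Qed.

Lemma ini_preimf r C : (forall x x', (k (f x) <= k (f x')) = (key x <= key x')) ->
  ini r C -> ini r (f @^-1: C).
Proof.
move=> kE /iniP[Cr Cu]; apply/iniP; split=> [x|x x']; rewrite inE => xC.
  by have := Cr _ xC; rewrite /= rkf.
by move=> rx kx; rewrite inE; apply: Cu xC _ _; rewrite /= ?rkf ?kE.
Qed.

End Keyed.
End Glued.

Section GluedMacaulay.
Variables (disp : Order.disp_t) (D : rankedType disp) (X Y : kgraph).
Variables (f : X -> D) (g : Y -> D) (R : nat).
Hypothesis gl : glued f g R.
Hypothesis bot_uniq : forall z z' : D, rank z = 0 -> rank z' = 0 -> z = z'.
Hypothesis top_uniq : forall z z' : D, R <= rank z -> rank z = rank z' -> z = z'.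
Hypothesis le_top : forall z z' : D, R <= rank z' -> rank z' = (rank z).+1 -> (z <= z')%O.
Hypothesis ini_shadowX : forall r (S : {set X}), ini r S -> ini r.+1 (shadow S).
Hypothesis ini_shadowY : forall r (S : {set Y}), ini r S -> ini r.+1 (shadow S).
Hypothesis shadow_min : forall r (A S : {set X}) (B U : {set Y}), 0 < r -> r.+1 < R ->
  A \subset lev X r -> B \subset lev Y r -> ini r S -> ini r U ->
  S = lev X r \/ U = set0 -> #|S| + #|U| = #|A| + #|B| ->
  #|shadow S| + #|shadow U| <= #|shadow A| + #|shadow B|.

(** The offset puts the image of X before the rest of Y; identified points take their key from X. By
    surjectivity the default 0 never occurs. *)
Definition glued_key (z : D) : nat :=
  if [pick x | f x == z] is Some x then kbound Y + key x
  else if [pick y | g y == z] is Some y then key y else 0.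

Lemma glued_keyf x : glued_key (f x) = kbound Y + key x.
Proof.
rewrite /glued_key; case: pickP => [x' /eqP/(glued_injf gl)->//|/(_ x)].
by rewrite eqxx.
Qed.

Lemma glued_keyg y : (exists2 x, f x = g y & glued_key (g y) = kbound Y + key x) \/
  (forall x, f x <> g y) /\ glued_key (g y) = key y.
Proof.
rewrite /glued_key; case: pickP => [x /eqP E|nf]; first by left; exists x.
right; split; first by move=> x /eqP; rewrite nf.
by case: pickP => [y' /eqP/(glued_injg gl)->//|/(_ y)]; rewrite eqxx.
Qed.

Lemma glued_key_inj : injective glued_key.
Proof.
move=> z z'; case: (glued_surj gl z) => [[x ->]|[y ->]];
  case: (glued_surj gl z') => [[x' ->]|[y' ->]]; rewrite ?glued_keyf.
- by move/addnI/key_inj->.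
- case: (glued_keyg y') => [[x0 <- ->]|[_ ->]]; first by move/addnI/key_inj->.
  by have := key_lt y'; lia.
- case: (glued_keyg y) => [[x0 <- ->]|[_ ->]]; first by move/addnI/key_inj->.
  by have := key_lt y; lia.
case: (glued_keyg y) => [[x0 <- ->]|[_ ->]]; case: (glued_keyg y') => [[x1 <- ->]|[_ ->]].
- by move/addnI/key_inj->.
- by have := key_lt y'; lia.
- by have := key_lt y; lia.
- by move/key_inj->.
Qed.

Local Notation K := (keyed_poset glued_key_inj).
Implicit Types (C : {set K}) (r : nat).

Lemma glued_key_mid y : 0 < rk y < R -> glued_key (g y) = key y.
Proof.
case: (glued_keyg y) => [[x E _]|[_ ->]] // ry.
by case: (glued_neq gl (x := x) (y := y)) => //; rewrite -(glued_rkf gl) E (glued_rkg gl).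
Qed.

Lemma glued_iniP r C : 0 < r < R -> ini r C <->
  [/\ C \subset lev K r, ini r (f @^-1: C), ini r (g @^-1: C) &
      f @^-1: C = lev X r \/ g @^-1: C = set0].
Proof.
move=> rR; split=> [iC|[sC /iniP[fr fu] /iniP[gr gu] fg]].
  have [Cr Cu] := iniP _ _ iC; split; first exact: ini_lev.
  - by apply: (ini_preimf gl) iC => x x'; rewrite !glued_keyf leq_add2l.
  - apply/iniP; split=> [y|y y']; rewrite inE => yC.
      by have := Cr _ yC; rewrite /= (glued_rkg gl).
    have ry : rk y = r by have := Cr _ yC; rewrite /= (glued_rkg gl).
    move=> ry' ky; rewrite inE; apply: (Cu _ _ yC); first by rewrite /= (glued_rkg gl).
    by rewrite /= !glued_key_mid ?ry ?ry'.
  - have [|[y]] := set_0Vmem (g @^-1: C); [by right|rewrite inE => yC; left].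
    apply/setP=> x; rewrite !inE; apply/idP/eqP => [/Cr|rx].
      by rewrite /= (glued_rkf gl).
    apply: (Cu _ _ yC); first by rewrite /= (glued_rkf gl).
    rewrite /= glued_keyf glued_key_mid; first by have := key_lt y; lia.
    by have := Cr _ yC; rewrite /= (glued_rkg gl) => ->.
apply/iniP; split=> [z /(subsetP sC)|z z' zC rz' kz]; first by rewrite inE => /eqP.
have rz : rank z = r by have := subsetP sC _ zC; rewrite inE => /eqP.
rewrite /= in rz' kz.
case: (glued_surj gl z) zC rz kz => [[x ->]|[y ->]] zC rz kz;
  case: (glued_surj gl z') rz' kz => [[x' ->]|[y' ->]]; rewrite ?(glued_rkf gl) ?(glued_rkg gl) => rz'.
- rewrite !glued_keyf leq_add2l => kx.
  by have := fu x x'; rewrite !inE; apply.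
- rewrite glued_keyf glued_key_mid ?rz' //; have := key_lt y'; lia.
- move=> _; case: fg => E; last by have := in_set0 y; rewrite -E inE zC.
  by have : x' \in lev X r; [rewrite inE rz' | rewrite -E inE].
rewrite (glued_rkg gl) in rz; rewrite !glued_key_mid ?rz ?rz' // => ky.
by have := gu y y'; rewrite !inE; apply.
Qed.

(** A point of X has a predecessor in D, which in middle ranks cannot come from Y. Thus a segment
    that has exhausted X keeps this shape under shadows. *)
Lemma shadow_full r : 0 < r -> r.+1 < R -> shadow (lev X r) = lev X r.+1.
Proof.
move=> r0 rR; apply/setP=> x; rewrite [RHS]inE; apply/shadowP/eqP => [[x' + /cov_rk->]|rx].
  by rewrite inE => /eqP->.
have [|z] := @covers_pred _ D (f x); first by rewrite (glued_rkf gl) rx.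
rewrite coversE (glued_rkf gl) rx eqSS => /andP[le_zx /eqP rz].
case: (glued_surj gl z) le_zx rz => [[x' ->]|[y ->]].
  rewrite (glued_lef gl) (glued_rkf gl) => le_x rx'.
  by exists x'; [rewrite inE rx' | rewrite /cov le_x rx rx' eqxx].
by rewrite (glued_rkg gl) => + ry; rewrite (negbTE (glued_gf gl _ _)) ?rx -?ry.
Qed.

(** At rank 0 and from rank R on, levels have at most one element. Between them segments are
    described by [glued_iniP], and condition (i) becomes [shadow_min]. *)
Lemma glued_macaulay : macaulay D.
Proof.
apply/macaulayP; exists glued_key, glued_key_inj.
have sub_uniq r (A S : {set K}) : (forall z z' : D, rank z = r -> rank z' = r -> z = z') ->
    A \subset lev K r -> S \subset lev K r -> S != set0 -> A \subset S.
  move=> uniq_r sA sS /set0Pn[z zS]; apply/subsetP=> w wA; rewrite (uniq_r w z) //.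
    by have := subsetP sA _ wA; rewrite inE => /eqP.
  by have := subsetP sS _ zS; rewrite inE => /eqP.
have ini_uniq r C : (forall z z' : D, rank z = r -> rank z' = r -> z = z') ->
    C \subset lev K r -> ini r C.
  move=> uniq_r sC; have [->|C0] := eqVneq C set0; first exact: ini0.
  suff -> : C = lev K r by exact: ini_full.
  by apply/eqP; rewrite eqEsubset sC (sub_uniq r).
split=> [r C iC|r A S sA iS cS].
  have sC := ini_lev iC.
  have [Rr|rR] := leqP R r.+1.
    apply: ini_uniq (shadow_lev sC) => z z' rz rz'; apply: top_uniq; first by rewrite rz.
    by rewrite rz rz'.
  have [r0|r0] := posnP r.
    have [->|C0] := eqVneq C set0; first by rewrite shadow0 ini0.
    suff -> : shadow C = lev K r.+1 by exact: ini_full.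
    apply/eqP; rewrite eqEsubset shadow_lev //=; apply/subsetP=> z zl.
    have rz : rank z = r.+1 by move: zl; rewrite inE => /eqP.
    have [|w] := @covers_pred _ D z; first by rewrite rz.
    move=> cwz; apply/(@shadowP K); exists w; last by rewrite /cov /= -coversE.
    move: cwz; rewrite coversE => /andP[_ /eqP]; rewrite rz r0 => -[rw].
    apply: (subsetP (@sub_uniq 0 [set w] C _ _ _ _)) (set11 _); rewrite -?r0 //.
      by rewrite r0; move=> z1 z2; apply: bot_uniq.
    by apply/subsetP=> v; rewrite !inE => /eqP->; rewrite /= -rw r0.
  have [|sC' iX iY XY] := (glued_iniP (r := r) C _).1 iC; first by rewrite r0 ltnW.
  apply/glued_iniP; first by rewrite rR.
  have EX := glued_shadowf gl r0 rR sC; have EY := glued_shadowf (gluedC gl) r0 rR sC.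
  split; first exact: shadow_lev.
  - by rewrite EX; apply: ini_shadowX.
  - by rewrite EY; apply: ini_shadowY.
  rewrite EX EY; case: XY => ->; [left|right]; first exact: shadow_full.
  exact: shadow0.
have sS := ini_lev iS.
have [S0|S0] := eqVneq S set0; first by rewrite S0 shadow0 cards0.
have A0 : A != set0 by rewrite -card_gt0 -cS card_gt0.
have [Rr|rR] := leqP R r.+1.
  apply/subset_leq_card/subsetP=> z zS; have rz := subsetP (shadow_lev sS) _ zS.
  have [w wA] := set0Pn _ A0; apply/(@shadowP K); exists w => //.
  have := subsetP sA _ wA; rewrite /cov !inE /= in rz * => /eqP rw.
  by rewrite rw rz andbT; apply: le_top; rewrite (eqP rz) // rw.
have [r0|r0] := posnP r.
  suff -> : A = S by [].
  rewrite r0 in sA sS; apply/eqP.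
  by rewrite eqEsubset; apply/andP; split; apply: (sub_uniq 0 _ _ bot_uniq).
have r1R : 0 < r < R by rewrite r0 ltnW.
have [_ iX iY XY] := (glued_iniP S r1R).1 iS.
rewrite (glued_card gl _ (shadow_lev sS)) ?rR // (glued_card gl _ (shadow_lev sA)) ?rR //.
rewrite !(glued_shadowf gl r0 rR) // !(glued_shadowf (gluedC gl) r0 rR) //.
apply: (shadow_min r0 rR (glued_levf gl sA) (glued_levf (gluedC gl) sA) iX iY XY).
by rewrite -!(glued_card gl r1R).
Qed.

End GluedMacaulay.

(** * Iterated shadows and necessity for diamonds *)

Section IteratedShadow.
Variables (disp : Order.disp_t) (D : rankedType disp) (k : D -> nat) (k_inj : injective k).
Local Notation K := (keyed_poset k_inj).
Implicit Types (A S : {set K}).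

Lemma shadow_up r r' A : A \subset lev K r -> r <= r' -> shadow (up r' A) = up r'.+1 A.
Proof.
move=> sA rr'; apply/setP=> y; apply/shadowP/upP => [[z /upP[rz [x xA xz]] czy]|[ry [x xA xy]]].
  split; first by rewrite (cov_rk czy) rz.
  by exists x => //; apply: Order.POrderTheory.le_trans xz (cov_le czy).
have rx : rank x = r by have := subsetP sA _ xA; rewrite inE => /eqP.
have [|z czy xz] := @covers_above _ D x y.
  rewrite Order.POrderTheory.lt_neqAle (xy : (x <= y)%O) andbT; apply/eqP=> E.
  by rewrite /= in ry; rewrite -E rx in ry; lia.
exists z; last by rewrite /cov /= -coversE.
apply/upP; split; last by exists x.
by have := rank_covers _ _ czy; rewrite /= in ry *; rewrite ry => -[].
Qed.

Hypothesis MacK : Mac K.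

Lemma ini_up r r' A : r <= r' -> ini r A -> ini r' (up r' A).
Proof.
move=> rr' iA; have sA := ini_lev iA; rewrite -(subnKC rr').
elim: (r' - r) => [|n IHn]; first by rewrite addn0 up_id.
by rewrite addnS -(shadow_up sA) ?leq_addr //; apply: MacK.1.
Qed.

(** Condition (ii) keeps each iterate of S a segment, so condition (i) applies again at every
    rank. *)
Lemma card_up r r' A S : r <= r' -> A \subset lev K r -> ini r S -> #|S| <= #|A| ->
  #|up r' S| <= #|up r' A|.
Proof.
move=> rr' sA iS cSA; have sS := ini_lev iS; rewrite -(subnKC rr').
elim: (r' - r) => [|n IHn]; first by rewrite addn0 !up_id.
rewrite addnS -(shadow_up sA) ?leq_addr // -(shadow_up sS) ?leq_addr //.
exact: (Mac_leq MacK (up_lev (r + n) A) (ini_up (leq_addr n r) iS) IHn).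
Qed.

End IteratedShadow.

Section BoxUp.
Variable s : seq nat.
Implicit Types (x y : box s) (A : {set box s}).

Lemma box_below x r : r <= rk x -> exists2 x', rk x' = r & le x' x.
Proof.
elim: s x r => [|d s' IHs] /=; first by move=> x r; rewrite leqn0 => /eqP->; exists tt.
move=> [i x] r /= ri; have [|x' rx' lx'] := IHs x (minn r (rk x)); first exact: geq_minr.
have ltd := ltn_ord i.
have i'd : r - minn r (@rk (box s') x) < d by lia.
exists (Ordinal i'd, x'); first by rewrite /= rx'; lia.
by rewrite /= lx' andbT; lia.
Qed.

Lemma box_above x r : rk x <= r <= box_rank s -> exists2 x', rk x' = r & le x x'.
Proof.
case/andP=> xr rs; have [|y ry ly] := @box_below (box_rev x) (box_rank s - r).
  by have := box_rk_rev x; lia.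
exists (box_rev y); last by rewrite -box_le_rev box_revK.
by have := box_rk_rev y; lia.
Qed.

Lemma box_up_lev r r' : r <= r' -> up r' (lev (box s) r) = lev (box s) r'.
Proof.
move=> rr'; apply/eqP; rewrite eqEsubset up_lev; apply/subsetP=> x; rewrite inE => /eqP rx.
apply/upP; split=> //; have [|y ry ly] := @box_below x r; first by rewrite rx.
by exists y => //; rewrite inE ry.
Qed.

Lemma box_up_gt0 r r' A : A \subset lev (box s) r -> A != set0 -> r <= r' <= box_rank s ->
  0 < #|up r' A|.
Proof.
move=> sA /set0Pn[x xA] rr'.
have rx : rk x = r by have := subsetP sA _ xA; rewrite inE => /eqP.
have [|y ry ly] := @box_above x r'; first by rewrite rx.
by apply/card_gt0P; exists y; apply/upP; split=> //; exists x.
Qed.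

(** Complementation pairs atoms with coatoms. A coatom [box_rev b] above no member of A forces A to
    be the singleton of b, so at most one coatom is lost, and only with a side of length two. *)
Lemma box_coatoms A : 1 < box_rank s -> A \subset lev (box s) 1 -> A != set0 ->
  #|lev (box s) 1| <= #|up (box_rank s).-1 A| + ((#|A| == 1) && (2 \in s)).
Proof.
move=> R1 sA A0; have [a aA] := set0Pn _ A0.
have aP x : x \in A -> rk x = 1 by move=> /(subsetP sA); rewrite inE => /eqP.
pose U := up (box_rank s).-1 A.
have revU b : rk b = 1 -> (box_rev b \notin U) -> A = [set b] /\ 2 \in s.
  move=> rb nU; have all_b x : x \in A -> x = b /\ 2 \in s.
    move=> xA; apply: (box_atom_coatom (aP _ xA) rb); apply: contra nU => le_x.
    by apply/upP; split; [have := box_rk_rev b; lia | exists x].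
  split; last by case: (all_b a aA).
  apply/setP=> x; rewrite inE; apply/idP/eqP => [/all_b[]//|->].
  by have [<-] := all_b a aA.
pose L := [set x in lev (box s) 1 | box_rev x \in U].
have LE b : (b \in L) = (rk b == 1) && (box_rev b \in U).
  by rewrite in_set; congr (_ && _); rewrite in_set.
have levE (b : box s) : (b \in lev (box s) 1) = (rk b == 1) by rewrite in_set.
have LU : #|L| <= #|U|.
  rewrite -(card_imset _ (inv_inj (@box_revK s))); apply/subset_leq_card/subsetP.
  by move=> _ /imsetP[x + ->]; rewrite LE => /andP[].
apply: leq_trans (leq_add LU (leqnn _)).
rewrite -(cardsID L (lev (box s) 1)) (setIidPr _) ?leq_add2l; last first.
  by apply/subsetP=> x; rewrite LE levE => /andP[].
have [->|[b]] := set_0Vmem (lev (box s) 1 :\: L); first by rewrite cards0.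
rewrite in_setD LE levE => /andP[+ rb]; rewrite rb /= => bU.
have [EA s2] := revU b (eqP rb) bU; rewrite EA cards1 eqxx s2 /=.
rewrite -[leqRHS](cards1 b); apply/subset_leq_card/subsetP=> c; rewrite in_setD LE levE.
case/andP=> + rc; rewrite rc /= => /(revU c (eqP rc))[EA' _].
by rewrite -EA EA' set11.
Qed.

End BoxUp.

Section DiamondNecessity.
Variables (disp : Order.disp_t) (D : rankedType disp) (k : D -> nat) (k_inj : injective k).
Local Notation K := (keyed_poset k_inj).
Hypothesis MacK : Mac K.

Lemma glued_card_up s t (f : box s -> D) (g : box t -> D) R r r' (C : {set K}) :
    glued f g R -> 0 < r -> r <= r' < R -> C \subset lev K r ->
  #|up r' C| = #|up r' (f @^-1: C)| + #|up r' (g @^-1: C)|.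
Proof.
move=> gl r0 /andP[rr' r'R] sC; have r'0 : 0 < r' < R by rewrite r'R (leq_trans r0).
rewrite (glued_card gl r'0 (up_lev r' C)).
by rewrite (glued_up gl r0 r'R sC) (glued_up (gluedC gl) r0 r'R sC).
Qed.

Section Parts.
Variables (s t : seq nat) (f : box s -> D) (g : box t -> D) (R : nat).
Hypothesis gl : glued f g R.

Definition part r : {set K} := f @: lev (box s) r.

Lemma part_lev r : part r \subset lev K r.
Proof.
by apply/subsetP=> _ /imsetP[x + ->]; rewrite !inE /= (glued_rkf gl).
Qed.

Lemma card_part r : #|part r| = #|lev (box s) r|.
Proof. by rewrite card_imset //; apply: glued_injf gl. Qed.

Lemma part_pre r : f @^-1: part r = lev (box s) r.
Proof. by apply/setP=> x; rewrite inE mem_imset //; apply: glued_injf gl. Qed.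

Lemma part_pre0 r : 0 < r < R -> g @^-1: part r = set0.
Proof.
move=> rR; apply/setP=> y; rewrite !inE; apply/imsetP=> -[x]; rewrite inE => /eqP rx E.
by apply: (glued_neq gl (x := x) (y := y)); rewrite ?rx.
Qed.

Lemma up_part r r' : 0 < r -> r <= r' < R -> up r' (part r) = part r'.
Proof.
move=> r0 rr'; have r'R : 0 < r' < R by lia.
have rR : 0 < r < R by lia.
have EX : f @^-1: up r' (part r) = f @^-1: part r'.
  have -> := glued_up gl r0 (proj2 (andP rr')) (part_lev r).
  by rewrite !part_pre -[RHS](@box_up_lev s r) //; case/andP: rr'.
have EY : g @^-1: up r' (part r) = g @^-1: part r'.
  have -> := glued_up (gluedC gl) r0 (proj2 (andP rr')) (part_lev r).
  by rewrite !part_pre0 //; apply: (up0 (box t) r').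
apply/setP=> z; case: (glued_surj gl z) => [[x ->]|[y ->]].
  by move/setP/(_ x): EX; rewrite ![x \in _ @^-1: _]inE.
by move/setP/(_ y): EY; rewrite ![y \in _ @^-1: _]inE.
Qed.

End Parts.
End DiamondNecessity.

Lemma size_box_rank s : all (leq 2) s -> size s <= box_rank s.
Proof.
elim: s => [|d s IHs] //= /andP[d2 /IHs]; rewrite /box_rank /= -/(box_rank s); lia.
Qed.

Lemma box_eq_two s t : sorted geq s -> sorted geq t -> all (leq 2) s -> all (leq 2) t ->
  size s = 2 -> size t = 2 -> 2 \in s -> 2 \in t -> box_rank s = box_rank t -> s = t.
Proof.
case: s => [|a [|b []]] //; case: t => [|a' [|b' []]] //; rewrite /box_rank /= !andbT.
move=> ba ba' /andP[a2 b2] /andP[a2' b2'] _ _; rewrite !inE => sb tb E.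
by congr [:: _; _]; move: ba ba' sb tb; rewrite /geq /=; lia.
Qed.

Lemma card_coatoms s : all (leq 2) s -> 0 < box_rank s ->
  #|lev (box s) (box_rank s).-1| = size s.
Proof. by move=> s2 R0; rewrite -subn1 card_lev_rev // card_lev1. Qed.

Section DiamondNecessity.
Variables (disp : Order.disp_t) (D : rankedType disp) (k : D -> nat) (k_inj : injective k).
Local Notation K := (keyed_poset k_inj).
Hypothesis MacK : Mac K.

Section Parts.
Variables (s t : seq nat) (f : box s -> D) (g : box t -> D) (R : nat).
Hypotheses (gl : glued f g R) (sR : box_rank s = R) (tR : box_rank t = R).
Hypotheses (s2 : all (leq 2) s) (t2 : all (leq 2) t).

Let coatoms_s : 0 < R -> #|lev (box s) R.-1| = size s.
Proof. by rewrite -sR => /(card_coatoms s2). Qed.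

Let coatoms_t : 0 < R -> #|lev (box t) R.-1| = size t.
Proof. by rewrite -tR => /(card_coatoms t2). Qed.

(** Comparison with the atoms of [s], above which lie only its own [size s] coatoms. *)
Lemma ini_part_coatoms (S : {set K}) : 1 < R -> ini 1 S -> #|S| <= size s ->
  #|up R.-1 (f @^-1: S)| + #|up R.-1 (g @^-1: S)| <= size s.
Proof.
move=> R1 iS cS; have R0 : 0 < R.-1 < R by lia.
rewrite -(glued_card_up gl _ _ (ini_lev iS)) ?ltn_predL //; last by lia.
have cP : #|S| <= #|part k_inj f 1| by rewrite (card_part _ gl) card_lev1.
have R1' : 1 <= R.-1 by lia.
apply: leq_trans (card_up MacK R1' (part_lev _ gl 1) iS cP) _.
have R1R : 1 <= R.-1 < R by lia.
rewrite (up_part _ gl (r := 1) isT R1R).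
by rewrite (card_part _ gl) coatoms_s // ltnW.
Qed.

Lemma first_atoms (S : {set K}) : 1 < R -> size s <= size t -> ini 1 S -> #|S| = size s ->
  [\/ f @^-1: S = lev (box s) 1, size s = size t /\ g @^-1: S = lev (box t) 1,
      [/\ size s = 1, size t = 2 & 2 \in t] |
      [/\ size s = 2, size t = 2, 2 \in s & 2 \in t]].
Proof.
move=> R1 st iS cS; pose F := f @^-1: S; pose G := g @^-1: S.
have u : #|up R.-1 F| + #|up R.-1 G| <= size s := ini_part_coatoms R1 iS (eq_leq cS).
have sF : F \subset lev (box s) 1 := glued_levf gl (ini_lev iS).
have sG : G \subset lev (box t) 1 := glued_levf (gluedC gl) (ini_lev iS).
have cFG : #|F| + #|G| = size s by rewrite -cS (glued_card gl _ (ini_lev iS)).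
have CF : F != set0 -> size s <= #|up R.-1 F| + ((#|F| == 1) && (2 \in s)).
  by move=> F0; have := @box_coatoms s F; rewrite sR card_lev1 //; apply.
have CG : G != set0 -> size t <= #|up R.-1 G| + ((#|G| == 1) && (2 \in t)).
  by move=> G0; have := @box_coatoms t G; rewrite tR card_lev1 //; apply.
rewrite -/F -/G.
have [G0|G0] := eqVneq G set0.
  constructor 1; apply/eqP; rewrite eqEcard sF card_lev1 //.
  by move: cFG; rewrite G0 cards0 addn0 => ->; rewrite leqnn.
have bG := CG G0; rewrite -card_gt0 in G0.
have [F0|F0] := eqVneq F set0.
  move: cFG u; rewrite F0 up0 !cards0 !add0n => cG u.
  have [E|n] := eqVneq (size s) (size t).
    constructor 2; split=> //; apply/eqP.
    by rewrite eqEcard sG card_lev1 // cG E leqnn.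
  constructor 3; move: bG; rewrite cG; case: eqP => /= [s1|]; last by move=> *; exfalso; lia.
  by clear -s1 u n st; case: (2 \in t) => /= ?; [split=> //; lia | exfalso; lia].
have bF := CF F0; rewrite -card_gt0 in F0.
constructor 4; clear -cFG u st F0 G0 bF bG.
move: (#|up R.-1 F|) (#|up R.-1 G|) u bF bG => uF uG u.
case: (#|F| =P 1) => /= f1; case: (#|G| =P 1) => /= g1;
  case: (2 \in s); case: (2 \in t) => /= *; (exfalso; lia) || (split=> //; lia).
Qed.

(** Once the atoms of [s] come first, the first [size t] atoms also contain one of [t]. Above them
    lie all coatoms of [s] and all but at most one of [t], against the [size t] coatoms above the
    atoms of [t]; so [size s] is at most 1. *)
Lemma diamond_dim_lt : size s < size t -> [/\ size s = 1, size t = 2 & 2 \in t].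
Proof.
move=> st; have := size_box_rank t2; rewrite tR => tR'.
have s0 : 0 < size s.
  rewrite lt0n; apply/eqP=> /size0nil E; move: sR; rewrite E /box_rank /= => E'; lia.
have R1 : 1 < R by lia.
have rR : 0 < 1 < R by [].
have cP : size s = #|part k_inj f 1| by rewrite (card_part _ gl) card_lev1.
have cQ : size t = #|part k_inj g 1| by rewrite (card_part _ (gluedC gl)) card_lev1.
have [S iS cS] : exists2 S : {set K}, ini 1 S & #|S| = size s.
  by rewrite cP; apply/ini_exists/subset_leq_card/(part_lev _ gl).
have [S' iS' cS'] : exists2 S : {set K}, ini 1 S & #|S| = size t.
  by rewrite cQ; apply/ini_exists/subset_leq_card/(part_lev _ (gluedC gl)).
case: (first_atoms R1 (ltnW st) iS cS) => [EF|[]|//|[]]; try by move=> *; exfalso; lia.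
have SS' : S \subset S' by apply: (ini_sub iS iS'); rewrite cS cS' ltnW.
have EF' : f @^-1: S' = lev (box s) 1.
  apply/eqP; rewrite eqEsubset (glued_levf gl (ini_lev iS')) -EF.
  by apply: preimsetS.
have cP' : #|S'| <= #|part k_inj g 1| by rewrite cS' cQ.
have R1' : 1 <= R.-1 by lia.
have := card_up MacK R1' (part_lev k_inj (gluedC gl) 1) iS' cP'.
have R1R : 1 <= R.-1 < R by lia.
rewrite (up_part _ (gluedC gl) (r := 1) isT R1R).
rewrite (card_part _ (gluedC gl)) coatoms_t ?(ltnW R1) //.
rewrite (glued_card_up gl (r := 1) isT R1R (ini_lev iS')).
rewrite EF' box_up_lev // coatoms_s ?(ltnW R1) //; pose G := g @^-1: S'; rewrite -/G => u.
have cG : size s + #|G| = size t.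
  by rewrite -cS' (glued_card gl rR (ini_lev iS')) EF' card_lev1.
have G0 : G != set0 by rewrite -card_gt0; lia.
have := box_coatoms _ (glued_levf (gluedC gl) (ini_lev iS')) G0.
rewrite -/G tR card_lev1 // => /(_ R1); case: (#|G| =P 1) => /= [g1|_ ?]; last by exfalso; lia.
by case: (2 \in t) => /= *; [split=> //; lia | exfalso; lia].
Qed.

Lemma diamond_level_lt r : size s = size t -> s <> t -> sorted geq s -> sorted geq t ->
  0 < r < R -> ~ #|lev (box s) r| < #|lev (box t) r|.
Proof.
move=> st neq ss ts rR ltr; have R1 : 1 < R by lia.
have r0 : 0 < r by lia.
have rr : 1 <= r < R by lia.
have cP : size s = #|part k_inj f 1| by rewrite (card_part _ gl) card_lev1.
have [S iS cS] : exists2 S : {set K}, ini 1 S & #|S| = size s.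
  by rewrite cP; apply/ini_exists/subset_leq_card/(part_lev _ gl).
have cQ : size t = #|part k_inj g 1| by rewrite (card_part _ (gluedC gl)) card_lev1.
have [EF|[_ EG]|[]|[p2 q2 s2' t2']] := first_atoms R1 (eq_leq st) iS cS; last first.
- by apply: neq; apply: box_eq_two => //; rewrite sR tR.
- lia.
(* If the atoms of [t] came first, iterating to rank r would make its level at most as large as that
   of [s]. *)
- have := card_up (r' := r) MacK r0 (part_lev k_inj gl 1) iS _; rewrite cS -cP => /(_ (leqnn _)).
  rewrite (up_part _ gl (r := 1) isT rr) (card_part _ gl) (glued_card_up gl (r := 1) isT rr (ini_lev iS)) EG.
  rewrite box_up_lev //; lia.
have ES : S = part k_inj f 1.
  apply/esym/eqP; rewrite eqEcard cS cP leqnn andbT; apply/subsetP=> _ /imsetP[x xl ->].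
  by move: xl; rewrite -EF inE.
have r'R : 1 <= R - r < R by lia.
(* The whole level of [s] of corank r is the iterated shadow of its atoms, hence a segment. *)
have iP : ini (R - r) (part k_inj f (R - r)).
  rewrite -(up_part _ gl (r := 1) isT r'R); apply: (ini_up MacK (proj1 (andP r'R))).
  by rewrite -ES.
have rev_t : #|lev (box t) (R - r)| = #|lev (box t) r|.
  by rewrite -{1}tR card_lev_rev // tR; lia.
have rev_s : #|lev (box s) (R - r)| = #|lev (box s) r|.
  by rewrite -{1}sR card_lev_rev // sR; lia.
have cQr : #|part k_inj g (R - r)| = #|lev (box t) r|.
  by rewrite (card_part _ (gluedC gl)).
have cPr : #|part k_inj f (R - r)| = #|lev (box s) r|.
  by rewrite (card_part _ gl).
have [U iU cU] := ini_exists (subset_leq_card (part_lev k_inj (gluedC gl) (R - r))).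
have sPU : part k_inj f (R - r) \subset U.
  by apply: (ini_sub iP iU); rewrite cU cQr cPr ltnW.
have EF' : f @^-1: U = lev (box s) (R - r).
  apply/eqP; rewrite eqEsubset (glued_levf gl (ini_lev iU)) -(part_pre k_inj gl).
  exact: preimsetS.
have R'R : R - r <= R.-1 < R by lia.
have R'R' : R - r <= R.-1 by lia.
have := card_up MacK R'R' (part_lev k_inj (gluedC gl) (R - r)) iU (eq_leq cU).
have Rr0 : 0 < R - r by lia.
rewrite (up_part _ (gluedC gl) Rr0 R'R).
rewrite (card_part _ (gluedC gl)) coatoms_t ?(ltnW R1) //.
rewrite (glued_card_up gl Rr0 R'R (ini_lev iU)).
rewrite EF' box_up_lev // coatoms_s ?(ltnW R1) //; pose G := g @^-1: U; rewrite -/G => u.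
have cG : #|lev (box s) r| + #|G| = #|lev (box t) r|.
  by rewrite -cQr -cU (glued_card gl _ (ini_lev iU)) ?EF' ?rev_s //; lia.
have G0 : G != set0 by rewrite -card_gt0; lia.
(* All coatoms of [s] are above [U], so a single coatom of [t] is already too many. *)
have := box_up_gt0 (r' := R.-1) (glued_levf (gluedC gl) (ini_lev iU)) G0.
rewrite tR -/G; clear -R'R u st; lia.
Qed.

End Parts.

Lemma diamond_necessary s t (f : box s -> D) (g : box t -> D) R :
    glued f g R -> box_rank s = R -> box_rank t = R ->
    all (leq 2) s -> all (leq 2) t -> sorted geq s -> sorted geq t ->
  [\/ s = t, [/\ size s = 1, size t = 2 & 2 \in t] | [/\ size t = 1, size s = 2 & 2 \in s]].
Proof.
move=> gl sR tR s2 t2 ss ts; have gl' := gluedC gl.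
have s1 : all (leq 1) s by apply: sub_all s2 => d; apply: ltnW.
have t1 : all (leq 1) t by apply: sub_all t2 => d; apply: ltnW.
have [st|ts'|st] := ltngtP (size s) (size t).
- by constructor 2; apply: (diamond_dim_lt gl).
- by constructor 3; apply: (diamond_dim_lt gl').
have [->|/eqP neq] := eqVneq s t; first by constructor 1.
have : [forall r : 'I_R, (0 < r) ==> (#|lev (box s) r| == #|lev (box t) r|)].
  apply/forallP=> r; apply/implyP=> r0; have rR : 0 < r < R by rewrite r0 ltn_ord.
  case: ltngtP => // [lt|gt].
    by case: (diamond_level_lt gl sR tR s2 t2 st neq ss ts rR).
  by case: (diamond_level_lt gl' tR sR t2 s2 (esym st) (nesym neq) ts ss rR).
move/forallP=> eq_mid; case: neq; apply: card_lev_inj => // r.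
have [->|r0] := posnP r; first by rewrite !card_lev0.
have [rR|Rr] := ltnP r R; first by have := eq_mid (Ordinal rR); rewrite /= r0 => /eqP.
have [->|rR] := eqVneq r R.
  by rewrite -{1}sR -tR -(subn0 (box_rank s)) -(subn0 (box_rank t)) !card_lev_rev // !card_lev0.
have empty u : box_rank u = R -> #|lev (box u) r| = 0.
  move=> uR; apply/eqP; rewrite cards_eq0; apply/eqP/setP=> x; rewrite !inE.
  by apply/eqP=> rx; have := box_rk_le x; lia.
by rewrite !empty.
Qed.

End DiamondNecessity.

Lemma Mac_iso (X Y : kgraph) (h : X -> Y) : bijective h -> (forall x, rk (h x) = rk x) ->
    (forall x x', cov (h x) (h x') = cov x x') -> (forall x, key (h x) = key x) ->
  Mac Y -> Mac X.
Proof.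
move=> h_bij h_rk h_cov h_key [M2 M1]; have [g hK gK] := h_bij.
have h_inj := can_inj hK.
have iniE r (S : {set X}) : ini r (h @: S) <-> ini r S.
  split=> /iniP[Sr Su]; apply/iniP; split=> [x xS|x y xS ry kxy].
  - by rewrite -h_rk; apply/Sr/imset_f.
  - by rewrite -(mem_imset _ _ h_inj); apply: (Su (h x)); rewrite ?imset_f ?h_rk ?h_key.
  - by case/imsetP: xS => z zS ->; rewrite h_rk; apply: Sr.
  case/imsetP: xS kxy => z zS ->; rewrite -(gK y) !h_key => kz.
  by rewrite mem_imset //; apply: (Su z) => //; rewrite -h_rk gK.
split=> [r S /iniE/M2|r A S sA /iniE iS cS].
  by rewrite (shadow_imset h_bij h_cov) => /iniE.
rewrite -(card_imset _ h_inj) -(card_imset (shadow A) h_inj) -!(shadow_imset h_bij h_cov).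
by apply: M1 iS _; rewrite ?lev_imset // !card_imset.
Qed.

Fixpoint box_cat s t : box s -> box t -> box (s ++ t) :=
  if s is d :: s' then fun p y => (p.1, box_cat p.2 y) else fun _ y => y.

Section Cat.
Variables s t : seq nat.
Implicit Types (x : box s) (y : box t).

Lemma box_cat_le x x' y y' : le (box_cat x y) (box_cat x' y') = le x x' && le y y'.
Proof. by elim: s x x' => [|d s' IHs] //= [i x] [i' x'] /=; rewrite IHs andbA. Qed.

Lemma box_cat_rk x y : rk (box_cat x y) = rk x + rk y.
Proof. by elim: s x => [|d s' IHs] //= [i x] /=; rewrite IHs addnA. Qed.

Lemma box_cat_key x y : key (box_cat x y) = key x + kbound (box s) * key y.
Proof.
elim: s x => [|d s' IHs] /=; first by case=> /=; rewrite mul1n.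
by case=> i x; rewrite /= /prod_key /= IHs mulnDr addnA mulnA.
Qed.

Lemma box_cat_bij : bijective (fun p : prod_graph (box s) (box t) => box_cat p.1 p.2).
Proof.
suff [h hK hK'] : exists2 h : box (s ++ t) -> box s * box t,
    forall x y, h (box_cat x y) = (x, y) & forall z, box_cat (h z).1 (h z).2 = z.
  by exists h => [[x y]|z] //=.
elim: s => [|d s' [h hK hK']] /=; first by exists (fun y => (tt, y)) => // -[].
exists (fun p => ((p.1, (h p.2).1), (h p.2).2)) => [[i x] y|[i z]] /=.
  by rewrite hK.
by rewrite hK'.
Qed.

Lemma Mac_cat : Mac (box (s ++ t)) -> Mac (prod_graph (box s) (box t)).
Proof.
apply: Mac_iso box_cat_bij _ _ _ => [[x y]|[x y] [x' y']|[x y]] /=.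
- exact: box_cat_rk.
- by rewrite /cov box_cat_le !box_cat_rk.
- exact: box_cat_key.
Qed.

End Cat.

(** * Two copies of one box *)

Section TwoCopies.
Variable s : seq nat.
Hypothesis Mac_s22 : Mac (prod_graph (box s) (box [:: 2; 2])).
Local Notation XQ := (prod_graph (box s) (box [:: 2; 2])).
Implicit Types (A B S U : {set box s}).

Let q11 : box [:: 2; 2] := (ord_max, (ord_max, tt)).
Let q01 : box [:: 2; 2] := (ord0, (ord_max, tt)).
Let q10 : box [:: 2; 2] := (ord_max, (ord0, tt)).

Let q_enum (q : box [:: 2; 2]) : [\/ q = q11, q = q01, q = q10 | rk q = 0].
Proof.
by case: q => [[[|[|//]] i] [[[|[|//]] j] []]];
  [constructor 4|constructor 2|constructor 3|constructor 1];
  rewrite //=; congr (_, (_, _)); apply: val_inj.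
Qed.

(* Placing the two subsets on the incomparable middle elements of the square
   [2 x 2], below a full level at its top, turns unions over two copies of the
   box into subsets of a single larger box. *)
Definition hat r A B : {set XQ} :=
  [set p | [|| (p.2 == q11) && (p.1 \in lev (box s) r), (p.2 == q01) && (p.1 \in A) |
               (p.2 == q10) && (p.1 \in B)]].

Lemma hat_slices r A B : [/\ slice (hat r A B) q11 = lev (box s) r,
  slice (hat r A B) q01 = A, slice (hat r A B) q10 = B &
  forall q, rk q = 0 -> slice (hat r A B) q = set0].
Proof.
split=> [|||q q0]; apply/setP=> x; rewrite !inE //= ?orbF //.
by case: q q0 => [[[|[|//]] i] [[[|[|//]] j] []]].
Qed.

Lemma card_hat r A B : #|hat r A B| = #|lev (box s) r| + #|A| + #|B|.
Proof.
have [E11 E01 E10 E00] := hat_slices r A B.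
rewrite card_slices (bigD1 q11) //= (bigD1 q01) //= (bigD1 q10) //= E11 E01 E10.
rewrite big1 ?addn0 ?addnA // => q; rewrite -!andbA => /and3P[/eqP n1 /eqP n2 /eqP n3].
by case: (q_enum q) => // /E00->; rewrite cards0.
Qed.

Lemma hat_lev r A B : A \subset lev (box s) r.+1 -> B \subset lev (box s) r.+1 ->
  hat r A B \subset lev XQ r.+2.
Proof.
move=> sA sB; apply/subsetP=> -[x q]; rewrite !inE /=.
by case/or3P=> /andP[/eqP->] => [/eqP->|/(subsetP sA)|/(subsetP sB)];
  rewrite ?inE /= ?addn2 ?addn1 // => /eqP->; rewrite ?addn1 ?addn0.
Qed.

(** The shadow spills A and B into the top slice, where they are absorbed: the shadow of the full
    level of rank r is the full level of rank r + 1. *)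
Lemma shadow_hat r A B : A \subset lev (box s) r.+1 -> B \subset lev (box s) r.+1 ->
  shadow (hat r A B) = hat r.+1 (shadow A) (shadow B).
Proof.
move=> sA sB; have [E11 E01 E10 E00] := hat_slices r A B.
have [F11 F01 F10 F00] := hat_slices r.+1 (shadow A) (shadow B).
suff sl q : slice (shadow (hat r A B)) q = slice (hat r.+1 (shadow A) (shadow B)) q.
  by apply/setP=> -[x q]; move/setP/(_ x): (sl q); rewrite ![x \in slice _ _]inE.
apply/setP=> x; case: (q_enum q) => [->|->|->|q0].
- rewrite F11; apply/slice_shadowP/idP.
    case=> [|[q' cq]]; first by rewrite E11 => /(subsetP (shadow_lev (subxx _))).
    case: (q_enum q') cq => [->|->|->|q0'] // cq.
    + by rewrite E01 => /(subsetP sA).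
    + by rewrite E10 => /(subsetP sB).
    + by rewrite (E00 _ q0') inE.
  move=> xl; left; rewrite E11; apply/shadowP.
  have rx : rk x = r.+1 by move: xl; rewrite inE => /eqP.
  have [|x' rx' lx'] := @box_below s x r; first by rewrite rx.
  by exists x'; rewrite ?inE ?rx' // /cov lx' rx rx' eqxx.
- rewrite F01; apply/slice_shadowP/idP => [[|[q' cq]]|xA]; rewrite ?E01 //; last by left.
  by case: (q_enum q') cq => [->|->|->|q0'] // cq; rewrite (E00 _ q0') inE.
- rewrite F10; apply/slice_shadowP/idP => [[|[q' cq]]|xA]; rewrite ?E10 //; last by left.
  by case: (q_enum q') cq => [->|->|->|q0'] // cq; rewrite (E00 _ q0') inE.
rewrite F00 // [RHS]inE; apply/slice_shadowP=> -[|[q' /cov_rk]]; last by rewrite q0.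
by rewrite E00 // shadow0 inE.
Qed.

(** Keys of the square decrease from [q11] through [q01] and [q10] to the bottom, so a segment must
    fill the slice at [q01] before entering that at [q10]. *)
Lemma ini_hat r S U : ini r.+1 S -> ini r.+1 U -> S = lev (box s) r.+1 \/ U = set0 ->
  ini r.+2 (hat r S U).
Proof.
move=> iS iU SU; have sS := ini_lev iS; have sU := ini_lev iU.
have [_ Su] := iniP _ _ iS; have [_ Uu] := iniP _ _ iU.
apply/iniP; split=> [p /(subsetP (hat_lev sS sU))|[x q] [x' q'] xS rx' kx].
  by rewrite inE => /eqP.
have [E11 E01 E10 E00] := hat_slices r S U.
have {xS} xS : x \in slice (hat r S U) q by rewrite inE.
suff: x' \in slice (hat r S U) q' by rewrite inE.
have q0 : rk q <> 0 by move=> q0; rewrite E00 ?inE // in xS.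
move: rx' kx; rewrite prod_key_le /=.
case: (q_enum q') => [->|->|->|q0'] rx'.
- by rewrite E11 inE => _; apply/eqP; move: rx' => /=; lia.
- rewrite E01; have {}rx' : rk x' = r.+1 by move: rx' => /=; lia.
  case: (q_enum q) xS => [->|->|->|//] xS; rewrite /= /prod_key //=.
    by rewrite E01 in xS => kx; apply: Su xS rx' kx.
  case: SU => [->|U0]; first by rewrite inE rx'.
  by rewrite E10 U0 inE in xS.
- rewrite E10; have {}rx' : rk x' = r.+1 by move: rx' => /=; lia.
  case: (q_enum q) xS => [->|->|->|//] xS; rewrite /= /prod_key //=.
  by rewrite E10 in xS => kx; apply: Uu xS rx' kx.
case: (q_enum q) q0 => [->|->|->|//] _; move: q0'; clear;
  by case: q' => [[[|[|//]] i] [[[|[|//]] j] []]].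
Qed.

Lemma two_copies_shadow_min r A S B U : 0 < r ->
  A \subset lev (box s) r -> B \subset lev (box s) r -> ini r S -> ini r U ->
  S = lev (box s) r \/ U = set0 -> #|S| + #|U| = #|A| + #|B| ->
  #|shadow S| + #|shadow U| <= #|shadow A| + #|shadow B|.
Proof.
(* The full level at the top of the square has rank one less than A and B, whence [0 < r]. Its
   contributions cancel in both counts. *)
case: r => // r _ sA sB iS iU SU cSU; have [_ M1] := Mac_s22.
have := M1 _ _ _ (hat_lev sA sB) (ini_hat iS iU SU).
rewrite !card_hat -!addnA cSU => /(_ erefl).
rewrite !shadow_hat ?(ini_lev iS) ?(ini_lev iU) // !card_hat -!addnA.
by rewrite leq_add2l.
Qed.

End TwoCopies.

Lemma box_bot_uniq s (x x' : box s) : rk x = 0 -> rk x' = 0 -> x = x'.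
Proof. by move=> x0 x0'; have [//|] := le_rk (box_le0 x' x0); rewrite x0'. Qed.

Lemma box_top_uniq s (x x' : box s) : rk x = box_rank s -> rk x' = box_rank s -> x = x'.
Proof. by move=> x1 x1'; have [//|] := le_rk (box_le1 x x1'); rewrite x1 x1' ltnn. Qed.

(** Since all sides are at least 2, appending two sides of length 2 keeps the list decreasing. *)
Lemma Mac_two_copies s : sorted geq s -> all (leq 2) s ->
  Mac (prod_graph (box s) (box [:: 2; 2])).
Proof.
move=> ss s2; apply/Mac_cat/clements_lindstrom_Mac.
have geq_tr : transitive geq by move=> b a c /= ba cb; apply: leq_trans cb ba.
rewrite sorted_pairwise // pairwise_cat -sorted_pairwise // ss /= andbT.
by apply/allrelP=> a b /(allP s2) a2; rewrite !inE orbb => /eqP->.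
Qed.

Section DiamondSufficiency.
Variables (disp : Order.disp_t) (D : rankedType disp) (s t : seq nat).
Variables (f : box s -> D) (g : box t -> D) (R : nat).
Hypotheses (gl : glued f g R) (sR : box_rank s = R) (tR : box_rank t = R).
Hypotheses (s1 : all (leq 1) s) (t1 : all (leq 1) t).
Hypothesis bot_eq : forall x y, rk x = 0 -> rk y = 0 -> f x = g y.
Hypothesis top_eq : forall x y, rk x = R -> rk y = R -> f x = g y.

Lemma diamond_macaulay :
  (forall r (A S : {set box s}) (B U : {set box t}), 0 < r -> r.+1 < R ->
     A \subset lev _ r -> B \subset lev _ r -> ini r S -> ini r U ->
     S = lev _ r \/ U = set0 -> #|S| + #|U| = #|A| + #|B| ->
     #|shadow S| + #|shadow U| <= #|shadow A| + #|shadow B|) ->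
  macaulay D.
Proof.
have rkf := glued_rkf gl; have rkg := glued_rkg gl.
have topf (x : box s) : R <= rk x -> rk x = R by move=> Rx; have := box_rk_le x; rewrite sR; lia.
have topg (y : box t) : R <= rk y -> rk y = R by move=> Ry; have := box_rk_le y; rewrite tR; lia.
apply: (glued_macaulay gl).
- move=> z z'; case: (glued_surj gl z) => -[x ->]; case: (glued_surj gl z') => -[x' ->];
    rewrite ?rkf ?rkg => r0 r0'.
  + by rewrite (box_bot_uniq r0 r0').
  + exact: bot_eq.
  + exact/esym/bot_eq.
  + by rewrite (box_bot_uniq r0 r0').
- move=> z z'; case: (glued_surj gl z) => -[x ->]; case: (glued_surj gl z') => -[x' ->];
    rewrite ?rkf ?rkg.
  + by move=> /topf rx rx'; congr f; apply: box_top_uniq; rewrite ?sR -?rx'.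
  + by move=> /topf rx rx'; apply: top_eq; rewrite -?rx'.
  + by move=> /topg rx rx'; apply/esym/top_eq; rewrite -?rx'.
  + by move=> /topg rx rx'; congr g; apply: box_top_uniq; rewrite ?tR -?rx'.
- have [x1 rx1] : exists x : box s, rk x = R.
    by have [x rx] := box_bot s1; exists (box_rev x); rewrite -sR -(box_rk_rev x) rx.
  have [y1 ry1] : exists y : box t, rk y = R.
    by have [y ry] := box_bot t1; exists (box_rev y); rewrite -tR -(box_rk_rev y) ry.
  move=> z z'; case: (glued_surj gl z) => -[x ->]; case: (glued_surj gl z') => -[x' ->];
    rewrite ?rkf ?rkg.
  + by move=> /topf rx' _; rewrite (glued_lef gl) box_le1 ?sR.
  + by move=> /topg rx' _; rewrite -(top_eq rx1 rx') (glued_lef gl) box_le1 ?sR.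
  + by move=> /topf rx' _; rewrite (top_eq rx' ry1) (glued_leg gl) box_le1 ?tR.
  + by move=> /topg rx' _; rewrite (glued_leg gl) box_le1 ?tR.
- exact: ini_shadow_box.
- exact: ini_shadow_box.
Qed.

End DiamondSufficiency.

(** * A path and a rectangle with a side of length two *)

Lemma chain_shadow_le a (S : {set box [:: a]}) : #|shadow S| <= #|S|.
Proof.
apply: (leq_card_rel (F := fun y x => val y.1 = (val x.1).+1)) => [[j []] |].
  case/(@shadowP (box [:: a]))=> -[i []] xS.
  by rewrite prod_covE chain_covE /= andbF orbF andbT => /eqP E; exists (i, tt).
by move=> [i []] [j []] [l []] _ _ /= Ei Ej; congr (_, _); apply: val_inj; rewrite /= Ei Ej.
Qed.

Lemma chain_shadow_ge a r (A : {set box [:: a]}) : A \subset lev _ r -> r.+1 < a ->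
  #|A| <= #|shadow A|.
Proof.
move=> sA ra.
apply: (leq_card_rel (F := fun x y => val y.1 = (val x.1).+1)) => [[i []] xA|].
  have ia : i.+1 < a by have := subsetP sA _ xA; rewrite inE /= => /eqP; lia.
  exists (Ordinal ia, tt) => //; apply/(@shadowP (box [:: a])); exists (i, tt) => //.
  by rewrite prod_covE chain_covE /= !eqxx.
by move=> [i []] [j []] [l []] _ _ /= -> [E]; congr (_, _); apply: val_inj.
Qed.

(** Here r + 1 is at least the short side 2 and less than the long side b, so neither correction for
    rectangles occurs: in both posets shadows never shrink, and shadows of segments never grow. *)
Lemma path_rect_shadow_min b r (A S : {set box [:: b.+1]}) (B U : {set box [:: b; 2]}) :
    0 < r -> r.+1 < b -> A \subset lev _ r -> B \subset lev _ r -> ini r S -> ini r U ->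
    #|S| + #|U| = #|A| + #|B| ->
  #|shadow S| + #|shadow U| <= #|shadow A| + #|shadow B|.
Proof.
move=> r0 rb sA sB iS iU E.
have leS := chain_shadow_le S; have geA := chain_shadow_ge sA (ltnW rb : r.+1 < b.+1).
have r2 : (r.+1 < 2) = false by lia.
have br : (b <= r.+1) = false by lia.
have leU : #|shadow U| <= #|U|.
  have [->|U0] := eqVneq U set0; first by rewrite shadow0 cards0.
  by have := rect_upper iU U0; rewrite r2 br !addn0.
have geB : #|B| <= #|shadow B|.
  have [->|B0] := eqVneq B set0; first by rewrite cards0.
  by have := rect_lower _ sB B0; rewrite r2 br !addn0; apply; lia.
by apply: (leq_trans (leq_add leS leU)); rewrite E leq_add.
Qed.

(* Up to a correction in {-1, 0, 1} depending only on the level, on emptiness and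
   on fullness, shadows in rectangles have the same size as the set. *)
Lemma wedge_excess m n m' n' r p q a b s u a' b' s' u' :
    m <= m' -> n <= n' -> m <= n -> m' <= n' ->
    (r.+1 < m -> q <= p) -> (n' <= r.+1 -> p <= q) ->
    a <= p -> b <= q -> s <= p -> u <= q -> s = p \/ u = 0 -> s + u = a + b ->
    (0 < a -> a + (r.+1 < m) <= a' + ((n <= r.+1) && (a == p))) ->
    (0 < b -> b + (r.+1 < m') <= b' + ((n' <= r.+1) && (b == q))) ->
    (s = 0 -> s' = 0) -> (u = 0 -> u' = 0) ->
    (0 < s -> s' + ((n <= r.+1) && (s == p)) <= s + (r.+1 < m)) ->
    (0 < u -> u' + ((n' <= r.+1) && (u == q)) <= u + (r.+1 < m')) ->
  s' + u' <= a' + b'.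
Proof.
move=> mm nn mn mn' pq qp ap bq sp uq su sum.
case: (ltnP r.+1 m) pq => r1; case: (ltnP r.+1 m') => r2; case: (leqP n r.+1) => r3;
  case: (leqP n' r.+1) qp => r4; try (exfalso; lia);
  rewrite /= => qp pq; clear r1 r2 r3 r4 mm nn mn mn';
  case: (a =P p) => ea; case: (b =P q) => eb; case: (s =P p) => es; case: (u =P q) => eu /=; lia.
Qed.

(** * Wedges of rectangles *)

Section Rectangles.
Variables m n m' n' : nat.

Lemma rect_lev_low r : r.+1 < m -> m <= n -> #|lev (box [:: n'; m']) r| <= #|lev (box [:: n; m]) r|.
Proof.
move=> rm mn.
apply: (leq_card_rel (F := fun x y => rect1 x = rect1 y /\ rect2 x = rect2 y)) => [x|x x' y].
  rewrite inE rect_rk => /eqP rx; have [||y [y1 y2]] := @rectP n m (rect1 x) (rect2 x).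
  - lia.
  - lia.
  by exists y; rewrite ?inE ?rect_rk ?y1 ?y2 ?rx.
by move=> _ _ [E1 E2] [E1' E2']; apply: rect_inj; rewrite ?E1 ?E2.
Qed.

(** Moving m' - m units from the first to the second coordinate keeps the rank; the first coordinate
    has enough of them because it is at least n' - m. *)
Lemma rect_lev_high r : n' <= r.+1 -> m <= m' -> n <= n' -> m' <= n' ->
  #|lev (box [:: n; m]) r| <= #|lev (box [:: n'; m']) r|.
Proof.
move=> rn mm nn mn'.
apply: (leq_card_rel (F := fun x y => rect2 y = rect2 x + (m' - m))) => [x|x x' y].
  rewrite inE rect_rk => /eqP rx; have x1 := rect1_lt x; have x2 := rect2_lt x.
  have [||y [y1 y2]] := @rectP n' m' (rect1 x - (m' - m)) (rect2 x + (m' - m)).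
  - lia.
  - lia.
  by exists y; rewrite // inE rect_rk y1 y2; apply/eqP; lia.
rewrite !inE !rect_rk => /eqP rx /eqP rx' E E'; apply: rect_inj; lia.
Qed.

End Rectangles.

Section Wedge.
Variables (disp : Order.disp_t) (D : rankedType disp) (m n m' n' : nat).
Local Notation P := (box [:: n; m]).
Local Notation Q := (box [:: n'; m']).
Variables (f : P -> D) (g : Q -> D) (R : nat).
Hypotheses (gl : glued f g R) (rank_lt : forall z : D, (rank z).+1 < R).
Hypothesis bot_eq : forall x y, rk x = 0 -> rk y = 0 -> f x = g y.
Hypotheses (m1 : 1 < m) (mn : m <= n) (m1' : 1 < m') (mn' : m' <= n').

(** The least excess |shadow A| - |A| over nonempty A is never larger in the smaller rectangle,
    which therefore precedes the other in every level. *)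
Lemma wedge_sufficient : m <= m' -> n <= n' -> macaulay D.
Proof.
move=> mm nn; apply: (glued_macaulay gl); try exact: ini_shadow_box.
- move=> z z'; case: (glued_surj gl z) => -[x ->]; case: (glued_surj gl z') => -[x' ->];
    rewrite ?(glued_rkf gl) ?(glued_rkg gl) => r0 r0'.
  + by rewrite (box_bot_uniq r0 r0').
  + exact: bot_eq.
  + exact/esym/bot_eq.
  + by rewrite (box_bot_uniq r0 r0').
- by move=> z z' Rz; have := rank_lt z; lia.
- by move=> z z' Rz; have := rank_lt z'; lia.
move=> r A S B U r0 rR sA sB iS iU SU cSU.
have eqE (X : kgraph) (C : {set X}) : C \subset lev X r -> (C == lev X r) = (#|C| == #|lev X r|).
  by move=> sC; rewrite eqEcard sC [RHS]eqn_leq (subset_leq_card sC).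
apply: (@wedge_excess m n m' n' r #|lev P r| #|lev Q r| #|A| #|B| #|S| #|U|) => //;
  try (by apply: subset_leq_card; rewrite ?(ini_lev iS) ?(ini_lev iU)).
- by move=> rm; apply: rect_lev_low.
- by move=> rn; apply: rect_lev_high.
- by case: SU => ->; [left|right; rewrite cards0].
- by rewrite card_gt0 -eqE // => A0; apply: rect_lower.
- by rewrite card_gt0 -eqE // => B0; apply: rect_lower.
- by move/cards0_eq->; rewrite shadow0 cards0.
- by move/cards0_eq->; rewrite shadow0 cards0.
- by rewrite card_gt0 -eqE ?(ini_lev iS) // => S0; apply: rect_upper.
- by rewrite card_gt0 -eqE ?(ini_lev iU) // => U0; apply: rect_upper.
Qed.

Section Necessity.
Variables (k : D -> nat) (k_inj : injective k).
Local Notation K := (keyed_poset k_inj).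
Hypothesis MacK : Mac K.

Lemma card_shadow_glued r (C : {set K}) : 0 < r < R -> r.+1 < R -> C \subset lev K r ->
  #|shadow C| = #|shadow (f @^-1: C)| + #|shadow (g @^-1: C)|.
Proof.
move=> /andP[r0 rR] rR1 sC; rewrite (glued_card gl _ (shadow_lev sC)) ?rR1 //.
by rewrite (glued_shadowf gl r0 rR1 sC) (glued_shadowf (gluedC gl) r0 rR1 sC).
Qed.

Lemma rect_shadow_ge d e r (A : {set box [:: d; e]}) : e <= d -> A \subset lev _ r ->
  r.+1 < d \/ A != lev _ r -> #|A| + ((r.+1 < e) && (A != set0)) <= #|shadow A|.
Proof.
move=> ed sA full; have [->|A0] := eqVneq A set0; first by rewrite andbF cards0.
have := rect_lower ed sA A0; rewrite andbT; case: (leqP d r.+1) => /= dr; last by rewrite addn0.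
by case: full => [|/negbTE->]; [lia | rewrite addn0].
Qed.

(** Rank m' - 2 is the last with positive excess in [Q], while [P] has excess 0 there, so [P] comes
    first from then on. Rank n' - 1 is the first at which the full level of [Q] has excess -1. The
    segment of that size contains elements of [P], where n' < n still excludes negative excess, and
    so does worse. *)
Lemma wedge_not_crossing : m < m' -> n' < n -> False.
Proof.
move=> mm nn.
have rR r : r.+1 < n' + m' -> 0 < r -> 0 < r < R /\ r.+1 < R.
  move=> rnm r0; have [|x xr] := @card_gt0P _ (mem (lev Q r)) _.
    apply: box_lev_gt0; rewrite /box_rank /=; lia.
  move: xr; rewrite inE => /eqP rx.
  by have := rank_lt (g x); rewrite (glued_rkg gl) rx; lia.
pose r0 := m'.-2; pose r1 := n'.-1.
have [R0 R0'] : 0 < r0 < R /\ r0.+1 < R by apply: rR; rewrite /r0; lia.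
have [R1 R1'] : 0 < r1 < R /\ r1.+1 < R by apply: rR; rewrite /r1; lia.
have cP : forall r, #|part k_inj f r| = #|lev P r| := card_part _ gl.
have cQ : forall r, #|part k_inj g r| = #|lev Q r| := card_part _ (gluedC gl).
have P_gt0 r : r.+1 < n + m -> 0 < #|lev P r|.
  by move=> rnm; apply: box_lev_gt0; rewrite /box_rank /=; lia.
have Q_gt0 r : r.+1 < n' + m' -> 0 < #|lev Q r|.
  by move=> rnm; apply: box_lev_gt0; rewrite /box_rank /=; lia.
have iP0 : ini r0 (part k_inj f r0).
  have [S iS cS] := ini_exists (subset_leq_card (part_lev k_inj gl r0)).
  suff G0 : g @^-1: S = set0.
    suff <- : S = part k_inj f r0 by [].
    apply/eqP; rewrite eqEcard cS leqnn andbT; apply/subsetP=> z.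
    case: (glued_surj gl z) => [[x ->]|[y ->]] zS; last first.
      by have := in_set0 y; rewrite -G0 inE zS.
    rewrite imset_f // inE; have := subsetP (ini_lev iS) _ zS.
    by rewrite inE /= (glued_rkf gl).
  have := MacK.2 r0 _ _ (part_lev k_inj gl r0) iS cS.
  rewrite !(card_shadow_glued R0 R0') ?(ini_lev iS) ?(part_lev _ gl) //.
  rewrite (part_pre _ gl) (part_pre0 _ gl) // shadow0 cards0 addn0.
  have := cS; rewrite (glued_card gl R0 (ini_lev iS)) cP.
  have lP : 0 < #|lev P r0| by apply: P_gt0; rewrite /r0; lia.
  have := rect_upper (ini_full P r0) _; rewrite -card_gt0 => /(_ lP).
  have := rect_shadow_ge mn (glued_levf gl (ini_lev iS)) _.
  have := rect_shadow_ge mn' (glued_levf (gluedC gl) (ini_lev iS)) _.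
  have -> : (r0.+1 < m) = false by rewrite /r0; lia.
  have -> : r0.+1 < m' by rewrite /r0; lia.
  have -> : r0.+1 < n' by rewrite /r0; lia.
  have -> : r0.+1 < n by rewrite /r0; lia.
  move=> /(_ (or_introl isT)) bG /(_ (or_introl isT)) bF bS cFG u.
  apply/eqP/negPn/negP=> G0; move: bG bF bS cFG u; rewrite G0 /=; lia.
have iP1 : ini r1 (part k_inj f r1).
  have r01 : r0 <= r1 < R by rewrite /r0 /r1 in R1 *; lia.
  rewrite -(up_part k_inj gl (r := r0)) //; last by case/andP: R0.
  exact: (ini_up MacK (proj1 (andP r01)) iP0).
have [T iT cT] := ini_exists (subset_leq_card (part_lev k_inj (gluedC gl) r1)).
have := MacK.2 r1 _ _ (part_lev k_inj (gluedC gl) r1) iT cT.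
rewrite !(card_shadow_glued R1 R1') ?(ini_lev iT) ?(part_lev _ (gluedC gl)) //.
rewrite (part_pre _ (gluedC gl)) (part_pre0 _ (gluedC gl)) // shadow0 cards0 add0n.
have lP : 0 < #|lev P r1| by apply: P_gt0; rewrite /r1; lia.
have lQ : 0 < #|lev Q r1| by apply: Q_gt0; rewrite /r1; lia.
have := rect_upper (ini_full Q r1) _; rewrite -card_gt0 => /(_ lQ).
have := cT; rewrite (glued_card gl R1 (ini_lev iT)) cQ => cFG.
have Gfull : g @^-1: T != lev Q r1.
  apply/eqP=> E; move: cFG; rewrite E => cFG.
  have F0 : f @^-1: T = set0 by apply/eqP; rewrite -cards_eq0; lia.
  have [sub|sub] := ini_sub_total iP1 iT.
    have := preimsetS f sub; rewrite (part_pre _ gl) F0 => /subset_leq_card.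
    by rewrite cards0; lia.
  have := preimsetS g sub; rewrite (part_pre0 _ gl) // E => /subset_leq_card.
  by rewrite cards0; lia.
have := rect_shadow_ge mn (glued_levf gl (ini_lev iT)) (or_introl _).
have := rect_shadow_ge mn' (glued_levf (gluedC gl) (ini_lev iT)) (or_intror Gfull).
have -> : r1.+1 < n by rewrite /r1; lia.
have -> : (r1.+1 < m') = false by rewrite /r1; lia.
have -> : n' <= r1.+1 by rewrite /r1; lia.
rewrite eqxx andFb => bG /(_ isT) bF bQ u; move: bG bF bQ u cFG; clear; lia.
Qed.

End Necessity.
End Wedge.

(** * Diamonds and wedges as glued posets *)

Section GlueInstances.
Import Order.TTheory.

Lemma rank_eq0 disp (P : rankedBType disp) (p : P) : rank p = 0 -> p = \bot%O.
Proof.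
move=> p0; have := le0x p; rewrite le_eqVlt => /orP[/eqP->//|/rank_strict].
by rewrite p0 ltn0.
Qed.

Lemma rank_eq_top disp (P : rankedTBType disp) (p : P) : rank p = poset_rank P -> p = \top%O.
Proof.
move=> p1; have := lex1 p; rewrite le_eqVlt => /orP[/eqP->//|/rank_strict].
by rewrite p1 rank_top ltnn.
Qed.

Section Diamond.
Variables (dP dQ : Order.disp_t) (P : rankedTBType dP) (Q : rankedTBType dQ).
Variable eq_rk : poset_rank P = poset_rank Q.
Local Notation l := (@diamond_l _ _ P Q eq_rk).
Local Notation r := (@diamond_r _ _ P Q eq_rk).

(** A relation inherited from [Q] can join only identified extremes, and a top below a bottom makes
    both posets trivial. *)
Lemma diamond_l_le (p p' : P) : (l p <= l p')%O = (p <= p')%O.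
Proof.
rewrite diamond_leE; apply/glue_leP/idP => [[]|pp'].
- by case=> a [b [/diamond_l_inj-> /diamond_l_inj-> ]].
- case=> a [b [/diamond_meet[][-> ->] /diamond_meet[][-> ->]]]; rewrite ?le0x ?lex1 //.
  by rewrite lex0 => /eqP E; rewrite (_ : \top%O = \bot%O) //; apply/eqP;
     rewrite eq_sym (diamond_trivial eq_rk) E.
by left; exists p, p'.
Qed.

Lemma diamond_r_le (q q' : Q) : (r q <= r q')%O = (q <= q')%O.
Proof.
rewrite diamond_leE; apply/glue_leP/idP => [[]|qq'].
- case=> a [b [/esym/diamond_meet[][-> ->] /esym/diamond_meet[][-> ->]]];
    rewrite ?le0x ?lex1 //.
  move=> le_tb; rewrite (_ : \top%O = \bot%O :> Q) //; apply/eqP.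
  by rewrite eq_sym -(diamond_trivial eq_rk) eq_sym -lex0.
- by case=> a [b [/diamond_r_inj-> /diamond_r_inj-> ]].
by right; exists q, q'.
Qed.

Lemma diamond_cross (p : P) (q : Q) : (l p <= r q)%O -> p = \bot%O \/ q = \top%O.
Proof.
rewrite diamond_leE => /glue_leP[] [a [b [Ea Eb ab]]].
  case: (diamond_meet (esym Eb)) => -[Eb' ->]; last by right.
  by left; apply/eqP; rewrite -lex0 (diamond_l_inj Ea) -Eb'.
case: (diamond_meet Ea) => -[-> Ea']; first by left.
by right; apply/eqP; rewrite -le1x (diamond_r_inj Eb) -Ea'.
Qed.

Lemma diamond_cross' (p : P) (q : Q) : (r q <= l p)%O -> q = \bot%O \/ p = \top%O.
Proof.
rewrite diamond_leE => /glue_leP[] [a [b [Ea Eb ab]]].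
  case: (diamond_meet (esym Ea)) => -[Ea' ->]; first by left.
  by right; apply/eqP; rewrite -le1x (diamond_l_inj Eb) -Ea'.
case: (diamond_meet Eb) => -[-> Eb']; last by right.
by left; apply/eqP; rewrite -lex0 (diamond_r_inj Ea) -Eb'.
Qed.

Lemma glued_diamond (X Y : kgraph) (f : X -> P) (g : Y -> Q) :
    bijective f -> {mono f : x y / le x y >-> (x <= y)%O} -> (forall x, rank (f x) = rk x) ->
    bijective g -> {mono g : x y / le x y >-> (x <= y)%O} -> (forall y, rank (g y) = rk y) ->
  glued (fun x => l (f x)) (fun y => r (g y)) (poset_rank P).
Proof.
move=> [f' fK fK'] lef rkf [g' gK gK'] leg rkg; split=> [x x'|y y'|x|y|z|x y x0 yR|x y y0 xR].
- by rewrite diamond_l_le lef.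
- by rewrite diamond_r_le leg.
- exact: rkf.
- by rewrite diamond_rankE diamond_rank_r.
- case: (diamond_surj z) => [[p ->]|[q ->]].
    by left; exists (f' p); rewrite fK'.
  by right; exists (g' q); rewrite gK'.
- apply/negP=> /diamond_cross[E|E].
    by have := rkf x; rewrite E rank_bot => x0'; rewrite -x0' in x0.
  by have := rkg y; rewrite E rank_top => yR'; rewrite -yR' -eq_rk ltnn in yR.
apply/negP=> /diamond_cross'[E|E].
  by have := rkg y; rewrite E rank_bot => y0'; rewrite -y0' in y0.
by have := rkf x; rewrite E rank_top => xR'; rewrite -xR' ltnn in xR.
Qed.

End Diamond.

Section Wedge.
Variables (dP dQ : Order.disp_t) (P : rankedBType dP) (Q : rankedBType dQ).
Local Notation l := (@wedge_l _ _ P Q).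
Local Notation r := (@wedge_r _ _ P Q).

Lemma wedge_l_le (p p' : P) : (l p <= l p')%O = (p <= p')%O.
Proof.
rewrite wedge_leE; apply/glue_leP/idP => [[]|pp'].
- by case=> a [b [/wedge_l_inj-> /wedge_l_inj-> ]].
- by case=> a [b [/wedge_meet[-> _] _ _]]; apply: le0x.
by left; exists p, p'.
Qed.

Lemma wedge_r_le (q q' : Q) : (r q <= r q')%O = (q <= q')%O.
Proof.
rewrite wedge_leE; apply/glue_leP/idP => [[]|qq'].
- by case=> a [b [/esym/wedge_meet[_ ->] _ _]]; apply: le0x.
- by case=> a [b [/wedge_r_inj-> /wedge_r_inj-> ]].
by right; exists q, q'.
Qed.

Lemma wedge_cross (p : P) (q : Q) : (l p <= r q)%O -> p = \bot%O.
Proof.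
rewrite wedge_leE => /glue_leP[] [a [b [Ea Eb ab]]]; last by case: (wedge_meet Ea).
case: (wedge_meet (esym Eb)) => Eb' _.
by apply/eqP; rewrite -lex0 (wedge_l_inj Ea) -Eb'.
Qed.

Lemma wedge_cross' (p : P) (q : Q) : (r q <= l p)%O -> q = \bot%O.
Proof.
rewrite wedge_leE => /glue_leP[] [a [b [Ea Eb ab]]].
  by case: (wedge_meet (esym Ea)).
case: (wedge_meet Eb) => _ Eb'.
by apply/eqP; rewrite -lex0 (wedge_r_inj Ea) -Eb'.
Qed.

Lemma glued_wedge (X Y : kgraph) (f : X -> P) (g : Y -> Q) R :
    bijective f -> {mono f : x y / le x y >-> (x <= y)%O} -> (forall x, rank (f x) = rk x) ->
    bijective g -> {mono g : x y / le x y >-> (x <= y)%O} -> (forall y, rank (g y) = rk y) ->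
  glued (fun x => l (f x)) (fun y => r (g y)) R.
Proof.
move=> [f' fK fK'] lef rkf [g' gK gK'] leg rkg; split=> [x x'|y y'|x|y|z|x y x0 _|x y y0 _].
- by rewrite wedge_l_le lef.
- by rewrite wedge_r_le leg.
- exact: rkf.
- by rewrite wedge_rankE wedge_rank_r.
- case: (wedge_surj z) => [[p ->]|[q ->]].
    by left; exists (f' p); rewrite fK'.
  by right; exists (g' q); rewrite gK'.
- apply/negP=> /wedge_cross E.
  by have := rkf x; rewrite E rank_bot => x0'; rewrite -x0' in x0.
apply/negP=> /wedge_cross' E.
by have := rkg y; rewrite E rank_bot => y0'; rewrite -y0' in y0.
Qed.

End Wedge.

(** Induction along covers, which are preserved: the order determines the rank. *)
Lemma iso_rank (dP dQ : Order.disp_t) (P : rankedType dP) (Q : rankedType dQ) (h : P -> Q) p :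
  bijective h -> {mono h : x y / (x <= y)%O} -> rank (h p) = rank p.
Proof.
move=> [h' hK hK'] h_le; have h_inj := can_inj hK.
have h_lt : {mono h : x y / (x < y)%O}.
  by move=> x y; rewrite !lt_neqAle h_le (inj_eq h_inj).
have [n] := ubnP (rank p); elim: n p => // n IHn p; rewrite ltnS => pn.
have [p0|/covers_pred[p' /[dup] c /rank_covers rp]] := posnP (rank p).
  have [q0|/covers_pred[q /andP[]]] := posnP (rank (h p)); first by rewrite q0 p0.
  by rewrite -(hK' q) h_lt => /rank_strict; rewrite p0.
have ch : covers (h p') (h p).
  case/andP: c => lt_pp /forallP np; rewrite /covers h_lt lt_pp; apply/forallP=> q.
  by rewrite -(hK' q) !h_lt.
by rewrite (rank_covers _ _ ch) IHn ?rp //; move: pn; rewrite rp.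
Qed.

End GlueInstances.

Section Presented.
Variables (disp : Order.disp_t) (P : rankedTBType disp) (s : seq nat) (f : box s -> P).
Hypotheses (f_bij : bijective f) (f_rk : forall x, rank (f x) = rk x).

Lemma presented_card r : #|level P r| = #|lev (box s) r|.
Proof.
rewrite -(card_imset (lev (box s) r) (bij_inj f_bij)); apply: eq_card => p.
have [f' fK fK'] := f_bij; rewrite -(fK' p) mem_imset; last exact: bij_inj.
by rewrite !inE f_rk.
Qed.

Lemma presented_rank : all (leq 1) s -> poset_rank P = box_rank s.
Proof.
move=> s1; have [x0 rx0] := box_bot s1; apply/eqP; rewrite eqn_leq; apply/andP; split.
  have [f' fK fK'] := f_bij.
  by rewrite -rank_top -(fK' \top%O) f_rk box_rk_le.
rewrite -(box_rk_rev x0) rx0 -f_rk; exact: (leq_bigmax (f (box_rev x0))).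
Qed.

End Presented.

(** A side 2 comes last in the decreasing pair, and then equal ranks read a - 1 = (b - 1) + 1. *)
Lemma path_rect_sides s t : sorted geq t -> all (leq 2) s -> all (leq 2) t ->
    size s = 1 -> size t = 2 -> 2 \in t -> box_rank s = box_rank t ->
  exists b, s = [:: b.+1] /\ t = [:: b; 2].
Proof.
case: s => [|a []] //; case: t => [|b [|c []]] //.
rewrite /box_rank /geq /= !andbT addn0 !inE => cb a2 /andP[b2 c2] _ _ bc2 E.
by exists b; split; congr [:: _ ; _] || congr [:: _]; lia.
Qed.

Lemma grid_box m n (m_gt1 : 1 < m) (le_mn : m <= n) :
  exists f : box [:: n; m] -> grid m_gt1 le_mn,
    [/\ bijective f, {mono f : x y / le x y >-> (x <= y)%O} & forall x, rank (f x) = rk x].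
Proof.
have [s [ss s2 sd [f fP]]] := cl_box (grid_gt0 m_gt1 le_mn).
suff E : s = [:: n; m] by move: f fP; rewrite E => f fP; exists f.
have n1 : 1 < n := leq_trans m_gt1 le_mn.
apply: (sorted_eq (leT := geq)) => //=.
- by move=> b a c /= ba cb; apply: leq_trans cb ba.
- by move=> a b /= /andP[ba ab]; apply/eqP; rewrite eqn_leq ab.
- by rewrite /geq /= le_mn.
by apply: perm_trans sd _; rewrite /= m_gt1 n1; apply/permP=> p /=; lia.
Qed.

Theorem theorem2 :
  (forall (k l : nat) (d : k.-tuple nat) (e : l.-tuple nat)
          (d_gt0 : forall i, (0 < tnth d i)%N)
          (e_gt0 : forall i, (0 < tnth e i)%N),
     let P := clements_lindstrom d_gt0 in
     let Q := clements_lindstrom e_gt0 in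
     forall eq_rk : poset_rank P = poset_rank Q,
       macaulay (diamond eq_rk) <->
         poset_iso P Q \/
         (dimension P = 1%N /\ dimension Q = 2%N /\ exists i, tnth e i = 2%N) \/
         (dimension Q = 1%N /\ dimension P = 2%N /\ exists i, tnth d i = 2%N))
  /\
  (forall (m n m' n' : nat)
          (m_gt1 : (1 < m)%N) (le_mn : (m <= n)%N)
          (m'_gt1 : (1 < m')%N) (le_m'n' : (m' <= n')%N),
     macaulay (wedge (grid m_gt1 le_mn) (grid m'_gt1 le_m'n')) <->
       (m <= m' /\ n <= n')%N \/ (m' <= m /\ n' <= n)%N).
Proof.
split=> [k l d e d_gt0 e_gt0 P Q eq_rk|m n m' n' m_gt1 le_mn m'_gt1 le_m'n'].
  have [s [ss s2 sd [f [f_bij f_le f_rk]]]] := cl_box d_gt0.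
  have [t [ts t2 te [g [g_bij g_le g_rk]]]] := cl_box e_gt0.
  have s1 : all (leq 1) s by apply: sub_all s2 => ?; apply: ltnW.
  have t1 : all (leq 1) t by apply: sub_all t2 => ?; apply: ltnW.
  have gl := glued_diamond eq_rk f_bij f_le f_rk g_bij g_le g_rk.
  have sR : box_rank s = poset_rank P by rewrite (presented_rank f_bij f_rk s1).
  have tR : box_rank t = poset_rank P by rewrite eq_rk (presented_rank g_bij g_rk t1).
  have dimP : dimension P = size s by rewrite /dimension (presented_card f_bij f_rk) card_lev1.
  have dimQ : dimension Q = size t by rewrite /dimension (presented_card g_bij g_rk) card_lev1.
  have two_side n (c : n.-tuple nat) (u : seq nat) : perm_eq u [seq i <- c | 1 < i] ->
      (2 \in u) <-> exists i, tnth c i = 2.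
    move=> /perm_mem->; rewrite mem_filter; split=> [/tnthP[i ->]|[i E]]; first by exists i.
    by have := mem_tnth i c; rewrite E.
  have bot_eq x y : rk x = 0 -> rk y = 0 -> diamond_l eq_rk (f x) = diamond_r eq_rk (g y).
    rewrite -f_rk -g_rk => /rank_eq0-> /rank_eq0->; exact: diamond_bot.
  have top_eq x y : rk x = poset_rank P -> rk y = poset_rank P ->
      diamond_l eq_rk (f x) = diamond_r eq_rk (g y).
    rewrite -f_rk -g_rk => /rank_eq_top->; rewrite eq_rk => /rank_eq_top->; exact: diamond_top.
  split=> [/macaulayP[key [key_inj MacD]]|].
    case: (diamond_necessary MacD gl sR tR s2 t2 ss ts) => [st|[p1 q2 t22]|[q1 p2 s22]].
    - left; subst t; have [f' fK fK'] := f_bij; have [g' gK gK'] := g_bij.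
      exists (fun p => g (f' p)); first by exists (fun q => f (g' q)) => z /=; rewrite ?gK ?fK' ?fK.
      by move=> p q; rewrite g_le -f_le !fK'.
    - by right; left; rewrite dimP dimQ; split=> //; split=> //; apply/two_side/t22.
    - by right; right; rewrite dimP dimQ; split=> //; split=> //; apply/two_side/s22.
  case=> [[h h_bij h_le]|[[p1 [q2 e2]]|[q1 [p2 d2]]]].
  - have st : s = t.
      apply: card_lev_inj => // r; rewrite -(presented_card f_bij f_rk) -(presented_card g_bij g_rk).
      have [h' hK hK'] := h_bij; rewrite -(card_imset (level _ r) (can_inj hK)).
      apply: eq_card => q; rewrite -(hK' q) mem_imset; last exact: can_inj hK.
      by rewrite !inE (iso_rank _ h_bij h_le).
    subst t; apply: (diamond_macaulay gl sR tR s1 t1 bot_eq top_eq) => r A S B U r0 _.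
    exact: (two_copies_shadow_min (Mac_two_copies ss s2)).
  - have [b [Es Et]] := path_rect_sides ts s2 t2 (etrans (esym dimP) p1)
      (etrans (esym dimQ) q2) (proj2 (two_side _ _ _ te) e2) (etrans sR (esym tR)).
    subst s t; apply: (diamond_macaulay gl sR tR s1 t1 bot_eq top_eq) => r A S B U r0 rR sA sB iS iU _.
    by apply: (path_rect_shadow_min r0 _ sA sB iS iU); move: rR; rewrite -sR /box_rank /= addn0.
  have [b [Et Es]] := path_rect_sides ss t2 s2 (etrans (esym dimQ) q1)
    (etrans (esym dimP) p2) (proj2 (two_side _ _ _ sd) d2) (etrans tR (esym sR)).
  subst s t; apply: (diamond_macaulay (gluedC gl) tR sR t1 s1) => [y x ry rx|y x ry rx|].
  - exact/esym/bot_eq.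
  - exact/esym/top_eq.
  move=> r A S B U r0 rR sA sB iS iU _.
  by apply: (path_rect_shadow_min r0 _ sA sB iS iU); move: rR; rewrite -tR /box_rank /= addn0.
have [f [f_bij f_le f_rk]] := grid_box m_gt1 le_mn.
have [g [g_bij g_le g_rk]] := grid_box m'_gt1 le_m'n'.
pose W := wedge (grid m_gt1 le_mn) (grid m'_gt1 le_m'n').
(* The successor of every rank stays below [R], so no level counts as an identified top. *)
pose R := (\max_(z : W) rank z).+2.
have rank_lt (z : W) : (rank z).+1 < R by rewrite /R !ltnS (leq_bigmax z).
have gl := glued_wedge R f_bij f_le f_rk g_bij g_le g_rk.
have bot_eq x y : rk x = 0 -> rk y = 0 -> wedge_l _ (f x) = wedge_r _ (g y).
  rewrite -f_rk -g_rk => /rank_eq0-> /rank_eq0->; exact: wedge_bot.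
split=> [/macaulayP[key [key_inj MacW]]|[[mm nn]|[mm nn]]].
- have := wedge_not_crossing gl rank_lt m_gt1 le_mn m'_gt1 le_m'n' MacW.
  have := wedge_not_crossing (gluedC gl) rank_lt m'_gt1 le_m'n' m_gt1 le_mn MacW.
  clear; lia.
- exact: (wedge_sufficient gl rank_lt bot_eq).
- apply: (wedge_sufficient (gluedC gl) rank_lt) => // y x ry rx.
  exact/esym/bot_eq.
Qed.
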